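(* Let $\pi$ be a multiplicative representation of $\Gamma$ (constructed from an irreducible normalized matrix system with inner products $(V_a,H_{ba},B_a)$). Then there exists a positive integer $\alpha\le 3$, depending only on $\pi$, such that for every nonzero smooth vector $v\in\mathcal{H}^\infty$ $$\|\phi_\varepsilon^v\|_2^2\simeq\left(\frac1\varepsilon\right)^{\alpha}\quad\text{as }\varepsilon\to0^+,$$ where $\phi_\varepsilon^v(x)=\langle v,\pi(x)v\rangle e^{-\varepsilon|x|}$ for $x\in\Gamma$, $\varepsilon>0$, so that $\|\phi^v_\varepsilon\|_2^2=\sum_{x\in\Gamma}|\langle v,\pi(x)v\rangle|^2e^{-2\varepsilon|x|}$.
   Context: $\Gamma$ is a non-commutative free group on finitely many generators; $A$ is the finite symmetric set consisting of the free generators and their inverses; $e$ is the identity and $|x|$ is the length of the reduced word of $x\in\Gamma$ in the letters of $A$. Matrix systems. A matrix system $(V_a,H_{ba})$ consists of finite-dimensional complex vector spaces $V_a$ ($a\in A$) and linear maps $H_{ba}:V_a\to V_b$ ($a,b\in A$) with $H_{ba}=0$ whenever $ba=e$. An invariant subsystem is a collection of subspaces $W_a\subseteq V_a$ with $H_{ba}(W_a)\subseteq W_b$ for all $a,b$. The system is irreducible if it is nonzero and its only invariant subsystems are itself and zero. $(V_a,H_{ba},B_a)$ is a normalized system with inner products if each $B_a$ is a strictly positive definite sesquilinear form on $V_a$ (linear in the first variable) and $B_a(v,v)=\sum_{b\in A}B_b(H_{ba}v,H_{ba}v)$ for all $a\in A$, $v\in V_a$. Multiplicative representation. Given an irreducible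 normalized system with inner products, a multiplicative function is a map $f:\Gamma\to\coprod_{a\in A}V_a$ for which there is $N=N(f)$ such that for all $x$ with $|x|\ge N$: $f(xa)\in V_a$ if $|xa|=|x|+1$, and $f(xab)=H_{ba}f(xa)$ if $|xab|=|x|+2$. Two multiplicative functions are identified if they agree at all but finitely many elements of $\Gamma$; $\mathcal{H}^\infty$ is the resulting quotient space; its elements are called smooth vectors. The inner product on $\mathcal{H}^\infty$ is $\langle f_1,f_2\rangle=\sum_{|x|=N}\sum_{a\in A,\,|xa|=|x|+1}B_a(f_1(xa),f_2(xa))$ for $N$ large enough (it does not depend on such $N$), and $\mathcal{H}$ is the completion. The multiplicative representation $\pi$ is the unitary representation of $\Gamma$ on $\mathcal{H}$ extending $(\pi(y)f)(x)=f(y^{-1}x)$ for $f\in\mathcal{H}^\infty$. Notation. $\|\phi_\varepsilon^v\|_2^2\simeq\varepsilon^{-\alpha}$ as $\varepsilon\to0^+$ means that there are positive constants $c_1,c_2$, possibly depending on $v$, with $c_1\varepsilon^{-\alpha}\le\|\phi_\varepsilon^v\|_2^2\le c_2\varepsilon^{-\alpha}$ for all sufficiently small $\varepsilon>0$. *)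

(* Defs.v *)
From HB Require Import structures.
From mathcomp Require Import all_boot all_order all_algebra.
From mathcomp Require Import generic_quotient sesquilinear.
From mathcomp Require Import complex.
From mathcomp Require Import all_classical all_reals all_analysis.

Set Implicit Arguments.
Unset Strict Implicit.
Unset Printing Implicit Defensive.
Import Order.TTheory GRing.Theory Num.Theory.
Import numFieldNormedType.Exports.
Local Open Scope classical_set_scope.
Local Open Scope ring_scope.

(* The free group on [X]: reduced words in the generators [(x, true)] and their
   formal inverses [(x, false)]. *)
Notation letter X := (X * bool)%type.

Section FreeGroup.
Variable X : choiceType.
Local Notation letter := (letter X).

Definition linv (a : letter) : letter := (a.1, ~~ a.2).

Definition reduced (w : seq letter) : bool :=
  sorted (fun a b => b != linv a) w.

Record freeGroup := FreeGroup { word : seq letter; word_reduced : reduced word }.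
HB.instance Definition _ := [isSub for word].
HB.instance Definition _ := [Choice of freeGroup by <:].

(* Product of the letter [a] with the reduced word [w]. *)
Definition push (a : letter) (w : seq letter) : seq letter :=
  if w is b :: w' then if b == linv a then w' else a :: w else [:: a].

Lemma linvK : involutive linv.
Proof. by case=> x b; rewrite /linv /= negbK. Qed.

Lemma push_reduced a w : reduced w -> reduced (push a w).
Proof.
case: w => [|b w] //= bw; case: ifPn => [_|ba]; last by rewrite /= ba.
exact: path_sorted bw.
Qed.

Lemma mul_reduced u v : reduced v -> reduced (foldr push v u).
Proof. by move=> rv; elim: u => //= a u; exact: push_reduced. Qed.

Lemma pushK a w : reduced w -> push a (push (linv a) w) = w.
Proof.
case: w => [|b w] /=; first by rewrite eqxx.
rewrite linvK; have [-> {b}|ba _] := eqVneq b a; last by rewrite /= eqxx.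
by case: w => [|c w] //= /andP[/negbTE ->].
Qed.

Lemma push_mul a u v : reduced v -> reduced u ->
  foldr push v (push a u) = push a (foldr push v u).
Proof.
move=> rv; case: u => [|b u] //= bu; case: eqVneq => [->|//].
by rewrite pushK // mul_reduced.
Qed.

Lemma mul_mul u v w : reduced v -> reduced w ->
  foldr push w (foldr push v u) = foldr push (foldr push w v) u.
Proof.
by move=> rv rw; elim: u => //= a u IHu; rewrite push_mul ?mul_reduced ?IHu.
Qed.

Lemma mul_cat u v : reduced (u ++ v) -> foldr push v u = u ++ v.
Proof.
elim: u => //= a u IHu auv; rewrite IHu; last exact: path_sorted auv.
by case: (u ++ v) auv => //= b t /andP[/negbTE ->].
Qed.

Lemma mulw1 u : reduced u -> foldr push [::] u = u.
Proof. by move=> ru; rewrite mul_cat ?cats0. Qed.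

Definition winv (u : seq letter) : seq letter := rev (map linv u).

Lemma winv_reduced u : reduced u -> reduced (winv u).
Proof.
rewrite /reduced /winv rev_sorted sorted_map; apply: sub_sorted => a b ba.
by change (linv a != linv (linv b)); rewrite linvK eq_sym.
Qed.

Lemma mulwV u : reduced u -> foldr push (winv u) u = [::].
Proof.
suff mulK v w : reduced w -> foldr push (foldr push w (winv v)) v = w.
  by move=> ru; rewrite -{1}[winv u]mulw1 ?mulK ?winv_reduced.
elim: v w => //= a v IHv w rw; rewrite /winv map_cons rev_cons -cats1.
rewrite foldr_cat IHv ?push_reduced //=; exact: pushK.
Qed.

Lemma winvK : involutive winv.
Proof. by move=> u; rewrite /winv map_rev revK (mapK linvK). Qed.

Lemma mulwVl u : reduced u -> foldr push u (winv u) = [::].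
Proof. by move=> ru; rewrite -{1}[u]winvK mulwV ?winv_reduced. Qed.

Definition fone : freeGroup := @FreeGroup [::] isT.
Definition fmul (x y : freeGroup) : freeGroup :=
  FreeGroup (mul_reduced (word x) (word_reduced y)).
Definition finv (x : freeGroup) : freeGroup :=
  FreeGroup (winv_reduced (word_reduced x)).

Lemma fmulA : associative fmul.
Proof.
by move=> x y z; apply: val_inj; rewrite /= mul_mul ?word_reduced.
Qed.
Lemma fmul1 : left_id fone fmul.
Proof. by move=> x; exact: val_inj. Qed.
Lemma fmulr1 : right_id fone fmul.
Proof. by move=> x; apply: val_inj; exact: mulw1 (word_reduced x). Qed.
Lemma fmulV : left_inverse fone finv fmul.
Proof. by move=> x; apply: val_inj; exact: mulwVl (word_reduced x). Qed.
Lemma fmulrV : right_inverse fone finv fmul.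
Proof. by move=> x; apply: val_inj; exact: mulwV (word_reduced x). Qed.

HB.instance Definition _ := isGroup.Build freeGroup fmulA fmul1 fmulr1 fmulV fmulrV.

Definition gen (a : letter) : freeGroup := @FreeGroup [:: a] isT.

Definition len (x : freeGroup) : nat := size (word x).

End FreeGroup.

Section FreeGroupLength.
Variable X : choiceType.
Implicit Types (x y : freeGroup X) (a b : letter X).

(* The last letter of the reduced word, and an arbitrary letter at [1]. *)
Definition last_letter (a0 : letter X) x : letter X := last a0 (word x).

Lemma size_push a w : ((size w).-1 <= size (push a w))%N.
Proof. by case: w => //= b w; case: ifP => //= _; rewrite ltnW. Qed.

Lemma last_push a0 a w : (1 < size w)%N -> last a0 (push a w) = last a0 w.
Proof. by case: w => [|b [|c w]] //= _; case: ifP. Qed.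

Lemma size_mul u v : (size v - size u <= size (foldr (@push X) v u))%N.
Proof.
elim: u => [|a u IHu] /=; first by rewrite subn0.
by apply: leq_trans (size_push _ _); rewrite subnS -!subn1 leq_sub2r.
Qed.

Lemma leq_len_mul y x : (len (y * x)%g <= len y + len x)%N.
Proof.
rewrite /len /=; elim: (word y) => //= a u; rewrite addSn -ltnS.
apply: leq_trans; case: (foldr _ _ _) => //= b w.
by case: ifP => //= _; rewrite -addn2 leq_addr.
Qed.

Lemma last_mul a0 u v : (size u < size v)%N ->
  last a0 (foldr (@push X) v u) = last a0 v.
Proof.
elim: u => //= a u IHu uv; rewrite last_push ?IHu ?(ltnW uv) //.
by apply: leq_trans (size_mul u v); rewrite ltn_subRL addn1.
Qed.

Lemma len_mul y x : (len x - len y <= len (y * x)%g)%N.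
Proof. exact: size_mul. Qed.

Lemma last_letter_mul a0 y x : (len y < len x)%N ->
  last_letter a0 (y * x)%g = last_letter a0 x.
Proof. exact: last_mul. Qed.

Lemma len_finv x : len (x^-1)%g = len x.
Proof. by rewrite /len /= /winv size_rev size_map. Qed.

Lemma gen_linv a : (gen a * gen (linv a) = 1)%g.
Proof. by apply: val_inj; rewrite /= eqxx. Qed.

Lemma word_mul_gen x a : reduced (rcons (word x) a) ->
  word (x * gen a)%g = rcons (word x) a.
Proof. by rewrite -cats1 => xa; exact: mul_cat. Qed.

Lemma split_last x : (0 < len x)%N ->
  exists2 y, (len y).+1 = len x &
    forall a0, x = (y * gen (last_letter a0 x))%g
               /\ reduced (rcons (word y) (last_letter a0 x)).
Proof.
case: x => w rw; rewrite /len /last_letter /=.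
case: (lastP w) rw => // u a rua _.
have ru : reduced u.
  by move: rua; rewrite /reduced -cats1 => /cat_sorted2[].
exists (FreeGroup ru) => [|a0]; rewrite ?size_rcons ?last_rcons //; split => //.
by apply: val_inj; rewrite /= -cats1 mul_cat ?cats1.
Qed.

Lemma reduced_rcons a0 w a : reduced w ->
  reduced (rcons w a) = (w == [::]) || (a != linv (last a0 w)).
Proof.
case: w => //= b w rw.
by rewrite /reduced /= rcons_path; move: rw; rewrite /reduced /= => ->.
Qed.

Lemma len_mul_gen a0 x a :
  (len (x * gen a)%g == (len x).+1) = (len x == 0%N) || (a != linv (last_letter a0 x)).
Proof.
have [x0|x0] := posnP (len x).
  by rewrite {1}/len /= (size0nil x0) x0.
have [y yx /(_ a0)[xE ry]] := split_last x0.
have [aE|aN] /= := eqVneq a (linv (last_letter a0 x)).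
  by rewrite xE -mulgA aE gen_linv mulg1 -xE -yx -addn2 -[X in X == _]addn0
             eqn_add2l.
rewrite {1}/len word_mul_gen ?size_rcons ?eqxx //.
by rewrite (reduced_rcons a0) ?word_reduced // aN orbT.
Qed.

Lemma len_mul_gen2 x a b : len (x * gen a * gen b)%g = (len x).+2 ->
  len (x * gen a)%g = (len x).+1 /\
  len (x * gen a * gen b)%g = (len (x * gen a)%g).+1.
Proof.
move=> xab; have := leq_len_mul (x * gen a)%g (gen b).
have := leq_len_mul x (gen a); rewrite !addn1 xab ltnS => xa ax.
suff -> : len (x * gen a)%g = (len x).+1 by [].
by apply/eqP; rewrite eqn_leq xa.
Qed.

Lemma last_letter_mul_gen a0 x a : len (x * gen a)%g = (len x).+1 ->
  last_letter a0 (x * gen a)%g = a.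
Proof.
move/eqP; rewrite (len_mul_gen a0) => xa.
rewrite /last_letter word_mul_gen ?last_rcons //.
by rewrite (reduced_rcons a0) ?word_reduced // -size_eq0.
Qed.

End FreeGroupLength.

Lemma finite_ball (X : finType) (N : nat) :
  finite_set [set x : freeGroup X | (len x <= N)%N].
Proof.
pose f (w : N.-bseq (letter X)) : freeGroup X := insubd (fone X) (bseqval w).
apply: (@sub_finite_set _ _ (f @` setT)); last exact/finite_image/finite_finset.
move=> x /= xN; exists (insub_bseq N (word x)) => //.
by rewrite /f /insub_bseq insubdK ?unfold_in //= valKd.
Qed.

(* Rank [n.+2]: the non-commutative free groups of finite rank. *)
Notation Gamma n := (freeGroup 'I_n.+2).
Notation alphabet n := (letter 'I_n.+2).

Record matrixSystem (R : realType) (n : nat) := MatrixSystem {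
  sysV : alphabet n -> vectType R[i];
  sysH : forall b a : alphabet n, 'Hom(sysV a, sysV b);
  sysH_eq0 : forall b a : alphabet n, (gen b * gen a = 1)%g -> sysH b a = 0 }.

Section MatrixSystem.
Variables (R : realType) (n : nat) (S : matrixSystem R n).

Definition invariant_subsystem (W : forall a, {vspace (sysV S a)}) : Prop :=
  forall b a, (sysH S b a @: W a <= W b)%VS.

Definition irreducible_system : Prop :=
  (exists a, {:sysV S a}%VS <> 0%VS) /\
  forall W : (forall a, {vspace (sysV S a)}), invariant_subsystem W ->
    (forall a, W a = 0%VS) \/ (forall a, W a = {:sysV S a}%VS).

End MatrixSystem.

(* [{dot V for conj}] is linear in the first variable. *)
Record normalizedSystem (R : realType) (n : nat) := NormalizedSystem {
  system :> matrixSystem R n;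
  sysB : forall a, {dot (sysV system a) for (@Num.conj R[i])};
  sysB_normalized : forall a (v : sysV system a),
        sysB a v v = \sum_b sysB b (sysH system b a v) (sysH system b a v) }.

Section Smooth.
Variables (R : realType) (n : nat) (S : matrixSystem R n).
Local Notation V := (sysV S).
Implicit Types (x y : Gamma n) (a b : alphabet n).

Definition coprod : Type := {a : alphabet n & V a}.

(* The component of [u] in [V a], which is [0] if [u] lies in another summand. *)
Definition component a (u : coprod) : V a := 
  @untag (alphabet n) (fun b => V b) (V a) 0 a id u.

Definition multiplicative_from (N : nat) (f : Gamma n -> coprod) : Prop :=
  forall x, (N <= len x)%N ->
    (forall a, len (x * gen a)%g = (len x).+1 -> tag (f (x * gen a)%g) = a) /\
    (forall a b, len (x * gen a * gen b)%g = (len x).+2 ->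
      f (x * gen a * gen b)%g =
        Tagged V (sysH S b a (component a (f (x * gen a)%g)))).

Record multfun := MultFun {
  multfun_val :> Gamma n -> coprod;
  _ : exists N, multiplicative_from N multfun_val }.
HB.instance Definition _ := gen_eqMixin multfun.
HB.instance Definition _ := gen_choiceMixin multfun.

Lemma multfunP (f : multfun) : exists N, multiplicative_from N f.
Proof. by case: f. Qed.

Definition agree (f g : multfun) : bool := `[< finite_set [set x | f x <> g x] >].

Lemma agreeP (f g : multfun) :
  reflect (exists N, forall x, (N <= len x)%N -> f x = g x) (agree f g).
Proof.
apply: (iffP (asboolP _)) => [/finite_fsetP[F FE]|[N fgN]].
  exists (\max_(x <- finmap.enum_fset F) len x).+1 => x lex; apply: contrapT => fg.
  have xF : x \in finmap.enum_fset F by move: fg; rewrite -[_ <> _]/([set z | f z <> g z] x) FE.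
  by move: lex; rewrite ltnNge leq_bigmax_seq.
apply: (sub_finite_set _ (@finite_ball _ N)) => x /= fgx.
by rewrite leqNgt; apply/negP => /ltnW /fgN.
Qed.

Lemma agree_refl : reflexive agree.
Proof. by move=> f; apply/agreeP; exists 0%N. Qed.
Lemma agree_sym : symmetric agree.
Proof.
by move=> f g; apply/agreeP/agreeP => -[N fg]; exists N => x /fg.
Qed.
Lemma agree_trans : transitive agree.
Proof.
move=> g f h /agreeP[N fg] /agreeP[M gh]; apply/agreeP; exists (maxn N M) => x.
by rewrite geq_max => /andP[/fg -> /gh].
Qed.

Canonical agree_equiv := EquivRel agree agree_refl agree_sym agree_trans.

Definition smooth := {eq_quot agree}%qT.
HB.instance Definition _ := Choice.on smooth.
HB.instance Definition _ := EqQuotient.on smooth.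

Local Notation cl f := (\pi_smooth f)%qT.

Lemma smooth_eqP (f g : multfun) :
  (cl f = cl g) <-> exists N, forall x, (N <= len x)%N -> f x = g x.
Proof. by split=> [/eqmodP/agreeP|fg]; last exact/eqmodP/agreeP. Qed.

Lemma smoothW (P : smooth -> Prop) : (forall f, P (cl f)) -> forall u, P u.
Proof. by move=> Pcl u; rewrite -[u]reprK. Qed.

Lemma componentT a (v : V a) : component a (Tagged V v) = v.
Proof. by rewrite /component (untagE _ _ (erefl : tag (Tagged V v) = a)). Qed.

Lemma componentK a u : tag u = a -> Tagged V (component a u) = u.
Proof. by move=> ua; rewrite /component untagE etaggedK. Qed.

Local Notation ell := (last_letter (ord0, true) : Gamma n -> alphabet n).

Lemma ell_eq (F : forall a, V a) y a : ell y = a ->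
  Tagged V (F (ell y)) = Tagged V (F a).
Proof. by move=> ->. Qed.

Lemma multfun_tag f N x : multiplicative_from N f -> (N < len x)%N ->
  tag (f x) = ell x.
Proof.
move=> fN Nx; have [y yx yP] := split_last (leq_ltn_trans (leq0n N) Nx).
have [xE _] := yP (ord0, true).
have Ny : (N <= len y)%N by rewrite -ltnS yx.
rewrite {1}xE; apply: (fN y Ny).1; by rewrite -xE yx.
Qed.

Definition mzero_fun y : coprod := Tagged V (0 : V (ell y)).

(* For large [y] both [f y] and [g y] lie in the summand of the last letter of [y]. *)
Definition mlin_fun (c : R[i]) (f g : Gamma n -> coprod) y : coprod :=
  Tagged V (c *: component (ell y) (f y) + component (ell y) (g y)).

Lemma mzero_subproof : exists N, multiplicative_from N mzero_fun.
Proof.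
exists 0%N => x _; split=> [a|a b /len_mul_gen2[xa xab]].
  exact: last_letter_mul_gen.
rewrite /mzero_fun (ell_eq (fun=> 0) (last_letter_mul_gen _ xab)).
rewrite (ell_eq (fun=> 0) (last_letter_mul_gen _ xa)).
by rewrite componentT linear0.
Qed.

Lemma mlin_subproof c (f g : multfun) :
  exists N, multiplicative_from N (mlin_fun c f g).
Proof.
have [[N fN] [M gM]] := (multfunP f, multfunP g).
exists (maxn N M) => x; rewrite geq_max => /andP[/fN[_ fx] /gM[_ gx]].
split=> [a|a b xab]; first exact: last_letter_mul_gen.
have [xa_len xab_len] := len_mul_gen2 xab.
pose F y a := c *: component a (f y) + component a (g y).
rewrite /mlin_fun (ell_eq (F _) (last_letter_mul_gen _ xab_len)).
rewrite (ell_eq (F _) (last_letter_mul_gen _ xa_len)) componentT /F.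
by rewrite fx // gx // !componentT linearP.
Qed.

Definition mzero := MultFun mzero_subproof.
Definition mlin c f g := MultFun (mlin_subproof c f g).

Definition smooth_zero : smooth := cl mzero.
Definition smooth_lin c (u v : smooth) : smooth := cl (mlin c (repr u) (repr v)).

Lemma smooth_linE c f g : smooth_lin c (cl f) (cl g) = cl (mlin c f g).
Proof.
apply/smooth_eqP.
have /smooth_eqP[N fN] : cl (repr (cl f)) = cl f by rewrite reprK.
have /smooth_eqP[M gM] : cl (repr (cl g)) = cl g by rewrite reprK.
exists (maxn N M) => x; rewrite geq_max => /andP[Nx Mx].
by rewrite /= /mlin_fun fN // gM.
Qed.

Definition smooth_add := smooth_lin 1.
Definition smooth_opp u := smooth_lin (-1) u smooth_zero.
Definition smooth_scale c u := smooth_lin c u smooth_zero.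

Lemma smooth_addE f g : smooth_add (cl f) (cl g) = cl (mlin 1 f g).
Proof. exact: smooth_linE. Qed.
Lemma smooth_oppE f : smooth_opp (cl f) = cl (mlin (-1) f mzero).
Proof. exact: smooth_linE. Qed.
Lemma smooth_scaleE c f : smooth_scale c (cl f) = cl (mlin c f mzero).
Proof. exact: smooth_linE. Qed.

Lemma multfun_large (f : multfun) : exists N, forall x, (N <= len x)%N ->
  f x = Tagged V (component (ell x) (f x)).
Proof.
have [N fN] := multfunP f; exists N.+1 => x Nx; rewrite componentK //.
exact: multfun_tag Nx.
Qed.



Lemma smooth_addA : associative smooth_add.
Proof.
move=> u v w; elim/smoothW: u => f; elim/smoothW: v => g; elim/smoothW: w => h.
rewrite !smooth_addE; apply/smooth_eqP; exists 0%N => x _.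
by rewrite /= /mlin_fun !componentT !scale1r addrA.
Qed.

Lemma smooth_addC : commutative smooth_add.
Proof.
move=> u v; elim/smoothW: u => f; elim/smoothW: v => g.
rewrite !smooth_addE; apply/smooth_eqP; exists 0%N => x _.
by rewrite /= /mlin_fun !scale1r addrC.
Qed.

Lemma smooth_add0 : left_id smooth_zero smooth_add.
Proof.
move=> u; elim/smoothW: u => f.
rewrite /smooth_zero smooth_addE; apply/smooth_eqP.
have [N fN] := multfun_large f; exists N => x /fN ->.
by rewrite /= /mlin_fun !componentT scaler0 add0r.
Qed.

Lemma smooth_addN : left_inverse smooth_zero smooth_opp smooth_add.
Proof.
move=> u; elim/smoothW: u => f.
rewrite smooth_oppE smooth_addE; apply/smooth_eqP.
exists 0%N => x _; rewrite /= /mlin_fun /mzero_fun !componentT.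
by rewrite addr0 scale1r scaleN1r addNr.
Qed.

HB.instance Definition _ := GRing.isZmodule.Build smooth
  smooth_addA smooth_addC smooth_add0 smooth_addN.

Lemma smooth_scaleA c d u : smooth_scale c (smooth_scale d u) = smooth_scale (c * d) u.
Proof.
elim/smoothW: u => f; rewrite !smooth_scaleE; apply/smooth_eqP.
exists 0%N => x _; rewrite /= /mlin_fun /mzero_fun !componentT.
by rewrite !addr0 scalerA.
Qed.

Lemma smooth_scale1 : left_id 1 smooth_scale.
Proof.
move=> u; elim/smoothW: u => f; rewrite !smooth_scaleE; apply/smooth_eqP.
have [N fN] := multfun_large f; exists N => x /fN ->.
by rewrite /= /mlin_fun /mzero_fun !componentT scale1r addr0.
Qed.

Lemma smooth_scaleDr : right_distributive smooth_scale +%R.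
Proof.
move=> c; elim/smoothW=> f; elim/smoothW=> g.
change (smooth_scale c (smooth_add (cl f) (cl g)) =
  smooth_add (smooth_scale c (cl f)) (smooth_scale c (cl g))).
rewrite (smooth_addE f g) !smooth_scaleE smooth_addE.
apply/smooth_eqP; exists 0%N => x _; rewrite /= /mlin_fun /mzero_fun !componentT.
by rewrite !addr0 !scale1r scalerDr.
Qed.

Lemma smooth_scaleDl u : {morph smooth_scale^~ u : c d / c + d}.
Proof.
rewrite -[u]reprK; move: (repr u) => f c d /=.
change (smooth_scale (c + d) (cl f) =
  smooth_add (smooth_scale c (cl f)) (smooth_scale d (cl f))).
rewrite !smooth_scaleE smooth_addE.
apply/smooth_eqP; exists 0%N => x _; rewrite /= /mlin_fun /mzero_fun !componentT.
by rewrite !addr0 !scale1r scalerDl.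
Qed.

HB.instance Definition _ := GRing.Zmodule_isLmodule.Build R[i] smooth
  smooth_scaleA smooth_scale1 smooth_scaleDr smooth_scaleDl.

Lemma translate_subproof y (f : multfun) :
  exists N, multiplicative_from N (fun x => f (y^-1 * x)%g).
Proof.
have [N fN] := multfunP f; exists (N + len y).+1 => x Nx.
have yx : (len y < len x)%N by apply: leq_ltn_trans Nx; exact: leq_addl.
have Nyx : (N < len (y^-1 * x)%g)%N.
  by apply: leq_trans (len_mul _ _); rewrite len_finv ltn_subRL addnC.
have [fx fxx] := fN _ (ltnW Nyx).
have lenyx z a : (len y < len z)%N -> (0 < len (y^-1 * z)%g)%N ->
    (len (y^-1 * z * gen a)%g == (len (y^-1 * z)%g).+1) =
    (len (z * gen a)%g == (len z).+1).
  move=> yz z0; rewrite !(len_mul_gen (ord0, true)) last_letter_mul ?len_finv //.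
  by rewrite !gtn_eqF // (leq_ltn_trans _ yz).
split=> [a xa|a b /len_mul_gen2[xa xab]]; rewrite !mulgA.
  by apply: fx; apply/eqP; rewrite lenyx ?xa // (leq_ltn_trans _ Nyx).
have yxa : len (y^-1 * x * gen a)%g = (len (y^-1 * x)%g).+1.
  by apply/eqP; rewrite lenyx ?xa // (leq_ltn_trans _ Nyx).
apply: fxx; rewrite -yxa; apply/eqP.
have := lenyx (x * gen a)%g b; rewrite mulgA => ->; rewrite ?xab //.
- by rewrite xa ltnW.
- by rewrite yxa.
Qed.

Definition translate y (f : multfun) : multfun := MultFun (translate_subproof y f).

(* [(pi y f) x = f (y^-1 * x)] on smooth vectors. *)
Definition smooth_rep y (u : smooth) : smooth := cl (translate y (repr u)).

Lemma smooth_repE y f : smooth_rep y (cl f) = cl (translate y f).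
Proof.
apply/smooth_eqP.
have /smooth_eqP[N fN] : cl (repr (cl f)) = cl f by rewrite reprK.
exists (N + len y)%N => x Nx /=; apply: fN.
by apply: leq_trans (len_mul _ _); rewrite len_finv leq_subRL ?(addnC (len y)) //;
   apply: leq_trans Nx; exact: leq_addl.
Qed.

End Smooth.

Section InnerProduct.
Variables (R : realType) (n : nat) (S : normalizedSystem R n).
Implicit Types (f g : multfun S) (u v : smooth S).

Definition sphere_form (N : nat) f g : R[i] :=
  \sum_(x \in [set x : Gamma n | len x = N])
    \sum_(a : alphabet n | len (x * gen a)%g == (len x).+1)
      sysB S a (component a (f (x * gen a)%g)) (component a (g (x * gen a)%g)).

Local Notation ell := (last_letter (ord0, true) : Gamma n -> alphabet n).
Local Notation V := (sysV S).
Local Notation H := (sysH S).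

Lemma form_polar a (v w : V a) :
  sysB S a v w = \sum_b sysB S b (H b a v) (H b a w).
Proof.
pose D (v w : V a) := sysB S a v w - \sum_b sysB S b (H b a v) (H b a w).
have D0 z : D z z = 0 by rewrite /D sysB_normalized subrr.
have DD x y z : D (x + y) z = D x z + D y z.
  rewrite /D linearDl; under eq_bigr do rewrite linearD linearDl.
  by rewrite big_split /= opprD addrACA.
have DDr x y z : D z (x + y) = D z x + D z y.
  rewrite /D linearDr; under eq_bigr do rewrite linearD linearDr.
  by rewrite big_split /= opprD addrACA.
have DZ c x z : D (c *: x) z = c * D x z.
  rewrite /D linearZl_LR; under eq_bigr do rewrite linearZ linearZl_LR.
  by rewrite -mulr_sumr -mulrBr.
have DZr c x z : D z (c *: x) = (Num.conj c) * D z x.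
  rewrite /D linearZr_LR /=; under eq_bigr do rewrite linearZ linearZr_LR /=.
  by rewrite -mulr_sumr -mulrBr.
have E1 : D v w + D w v = 0.
  by have := D0 (v + w); rewrite DD !DDr !D0 add0r addr0.
have E2 : 'i * D v w - 'i * D w v = 0.
  have := D0 ('i *: v + w).
  by rewrite DD !DDr !D0 add0r addr0 DZ DZr conjCi mulNr.
apply/eqP; rewrite -subr_eq0; apply/eqP; change (D v w = 0).
have E3 : D v w = D w v.
  by apply: (mulfI (neq0Ci _)); apply/eqP; rewrite -subr_eq0 E2.
move: E1; rewrite -E3 -mulr2n => /eqP; by rewrite mulrn_eq0 => /eqP.
Qed.

Definition last_form f g (y : Gamma n) : R[i] :=
  sysB S (ell y) (component (ell y) (f y)) (component (ell y) (g y)).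

Lemma last_form_eq f g y a : ell y = a ->
  last_form f g y = sysB S a (component a (f y)) (component a (g y)).
Proof. by move=> <-. Qed.

Lemma sphere_fin N : finite_set [set x : Gamma n | len x = N].
Proof. by apply: (sub_finite_set _ (@finite_ball _ N)) => x /= ->. Qed.

Lemma sphere_formE N f g : sphere_form N f g =
  \sum_(y \in [set y : Gamma n | len y = N.+1]) last_form f g y.
Proof.
pose D := [set p : Gamma n * alphabet n | len p.1 = N /\ len (p.1 * gen p.2)%g = N.+1].
pose h (p : Gamma n * alphabet n) : Gamma n := (p.1 * gen p.2)%g.
have hD : set_bij D [set y : Gamma n | len y = N.+1] h.
  split.
  - by move=> [x a] [].
  - move=> [x a] [y b]; rewrite !inE /h /= => -[/= xN xa] [/= yN yb] xy.
    have ab : a = b.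
      rewrite -(@last_letter_mul_gen _ (ord0, true) x a) ?xa ?xN //.
      by rewrite xy last_letter_mul_gen // yb yN.
    by move: xy; rewrite ab => /mulIg ->.
  - move=> y /= yN; have [x xy /(_ (ord0, true))[yE _]] : exists2 x, _ & _ :=
      split_last (ltac:(by rewrite yN) : (0 < len y)%N).
    exists (x, ell y) => //=; split=> /=; last by rewrite -yE.
    by move: xy; rewrite yN => -[].
rewrite (reindex_fsbig h D) //.
rewrite /sphere_form.
pose Q : set (alphabet n) := [set` index_enum (alphabet n)].
have QT a : Q a by rewrite /Q /= mem_index_enum.
have Qfin : finite_set Q by exact/finite_finset.
pose K := [set p : Gamma n * alphabet n | len (p.1 * gen p.2)%g = N.+1].
have -> : D = ([set x : Gamma n | len x = N] `*` Q) `&` K.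
  by apply/seteqP; split=> [[x a] [] //|[x a] [[] //]].
rewrite fsbig_mkcondr.
rewrite -(@pair_fsbig _ _ _ _ _ _ Q (fun x a => if (x, a) \in K then last_form f g (h (x, a)) else 0)) //; last exact: sphere_fin.
apply: eq_fsbigr => x; rewrite inE /= => xN.
rewrite big_mkcond fsbig_seq ?index_enum_uniq //; apply: eq_fsbigr => a _.
rewrite xN (_ : ((x, a) \in K) = (len (x * gen a)%g == N.+1)); last first.
  by apply/idP/eqP; rewrite inE.
case: eqP => // xa; rewrite /h /=.
by rewrite (last_form_eq f g (a := a)) // last_letter_mul_gen // xa xN.
Qed.

Lemma sphere_form_stable f g :
  exists N0, forall N, (N0 <= N)%N -> sphere_form N f g = sphere_form N0 f g.
Proof.
have [[N fN] [M gM]] := (multfunP f, multfunP g).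
exists (maxn N M); suff st k : (maxn N M <= k)%N -> sphere_form k.+1 f g = sphere_form k f g.
  elim=> [|k IHk]; first by rewrite leqn0 => /eqP ->.
  rewrite leq_eqVlt => /predU1P[-> //|]; rewrite ltnS => /[dup] /IHk <-; exact: st.
rewrite geq_max => /andP[Nk Mk].
rewrite [RHS]sphere_formE /sphere_form; apply: eq_fsbigr => y; rewrite inE /= => yk.
have [x xy /(_ (ord0, true))[yE ry]] : exists2 x, _ & _ :=
      split_last (ltac:(by rewrite yk) : (0 < len y)%N).
set a := ell y in yE ry.
have xk : len x = k by move: xy; rewrite yk => -[].
rewrite (last_form_eq f g (erefl a)) form_polar [RHS](bigID (fun b => len (y * gen b)%g == (len y).+1)) /=.
rewrite [X in _ + X]big1 ?addr0.
  apply: eq_bigr => b /eqP yb.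
  have xab : len (x * gen a * gen b)%g = (len x).+2 by rewrite -yE yb xy.
  have [Nx Mx] : (N <= len x)%N /\ (M <= len x)%N by rewrite xk.
  by rewrite yE (fN x Nx).2 // (gM x Mx).2 // !componentT.
move=> b; rewrite (len_mul_gen (ord0, true)) yk /= negbK => /eqP ->.
have H0 : H (linv (ell y)) a = 0.
  apply: sysH_eq0; have := gen_linv (linv a); by rewrite linvK.
by rewrite -/a H0 !lfunE /= linear0r.
Qed.

(* The common value of [sphere_form N] for all large enough [N]. *)
Definition smooth_form u v : R[i] :=
  xget 0 [set c | exists N0, forall N, (N0 <= N)%N ->
                    sphere_form N (repr u) (repr v) = c].

Lemma smooth_formE f g : exists N0, forall N, (N0 <= N)%N ->
  smooth_form (\pi_(smooth S)%qT f) (\pi_(smooth S)%qT g) = sphere_form N f g.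
Proof.
pose f' := repr (\pi_(smooth S)%qT f); pose g' := repr (\pi_(smooth S)%qT g).
have /smooth_eqP[N fN] : \pi_(smooth S)%qT f' = \pi_(smooth S)%qT f by rewrite reprK.
have /smooth_eqP[M gM] : \pi_(smooth S)%qT g' = \pi_(smooth S)%qT g by rewrite reprK.
have [N0 fgN0] := sphere_form_stable f g.
have E k : (maxn N0 (maxn N M) <= k)%N -> sphere_form k f' g' = sphere_form N0 f g.
  rewrite !geq_max => /and3P[N0k Nk Mk]; rewrite -(fgN0 k) // !sphere_formE.
  apply: eq_fsbigr => y; rewrite inE /= => yk.
  by rewrite /last_form fN ?gM ?yk ?leqW.
exists N0 => k /fgN0 ->; rewrite /smooth_form; case: xgetP.
  move=> c _ [K cK].
  have := cK _ (leq_maxl K (maxn N0 (maxn N M))); rewrite -/f' -/g' E //.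
  exact: leq_maxr.
by move=> /(_ (sphere_form N0 f g)) []; exists (maxn N0 (maxn N M)) => k' /E.
Qed.

End InnerProduct.

(* The completion of the pre-Hilbert space [smooth S], given by a Hilbert space
   with an isometric dense embedding of [smooth S], hence determined up to a
   unique unitary map, together with the unitary representation extending
   [smooth_rep]. *)
Record multiplicativeRep (R : realType) (n : nat) (S : normalizedSystem R n) :=
MultiplicativeRep {
  hspace : completeNormedModType R[i];
  inner : {dot hspace for (@Num.conj R[i])};
  norm_inner : forall h : hspace, `|h| ^+ 2 = inner h h;
  embed : {linear smooth S -> hspace};
  embed_isometry : forall u v, inner (embed u) (embed v) = smooth_form u v;
  embed_dense : dense (range embed);
  rep : Gamma n -> {linear hspace -> hspace};
  rep1 : forall h, rep 1%g h = h;
  repM : forall x y h, rep (x * y)%g h = rep x (rep y h);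
  rep_unitary : forall x h k, inner (rep x h) (rep x k) = inner h k;
  rep_smooth : forall y u, rep y (embed u) = embed (smooth_rep y u) }.

Section Coefficients.
Variables (R : realType) (n : nat) (S : normalizedSystem R n).
Variable pi : multiplicativeRep S.

Definition damped_coef (eps : R) (v : smooth S) (x : Gamma n) : R[i] :=
  inner pi (embed pi v) (rep pi x (embed pi v)) *
  (expR (- eps * (len x)%:R))%:C%C.

End Coefficients.

Definition l2norm_sq (R : realType) (T : choiceType) (phi : T -> R[i]) : \bar R :=
  \esum_(x in [set: T]) (Normc.normc (phi x) ^+ 2)%:E.

(* Main.v *)
(** Let [N_k(u, v)] be the sum of [|<u, pi(x) v>|^2] over [|x| = k], and
    [S(r) = sum_k N_k(v, v) r^k], so that the squared norm of the damped
    coefficient is [S(exp(-2 eps))].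

    Seen from far out along a reduced word, a smooth vector is determined by its
    value there together with one more vector, which records its pairings with
    the multiplicative functions that continue in the backward direction. These
    states evolve linearly, so [N_k(v, v)] satisfies a linear recurrence, [S] is
    a rational function, and [S(r)] has exact order [(1 - r)^(- alpha)] at [1]
    for some integer [alpha].

    Splitting the sphere according to the point where it leaves the geodesic from
    [1] to [x], the Cauchy-Schwarz inequality gives
    [N_k(u, v) <= (k + 1)^2 |u|^2 |v|^2], hence [alpha <= 3].

    For [m >= 1], the vectors [u] for which [sum_k N_k(u, v) r^k] is
    [O((1 - r)^(- m))] form a subspace that is invariant under the group and also
    under restriction to the words with a prescribed first letter, because
    restriction costs only an error whose sums over spheres are bounded. By
    irreducibility of the matrix system such a subspace is zero or everything,
    so [alpha] does not depend on [v] as soon as it is positive.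

    If [alpha] were [0] for some [v <> 0], then [N_k(v, v)] would tend to [0],
    hence decay exponentially by the recurrence. By Haagerup's inequality,
    [x |-> <w, pi(x) v>] would then be square summable for every [w]. But for [w]
    supported on a cone these coefficients are the coordinates of the values of
    [v], whose squares sum to [|v|^2] over every large sphere. *)
Require Import Defs.
From HB Require Import structures.
From mathcomp Require Import all_boot all_order all_algebra.
From mathcomp Require Import finmap complex.
From mathcomp Require Import all_classical all_reals all_analysis.
From mathcomp Require Import generic_quotient sesquilinear.
From mathcomp Require Import ring lra.
From mathcomp Require Import zify.
Set Implicit Arguments.
Unset Strict Implicit.
Unset Printing Implicit Defensive.
Import Order.TTheory GRing.Theory Num.Theory.
Import numFieldNormedType.Exports.
Local Open Scope classical_set_scope.
Local Open Scope ring_scope.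

(** * Linear recurrences and Abel sums *)

Section Sequences.
Variable R : realType.
Implicit Types (s : nat -> R) (r : R).

Definition linrec s := exists d (c : nat -> R),
  forall k, s (k + d)%N = \sum_(i < d) c i * s (k + i)%N.

(** Shifting the index by [K] gives a recurrence of order [K + d] whose first [K] coefficients are
    zero. *)
Lemma eventually_linrec s K d (c : nat -> R) :
  (forall k, (K <= k)%N -> s (k + d)%N = \sum_(i < d) c i * s (k + i)%N) ->
  linrec s.
Proof.
move=> sK; exists (K + d)%N, (fun i => if (i < K)%N then 0 else c (i - K)%N) => k.
rewrite big_split_ord /= big1 ?add0r => [|i _]; last by rewrite ltn_ord mul0r.
rewrite addnA sK ?leq_addl //; apply: eq_bigr => i _.
by rewrite ltnNge leq_addr /= addKn addnA.
Qed.

(* The windows [(s n, ..., s (n + d - 1))] are combinations of the rows of a finite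
   Hankel matrix [A]; the coefficients are linear in the window, hence small, and
   the same combination holds for all later terms. *)
Lemma linrec_halving s : linrec s ->
  (forall e, 0 < e -> exists K, forall k, (K <= k)%N -> `|s k| <= e) ->
  exists2 p, (0 < p)%N & forall m B, (forall k, (m <= k)%N -> `|s k| <= B) ->
    forall k, (p + m <= k)%N -> `|s k| <= B / 2.
Proof.
move=> [d [c sE]] s0.
pose E n : 'rV[R]_d := \row_j s (n + j)%N.
pose A : 'M[R]_d := \matrix_(i, j) s (i + j)%N.
have EA n : (E n <= A)%MS.
  elim/ltn_ind: n => n IHn; have [nd|dn] := ltnP n d.
    have -> : E n = row (Ordinal nd) A by apply/rowP => j; rewrite !mxE.
    exact: row_sub.
  have -> : E n = \sum_(i < d) c i *: E (n - d + i)%N.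
    apply/rowP => j; rewrite summxE mxE -{1}(subnK dn) addnAC sE.
    by apply: eq_bigr => i _; rewrite !mxE addnAC.
  apply: summx_sub => i _; apply/scalemx_sub/IHn.
  by rewrite -[ltnRHS](subnK dn) ltn_add2l.
pose P := pinvmx A; pose a n := E n *m P.
have aE n m : s (n + m)%N = \sum_(i < d) a n 0 i * s (i + m)%N.
  elim/ltn_ind: m => m IHm; have [md|dm] := ltnP m d.
    have := congr1 (fun M : 'rV_d => M 0 (Ordinal md)) (mulmxKpV (EA n)).
    by rewrite -/(a n) !mxE /= => <-; apply: eq_bigr => i _; rewrite !mxE.
  rewrite -(subnK dm) addnA sE.
  rewrite (eq_bigr (fun i : 'I_d => \sum_(j < d) c i * (a n 0 j * s (j + (m - d + i))%N))); last first.
    move=> i _; rewrite -addnA IHm ?mulr_sumr //.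
    by rewrite -[ltnRHS](subnK dm) ltn_add2l.
  rewrite exchange_big /=; apply: eq_bigr => j _; rewrite addnA sE mulr_sumr.
  by apply: eq_bigr => i _; rewrite -addnA mulrCA.
pose D := \sum_(i < d) \sum_(j < d) `|P j i| + 1.
have D1 : 1 <= D by rewrite lerDr !sumr_ge0 // => i _; exact: sumr_ge0.
have D0 : 0 < D by exact: lt_le_trans ltr01 D1.
(* [D] bounds the sum of the absolute values of the entries of [P]. Once the window is entrywise at
   most [2^-1 / D], the absolute values of its coefficients [a n] add up to at most 1/2. *)
have [|K sK] := s0 (2^-1 / D); first by rewrite divr_gt0 ?invr_gt0.
exists K.+1 => // m B sB k pk.
have [m' mm' kE] : exists2 m', (m <= m')%N & k = (K.+1 + m')%N.
  exists (k - K.+1)%N; first by rewrite leq_subRL // (leq_trans _ pk) // leq_addr.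
  by rewrite subnKC // (leq_trans _ pk) // leq_addr.
have B0 : 0 <= B by apply: le_trans (sB m (leqnn _)).
rewrite kE aE (le_trans (ler_norm_sum _ _ _)) //.
have -> : B / 2 = (D * (2^-1 / D)) * B by field; rewrite lt0r_neq0.
apply: (@le_trans _ _ ((\sum_(i < d) \sum_(j < d) `|P j i|) * (2^-1 / D) * B)); last first.
  by rewrite ler_wpM2r // ler_wpM2r ?lerDl // divr_ge0 ?invr_ge0 // ltW.
rewrite !mulr_suml; apply: ler_sum => i _; rewrite normrM ler_pM //; last first.
  by apply: sB; rewrite (leq_trans mm') // leq_addl.
rewrite mxE (le_trans (ler_norm_sum _ _ _)) // mulr_suml; apply: ler_sum => j _.
rewrite normrM mulrC ler_wpM2l // mxE; apply: sK.
by rewrite (leq_trans (leqnSn K)) // leq_addr.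
Qed.

Lemma bernoulli_le (x : R) n : 0 <= x -> x <= 1 -> 1 - n%:R * x <= (1 - x) ^+ n.
Proof.
move=> x0 x1; elim: n => [|n IHn]; first by rewrite mul0r subr0 expr0.
rewrite exprS -natr1; have : 0 <= 1 - x by rewrite subr_ge0.
move=> /ler_wpM2l /(_ _ _ IHn); apply: le_trans.
have : 0 <= n%:R * x * x by rewrite !mulr_ge0.
nra.
Qed.

(** The delay [p] in [linrec_halving] depends neither on the bound nor on the starting rank, so the
    halving can be iterated. *)
Lemma linrec_decay s : linrec s ->
  (forall e, 0 < e -> exists K, forall k, (K <= k)%N -> `|s k| <= e) ->
  exists C t : R, [/\ 0 <= C, 0 < t, t < 1 & forall k, `|s k| <= C * t ^+ k].
Proof.
move=> sL s0; have [p p0 half] := linrec_halving sL s0.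
have [K sK] := s0 1 ltr01.
have p0' : 0 < p%:R :> R by rewrite ltr0n.
have p1 : (2 * p%:R)^-1 <= 2^-1 :> R.
  by rewrite lef_pV2 ?posrE ?mulr_gt0 // ler_peMr // ler1n.
have pp : 0 < (2 * p%:R)^-1 :> R by rewrite invr_gt0 mulr_gt0.
(* By Bernoulli's inequality [t ^+ p] is at least 1/2, so halving every [p] steps is decay at least
   as fast as that of the powers of [t]. *)
pose t : R := 1 - (2 * p%:R)^-1.
have t0 : 0 < t by rewrite /t; lra.
have t1 : t < 1 by rewrite /t; lra.
have tp : 2^-1 <= t ^+ p.
  have p1' : (2 * p%:R)^-1 <= 1 :> R by lra.
  apply: le_trans (bernoulli_le p (ltW pp) p1').
  have -> : p%:R * (2 * p%:R)^-1 = 2^-1 :> R.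
    by rewrite invfM mulrCA divff ?mulr1 // lt0r_neq0.
  lra.
have iter_half j k : (j * p + K <= k)%N -> `|s k| <= (2^-1) ^+ j.
  elim: j k => [|j IHj] k; first by rewrite expr0; exact: sK.
  by rewrite mulSn -addnA => /(half _ _ IHj); rewrite exprSr.
pose M := \sum_(i < K) `|s i|.
have M0 : 0 <= M by exact: sumr_ge0.
have tK : 0 < t ^+ K by rewrite exprn_gt0.
(* [M] takes care of the first [K] terms, 2 of the incomplete block of [p] steps, and [t ^+ K] of
   the shift by [K]. *)
exists ((2 + M) / t ^+ K), t; split => // [|k].
  by rewrite divr_ge0 ?addr_ge0 // ltW.
have tt : forall a b, (a <= b)%N -> t ^+ b <= t ^+ a.
  by move=> a b ab; rewrite ler_wiXn2l // ltW.
have [kK|Kk] := ltnP k K.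
  rewrite mulrAC ler_pdivlMr // (@le_trans _ _ (`|s k| * t ^+ k)) ?ler_wpM2l ?tt ?(ltnW kK) //.
  apply: ler_wpM2r; first exact/ltW/exprn_gt0.
  rewrite /M (bigD1 (Ordinal kK)) //= addrCA lerDl addr_ge0 //; exact: sumr_ge0.
pose j := ((k - K) %/ p)%N.
have jk : (j * p + K <= k)%N by rewrite addnC -leq_subRL // leq_trunc_div.
apply: le_trans (iter_half j k jk) _.
have kj : (k - K <= j.+1 * p)%N by rewrite ltnW // ltn_ceil.
have : 2^-1 ^+ j <= 2 * t ^+ (k - K).
  apply: (@le_trans _ _ (2 * 2^-1 ^+ j.+1)); first by rewrite exprS mulrA divff ?mul1r.
  apply: ler_wpM2l => //; apply: le_trans (tt _ _ kj).
  rewrite mulnC exprM; elim: (j.+1) => [|i IHi]; first by rewrite !expr0.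
  by rewrite !exprS ler_pM ?exprn_ge0 ?invr_ge0.
move=> /le_trans; apply.
rewrite mulrAC ler_pdivlMr // -mulrA -exprD subnK //.
by apply: ler_wpM2r; [exact/exprn_ge0/ltW | rewrite lerDl].
Qed.


Lemma near1_bounds (q : {poly R}) : ~~ root q 1 ->
  exists c C d : R, [/\ 0 < c, 0 < C, 0 < d &
    forall r, 1 - d < r -> r < 1 -> c <= `|q.[r]| /\ `|q.[r]| <= C].
Proof.
move=> q1; have q1' : 0 < `|q.[1]| by rewrite normr_gt0.
have q2 : 0 < `|q.[1]| / 2 by rewrite divr_gt0.
have /cvgrPdist_le /(_ _ q2) /nbhs_ballP [d /= d0 dq] := @continuous_horner R q 1.
exists (`|q.[1]| / 2), (`|q.[1]| * 2), d; split => // [|r r1 r2]; first by rewrite mulr_gt0.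
have {}/dq /= : ball (1 : R) d r by rewrite /ball /= gtr0_norm ?subr_gt0 // ltrBlDl -ltrBlDr.
move=> dqr; have := lerB_dist q.[1] q.[r].
have := lerB_dist q.[r] q.[1]; rewrite (distrC q.[r]).
lra.
Qed.

Lemma cvgn_sum (I : Type) (e : seq I) (f : I -> nat -> R) (l : I -> R) :
  (forall i, f i n @[n --> \oo] --> l i) ->
  (\sum_(i <- e) f i n) @[n --> \oo] --> \sum_(i <- e) l i.
Proof.
move=> fl; elim: e => [|i e IHe].
  by rewrite big_nil; under eq_cvg do rewrite big_nil; exact: cvg_cst.
by rewrite big_cons; under eq_cvg do rewrite big_cons; exact: cvgD.
Qed.

(** The generating function is rational. The denominator is the reversed characteristic polynomial,
    nonzero because its value at 0 is 1; the numerator collects the initial terms. The identity is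
    stated only at points where the series converges. *)
Lemma linrec_gf s : linrec s -> exists2 q : {poly R}, q != 0 &
  exists p : {poly R}, forall (r L : R),
    (\sum_(k < n) s k * r ^+ k) @[n --> \oo] --> L -> q.[r] * L = p.[r].
Proof.
move=> [d [c sE]].
pose S m := \sum_(k < m) s k *: 'X^k : {poly R}.
exists (1 - \sum_(i < d) c i *: 'X^(d - i)).
  apply/eqP => /(congr1 (fun q => q.[0])).
  rewrite hornerD hornerN horner_sum hornerC big1 ?horner0.
    by rewrite subr0 => /eqP; rewrite oner_eq0.
  by move=> i _; rewrite hornerZ hornerXn expr0n subn_eq0 leqNgt ltn_ord mulr0.
exists (S d - \sum_(i < d) c i *: 'X^(d - i) * S i) => r L SL.
have SE m : (S m).[r] = \sum_(k < m) s k * r ^+ k.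
  by rewrite horner_sum; apply: eq_bigr => k _; rewrite hornerZ hornerXn.
pose T n := \sum_(k < n) s k * r ^+ k.
have TE n m : T (n + m)%N - T m = \sum_(k < n) s (k + m)%N * r ^+ (k + m).
  rewrite /T addnC big_split_ord /= [LHS]addrC addKr.
  by apply: eq_bigr => k _; rewrite addnC.
have key n : T (n + d)%N - T d = \sum_(i < d) c i * r ^+ (d - i) * (T (n + i)%N - T i).
  under [RHS]eq_bigr do rewrite TE mulr_sumr.
  rewrite TE exchange_big /=; apply: eq_bigr => k _.
  rewrite sE mulr_suml; apply: eq_bigr => i _.
  rewrite -!mulrA; congr (_ * _); rewrite mulrCA -exprD; congr (_ * _ ^+ _).
  by rewrite addnCA subnK // ltnW.
have lim1 : (T (n + d)%N - T d) @[n --> \oo] --> L - T d.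
  by apply: cvgB; [rewrite (cvg_shiftn d T) | exact: cvg_cst].
have lim2 : (T (n + d)%N - T d) @[n --> \oo] -->
    \sum_(i < d) c i * r ^+ (d - i) * (L - T i).
  under eq_cvg do rewrite key.
  apply: cvgn_sum => i; apply: cvgMr.
  by apply: cvgB; [rewrite (cvg_shiftn i T) | exact: cvg_cst].
have H : L - T d = \sum_(i < d) c i * r ^+ (d - i) * (L - T i).
  by apply: (cvg_unique _ lim1 lim2); exact: norm_hausdorff.
have -> : (1 - \sum_(i < d) c i *: 'X^(d - i)).[r] = 1 - \sum_(i < d) c i * r ^+ (d - i).
  rewrite hornerD hornerN horner_sum hornerC; congr (1 - _).
  by apply: eq_bigr => i _; rewrite hornerZ hornerXn.
have -> : (S d - \sum_(i < d) c i *: 'X^(d - i) * S i).[r] =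
    T d - \sum_(i < d) c i * r ^+ (d - i) * T i.
  rewrite hornerD hornerN SE horner_sum; congr (_ - _).
  by apply: eq_bigr => i _; rewrite hornerM hornerZ hornerXn SE.
move: H; under eq_bigr do rewrite mulrBr.
rewrite sumrB mulrBl mul1r mulr_suml => H.
by rewrite -{1}(addrNK (T d) L) H; ring.
Qed.

Lemma psum_le_r s m n (r r' : R) : (forall k, 0 <= s k) -> 0 <= r -> r <= r' -> (m <= n)%N ->
  \sum_(k < m) s k * r ^+ k <= \sum_(k < n) s k * r' ^+ k.
Proof.
move=> s0 r0 rr mn; apply: (@le_trans _ _ (\sum_(k < m) s k * r' ^+ k)).
  by apply: ler_sum => k _; rewrite ler_wpM2l // lerXn2r // nnegrE // (le_trans r0).
rewrite -(subnKC mn) big_split_ord /= lerDl sumr_ge0 // => k _.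
by rewrite mulr_ge0 // exprn_ge0 // (le_trans r0).
Qed.

(** If 1 is a root of order [l] of the denominator and of order [j] of the numerator, the sum is
    comparable to the power [j - l] of [1 - r] near 1. The two alternatives are [l <= m + j] and its
    negation; integrality of the orders leaves no gap between them. *)
Lemma linrec_dichotomy s m : (forall k, 0 <= s k) -> linrec s ->
  (forall r, 0 < r -> r < 1 -> exists C : R, forall n, \sum_(k < n) s k * r ^+ k <= C) ->
  (exists C : R, forall r n, 2^-1 <= r -> r < 1 ->
     \sum_(k < n) s k * r ^+ k <= C / (1 - r) ^+ m) \/
  (exists c d : R, [/\ 0 < c, 0 < d & forall r, 1 - d < r -> r < 1 ->
     exists n, c / (1 - r) ^+ m.+1 <= \sum_(k < n) s k * r ^+ k]).
Proof.
move=> s0 sL sB; have [q q0 [p qp]] := linrec_gf sL.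
pose T r n := \sum_(k < n) s k * r ^+ k.
have lim r : 0 < r -> r < 1 -> exists2 L : R, (T r n @[n --> \oo] --> L) & forall n, T r n <= L.
  move=> r0 r1; have [C TC] := sB r r0 r1.
  have Tnd : nondecreasing_seq (T r).
    by move=> a b ab; apply: psum_le_r => //; exact: ltW.
  have Tcv : cvgn (T r).
    by apply: nondecreasing_is_cvgn => //; exists C => _ [n _ <-]; exact: TC.
  by exists (limn (T r)) => // n; exact: nondecreasing_cvgn_le.
have [l [q1]] := multiplicity_XsubC q 1; rewrite q0 /= => rq1 qE.
have [j [p1 rp1 pE]] := multiplicity_XsubC p 1.
have [cq [Cq [dq [cq0 Cq0 dq0 qb]]]] := near1_bounds rq1.
have [p0|p0] := eqVneq p 0.
  left; exists 0 => r n r2 r1; rewrite mul0r.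
  (* A zero numerator makes the sum vanish wherever the denominator does not. The point [r'] lies
     between [r] and 1, close enough to 1 for this, and monotonicity brings the bound back to
     [r]. *)
  pose d := Num.min dq (1 - r); pose r' := 1 - d / 2.
  have d0 : 0 < d by rewrite lt_min dq0 subr_gt0.
  have dr : d <= 1 - r by rewrite ge_min lexx orbT.
  have dd : d <= dq by rewrite ge_min lexx.
  have r'0 : 0 < r' by rewrite /r'; lra.
  have r'1 : r' < 1 by rewrite /r'; lra.
  have [L TL TleL] := lim r' r'0 r'1.
  have := qp r' L TL; rewrite p0 horner0 qE hornerM => /eqP; rewrite !mulf_eq0.
  have [|cr _] := qb r' _ r'1; first by rewrite /r'; lra.
  rewrite -(normr_eq0 q1.[r']) gt_eqF ?(lt_le_trans cq0) //=.
  rewrite horner_exp hornerXsubC expf_eq0 subr_eq0 lt_eqF // andbF /= => /eqP L0.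
  have r0 : 0 <= r by lra.
  have rr' : r <= r' by rewrite /r'; lra.
  by apply: le_trans (psum_le_r s0 r0 rr' (leqnn n)) _; apply: le_trans (TleL n) _; rewrite L0.
have rp1' : ~~ root p1 1 by exact: (implyP rp1).
have [cp [Cp [dp [cp0 Cp0 dp0 pb]]]] := near1_bounds rp1'.
pose d := Num.min (Num.min dp dq) 2^-1.
have d0 : 0 < d by rewrite !lt_min dp0 dq0 /= invr_gt0 ltr0n.
have ddp : d <= dp by rewrite !ge_min lexx.
have ddq : d <= dq by rewrite !ge_min lexx orbT.
have d2 : d <= 2^-1 by rewrite !ge_min lexx orbT.
have main r : 1 - d < r -> r < 1 -> exists L : R, [/\ forall n, T r n <= L, T r n @[n --> \oo] --> L,
    L * (1 - r) ^+ l * cq <= Cp * (1 - r) ^+ j & cp * (1 - r) ^+ j <= L * (1 - r) ^+ l * Cq].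
  move=> rd r1; have r0 : 0 < r by lra.
  have [L TL TleL] := lim r r0 r1; exists L.
  have L0 : 0 <= L by apply: le_trans (TleL 0%N); rewrite /T big_ord0.
  have := congr1 (fun x : R => `|x|) (qp r L TL).
  have [pb1 pb2] := pb r (ltac:(lra)) r1; have [qb1 qb2] := qb r (ltac:(lra)) r1.
  rewrite qE pE !hornerM !horner_exp !hornerXsubC !normrM !normrX (ger0_norm L0).
  rewrite (distrC r) (@gtr0_norm _ (1 - r)) ?subr_gt0 // => E.
  have rl : 0 <= (1 - r) ^+ l by rewrite exprn_ge0 // subr_ge0 ltW.
  have rj : 0 <= (1 - r) ^+ j by rewrite exprn_ge0 // subr_ge0 ltW.
  split=> //.
    apply: (@le_trans _ _ (`|p1.[r]| * (1 - r) ^+ j)); last exact: ler_wpM2r.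
    by rewrite -E mulrC mulrA mulrAC; apply: ler_wpM2r => //; apply: ler_wpM2r.
  apply: (@le_trans _ _ (`|p1.[r]| * (1 - r) ^+ j)); first exact: ler_wpM2r.
  by rewrite -E [leRHS]mulrC mulrA mulrAC; apply: ler_wpM2r => //; apply: ler_wpM2r.
have [lj|lj] := leqP l (m + j).
  left; pose K := Cp / cq; have K0 : 0 <= K by rewrite divr_ge0 ?ltW.
  have near1 r n : 1 - d < r -> r < 1 -> T r n <= K / (1 - r) ^+ m.
    move=> rd r1; have [L [TleL _ L1 _]] := main r rd r1.
    apply: le_trans (TleL n) _; have r1' : 0 < 1 - r by rewrite subr_gt0.
    rewrite ler_pdivlMr ?exprn_gt0 //.
    have r1'' : 1 - r <= 1 by lra.
    have rj : 0 < (1 - r) ^+ j by rewrite exprn_gt0.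
    rewrite /K ler_pdivlMr // -(ler_pM2r rj); apply: le_trans L1.
    rewrite mulrAC ler_wpM2r ?(ltW cq0) // -mulrA -exprD.
    apply: ler_wpM2l; last by rewrite ler_wiXn2l // ltW.
    by apply: le_trans (TleL 0%N); rewrite /T big_ord0.
  (* Away from 1, monotonicity in [r] bounds the partial sums by those at the fixed point [r0]. *)
  pose r0 := 1 - d / 2; pose K' := K / (1 - r0) ^+ m.
  have K'0 : 0 <= K' by rewrite divr_ge0 // exprn_ge0 // /r0; lra.
  exists (K + K') => r n r2 r1; have r1' : 0 < 1 - r by rewrite subr_gt0.
  have rm : 0 < (1 - r) ^+ m by rewrite exprn_gt0.
  have [rd|rd] := ltP (1 - d) r.
    by apply: le_trans (near1 r n rd r1) _; rewrite ler_pM2r ?invr_gt0 // lerDl.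
  apply: (@le_trans _ _ K').
    apply: (@le_trans _ _ (T r0 n)); last by apply: near1; rewrite /r0; lra.
    by apply: psum_le_r => //; rewrite /r0; lra.
  apply: (@le_trans _ _ (K + K')); first by rewrite lerDr.
  rewrite ler_pdivlMr // ler_piMr ?addr_ge0 // exprn_ile1 // ?ltW //; lra.
(* The estimate with [cp / Cq] holds for the limit; the factor 1/2 lets a partial sum satisfy it. *)
right; exists (cp / Cq / 2), d; split=> //; first by rewrite !divr_gt0.
move=> r rd r1; have r1' : 0 < 1 - r by rewrite subr_gt0.
have [L [TleL TL _ L2]] := main r rd r1.
have rj : 0 < (1 - r) ^+ j by rewrite exprn_gt0.
have rm : 0 < (1 - r) ^+ m.+1 by rewrite exprn_gt0.
have L0 : 0 <= L by apply: le_trans (TleL 0%N); rewrite /T big_ord0.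
have Lge : cp / Cq / (1 - r) ^+ m.+1 <= L.
  rewrite !ler_pdivrMr // -(ler_pM2r rj); apply: le_trans L2 _.
  rewrite [leRHS]mulrAC ler_wpM2r ?(ltW Cq0) // -mulrA -exprD.
  by apply: ler_wpM2l => //; rewrite ler_wiXn2l ?ltW //; lra.
have Lgt : 0 < L by apply: lt_le_trans Lge; rewrite !divr_gt0.
have L2' : 0 < L / 2 by rewrite divr_gt0.
have /cvgrPdist_le /(_ _ L2') [n _ /(_ n (leqnn n)) /=] := TL.
move=> Ln; exists n; have := ler_norm (L - T r n); rewrite -/(T r n).
have -> : cp / Cq / 2 / (1 - r) ^+ m.+1 = cp / Cq / (1 - r) ^+ m.+1 / 2 by rewrite mulrAC.
lra.
Qed.


Lemma sum_geo_le r n : 0 <= r -> r < 1 -> \sum_(k < n) r ^+ k <= (1 - r)^-1.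
Proof.
move=> r0 r1; have r1' : 0 < 1 - r by rewrite subr_gt0.
rewrite -[leRHS]mul1r ler_pdivlMr //.
have -> : (\sum_(k < n) r ^+ k) * (1 - r) = 1 - r ^+ n.
  elim: n => [|n IHn]; first by rewrite big_ord0 mul0r subrr.
  by rewrite big_ord_recr /= mulrDl IHn exprSr; ring.
by rewrite gerBl exprn_ge0.
Qed.

(** Multiplication by [1 - r] takes differences of the coefficients: squares become at most twice
    the linear terms, and linear terms become constants. Three factors then reduce the sum to a
    constant. *)
Lemma sum_sqr_geo_le r n : 0 <= r -> r < 1 ->
  \sum_(k < n) (k.+1)%:R ^+ 2 * r ^+ k <= 2 / (1 - r) ^+ 3.
Proof.
move=> r0 r1; have r1' : 0 < 1 - r by rewrite subr_gt0.
have E1 : (1 - r) * \sum_(k < n) (k.+1)%:R * r ^+ k <= (1 - r)^-1.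
  apply: le_trans (sum_geo_le n r0 r1).
  rewrite -subr_ge0 (_ : _ - _ = n%:R * r ^+ n) ?mulr_ge0 ?exprn_ge0 //.
  elim: n => [|n IHn]; first by rewrite !big_ord0 mul0r mulr0 subrr.
  rewrite !big_ord_recr /= mulrDr exprS -natr1.
  have : \sum_(k < n) r ^+ k = n%:R * r ^+ n + (1 - r) * \sum_(k < n) (k.+1)%:R * r ^+ k.
    by rewrite -IHn; ring.
  by move=> ->; ring.
have E2 : (1 - r) * \sum_(k < n) (k.+1)%:R ^+ 2 * r ^+ k <= 2 * \sum_(k < n) (k.+1)%:R * r ^+ k.
  rewrite -subr_ge0 (_ : _ - _ = n%:R ^+ 2 * r ^+ n + \sum_(k < n) r ^+ k).
    by rewrite addr_ge0 ?mulr_ge0 ?exprn_ge0 ?sumr_ge0 // => k _; rewrite exprn_ge0.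
  elim: n {E1} => [|n IHn]; first by rewrite !big_ord0 expr2 !mul0r !mulr0 subrr addr0.
  rewrite !big_ord_recr /=.
  have -> : \sum_(k < n) r ^+ k = 2 * (\sum_(k < n) (k.+1)%:R * r ^+ k) -
      (1 - r) * (\sum_(k < n) (k.+1)%:R ^+ 2 * r ^+ k) - n%:R ^+ 2 * r ^+ n.
    by rewrite IHn; ring.
  by rewrite -(natr1 n) (exprS r); ring.
move: E1 E2; set S1 := (\sum_(k < n) _); set S2 := (\sum_(k < n) _) => E1 E2.
rewrite ler_pdivlMr ?exprn_gt0 //.
have -> : S2 * (1 - r) ^+ 3 = (1 - r) * (1 - r) * ((1 - r) * S2) by ring.
apply: le_trans (ler_wpM2l _ E2) _; first by rewrite mulr_ge0 ?ltW.
have -> : (1 - r) * (1 - r) * (2 * S1) = 2 * (1 - r) * ((1 - r) * S1) by ring.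
apply: le_trans (ler_wpM2l _ E1) _; first by rewrite mulr_ge0 ?ltW.
by rewrite mulfK // lt0r_neq0.
Qed.

End Sequences.

(** * Sums over spheres of the free group *)

Section FiniteSums.
Variable R : realDomainType.

Lemma sum_sub_le (J : eqType) (u t : seq J) (F : J -> R) :
  uniq u -> {subset u <= t} -> (forall y, 0 <= F y) ->
  \sum_(y <- u) F y <= \sum_(y <- t) F y.
Proof.
move=> uu ut F0; elim: u t uu ut => [|y u IHu] t /=.
  by rewrite big_nil sumr_ge0.
move=> /andP[yu uu] ut.
have yt : y \in t by apply: ut; rewrite mem_head.
rewrite big_cons (perm_big _ (perm_to_rem yt)) big_cons lerD2l; apply: IHu => // z zu.
have /ut zt : z \in y :: u by rewrite inE zu orbT.
move: zt; rewrite (perm_mem (perm_to_rem yt)) inE => /predU1P[zy|//].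
by rewrite zy (negbTE yu) in zu.
Qed.

Lemma sum_inj_le (I J : eqType) (s : seq I) (t : seq J) (P : pred I) (h : I -> J)
    (F : J -> R) :
  uniq s -> {in [pred x in s | P x] &, injective h} ->
  (forall x, x \in s -> P x -> h x \in t) -> (forall y, 0 <= F y) ->
  \sum_(x <- s | P x) F (h x) <= \sum_(y <- t) F y.
Proof.
move=> us hi ht F0; rewrite -big_filter -(big_map h xpredT); apply: sum_sub_le => //.
  rewrite map_inj_in_uniq ?filter_uniq // => x y.
  by rewrite !mem_filter => /andP[Px xs] /andP[Py ys]; apply: hi; rewrite inE ?xs ?ys.
by move=> _ /mapP[x + ->]; rewrite mem_filter => /andP[Px xs]; exact: ht.
Qed.

(** Cauchy-Schwarz without square roots, in the shape in which a positive form bounds its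
    off-diagonal values. The signs of the three sums are carried through the induction, where the
    cross term is the arithmetic-geometric inequality. *)
Lemma sum_sqr_le (I : Type) (s : seq I) (P : pred I) (z p q : I -> R) :
  (forall i, P i -> [/\ 0 <= z i, 0 <= p i, 0 <= q i & z i ^+ 2 <= p i * q i]) ->
  (\sum_(i <- s | P i) z i) ^+ 2 <=
  (\sum_(i <- s | P i) p i) * (\sum_(i <- s | P i) q i).
Proof.
move=> H; suff [] : [/\ 0 <= \sum_(i <- s | P i) z i, 0 <= \sum_(i <- s | P i) p i,
  0 <= \sum_(i <- s | P i) q i & (\sum_(i <- s | P i) z i) ^+ 2 <=
  (\sum_(i <- s | P i) p i) * (\sum_(i <- s | P i) q i)] by [].
elim/big_ind3: _ => //.
move=> q1 p1 z1 q2 p2 z2 [z10 p10 q10 h1] [z20 p20 q20 h2]; split; rewrite ?addr_ge0 //.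
have -> : (z1 + z2) ^+ 2 = z1 ^+ 2 + z2 ^+ 2 + 2 * (z1 * z2) by ring.
have -> : (p1 + p2) * (q1 + q2) = p1 * q1 + p2 * q2 + (p1 * q2 + p2 * q1) by ring.
rewrite !lerD //.
have h12 : (2 * (z1 * z2)) ^+ 2 <= (p1 * q2 + p2 * q1) ^+ 2.
  have : (z1 ^+ 2) * (z2 ^+ 2) <= (p1 * q1) * (p2 * q2) by rewrite ler_pM ?sqr_ge0.
  have : 0 <= (p1 * q2 - p2 * q1) ^+ 2 by rewrite sqr_ge0.
  lra.
by rewrite -ler_sqr // nnegrE ?addr_ge0 ?mulr_ge0.
Qed.

End FiniteSums.

(** * Spheres, prefixes and common prefixes of reduced words *)

Section Words.
Variable X : finType.
Local Notation G := (freeGroup X).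
Implicit Types (x y z : G) (a b c : letter X) (u v : seq (letter X)).

Definition sph k : seq G := enum_fset (fset_set [set x : G | len x = k]).

Lemma sph_uniq k : uniq (sph k). Proof. exact: fset_uniq. Qed.

Lemma mem_sph k x : (x \in sph k) = (len x == k).
Proof.
rewrite -[x \in sph k]/(x \in fset_set [set x : G | len x = k]) in_fset_set.
  by apply/idP/eqP; rewrite inE.
by apply: (sub_finite_set _ (@finite_ball _ k)) => y /= ->.
Qed.

Definition wball k : seq G := enum_fset (fset_set [set x : G | (len x < k)%N]).

Lemma wball_uniq k : uniq (wball k). Proof. exact: fset_uniq. Qed.

Lemma mem_wball k x : (x \in wball k) = (len x < k)%N.
Proof.
rewrite -[x \in wball k]/(x \in fset_set [set x : G | (len x < k)%N]) in_fset_set.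
  by apply/idP/idP; rewrite inE.
by apply: (sub_finite_set _ (@finite_ball _ k)) => y /= /ltnW.
Qed.

Lemma sum_wball (V : nmodType) (F : G -> V) k :
  \sum_(x <- wball k) F x = \sum_(i < k) \sum_(x <- sph i) F x.
Proof.
elim: k => [|k IHk].
  rewrite big_ord0 big_seq big_pred0 // => x; by rewrite mem_wball ltn0.
rewrite big_ord_recr /= -IHk -big_cat /=; apply: perm_big; apply: uniq_perm.
- exact: wball_uniq.
- rewrite cat_uniq wball_uniq sph_uniq andbT /=; apply/hasPn => x.
  by rewrite mem_sph mem_wball => /eqP ->; rewrite ltnn.
- by move=> x; rewrite mem_cat mem_sph !mem_wball ltnS leq_eqVlt orbC.
Qed.

Lemma reduced_cat (u v : seq (letter X)) : reduced (u ++ v) -> reduced u /\ reduced v.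
Proof. by rewrite /reduced => uv; have [] := cat_sorted2 uv. Qed.

Lemma reduced_cat_head u a v : reduced u -> reduced (a :: v) ->
  reduced (u ++ a :: v) = (u == [::]) || (a != linv (last a u)).
Proof.
case: u => [|b u] //= ru rv; rewrite /reduced /= cat_path /=.
by move: ru rv; rewrite /reduced /= => -> ->; rewrite andbT.
Qed.

Lemma take_reduced j x : reduced (take j (word x)).
Proof. by have := word_reduced x; rewrite -{1}(cat_take_drop j (word x)) => /reduced_cat[]. Qed.
Lemma drop_reduced j x : reduced (drop j (word x)).
Proof. by have := word_reduced x; rewrite -{1}(cat_take_drop j (word x)) => /reduced_cat[]. Qed.

Definition pre j x : G := FreeGroup (take_reduced j x).
Definition suf j x : G := FreeGroup (drop_reduced j x).

Lemma word_mul x y : reduced (word x ++ word y) -> word (x * y)%g = word x ++ word y.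
Proof. exact: mul_cat. Qed.

Lemma pre_suf j x : (pre j x * suf j x)%g = x.
Proof.
by apply: val_inj; rewrite [val _]word_mul /= cat_take_drop ?word_reduced.
Qed.

Lemma len_pre j x : (j <= len x)%N -> len (pre j x) = j.
Proof. by move=> jx; rewrite /len size_takel. Qed.
Lemma len_suf j x : len (suf j x) = (len x - j)%N.
Proof. by rewrite /len size_drop. Qed.

Fixpoint lcpw (u v : seq (letter X)) : nat :=
  if u is a :: u' then if v is b :: v' then if a == b then (lcpw u' v').+1 else 0%N else 0%N else 0%N.

(** In the Cayley tree, the distance from [1] to the point where the geodesics to [x] and [y]
    separate. *)
Definition lcp x y := lcpw (word x) (word y).

Lemma lcpwP u v : let l := lcpw u v in
  [/\ (l <= size u)%N, (l <= size v)%N, take l u = take l v &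
      forall a, (l < size u)%N -> (l < size v)%N -> nth a u l != nth a v l].
Proof.
elim: u v => [|a u IHu] [|b v] //=; case: eqVneq => [->|ab] //=.
by have [? ? E ?] := IHu v; rewrite E.
Qed.

Lemma lcp_lel x y : (lcp x y <= len x)%N. Proof. by case: (lcpwP (word x) (word y)). Qed.
Lemma lcp_ler x y : (lcp x y <= len y)%N. Proof. by case: (lcpwP (word x) (word y)). Qed.

Lemma lcp_pre x y : pre (lcp x y) x = pre (lcp x y) y.
Proof. by apply: val_inj; case: (lcpwP (word x) (word y)). Qed.

Lemma word_winv_cat u v : reduced u -> reduced v ->
  (forall a u' b v', u = a :: u' -> v = b :: v' -> a != b) -> reduced (winv u ++ v).
Proof.
move=> ru rv uv; case: v rv uv => [|b v] rv uv; first by rewrite cats0 winv_reduced.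
rewrite reduced_cat_head ?winv_reduced //; case: u ru uv => [|a u] //= ru uv.
rewrite /winv /= rev_cons last_rcons linvK; apply/orP; right.
by rewrite eq_sym; exact: uv.
Qed.

(** Only the common prefix cancels: the letters that follow it in [x] and [y] differ, so the
    concatenation is already reduced. *)
Lemma word_divl x y : let l := lcp x y in
  word (x^-1 * y)%g = winv (word (suf l x)) ++ word (suf l y).
Proof.
move=> l; have -> : (x^-1 * y = (suf l x)^-1 * suf l y)%g.
  rewrite -{1}(pre_suf l x) -{1}(pre_suf l y) lcp_pre -/l.
  by rewrite invgM -mulgA mulKg.
apply: word_mul => /=; apply: word_winv_cat; rewrite ?drop_reduced //.
have [lx ly _ lxy] := lcpwP (word x) (word y).
move=> a u' b v' xE yE; have := lxy a.
have sx : (lcp x y < size (word x))%N by rewrite ltnNge; apply/negP => /drop_oversize; rewrite xE.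
have sy : (lcp x y < size (word y))%N by rewrite ltnNge; apply/negP => /drop_oversize; rewrite yE.
move=> /(_ sx sy); rewrite -[lcpw _ _]/l.
by rewrite -[X in nth a (word x) X]addn0 -[X in nth a (word y) X]addn0 -!nth_drop xE yE.
Qed.

Lemma len_divl x y : len (x^-1 * y)%g = (len x - lcp x y + (len y - lcp x y))%N.
Proof. by rewrite /len word_divl size_cat size_rev size_map !size_drop. Qed.

(** A word of length [k + l] is such a reduced product in exactly one way, its first factor being
    its prefix of length [k]. *)
Lemma sph_split (V : nmodType) (F : G -> V) k l :
  \sum_(x <- sph (k + l)) F x =
  \sum_(u <- sph k) \sum_(x <- sph l | reduced (word u ++ word x)) F (u * x)%g.
Proof.
have E (u : G) : u \in sph k -> \sum_(x <- sph l | reduced (word u ++ word x)) F (u * x)%g =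
    \sum_(x <- sph (k + l) | pre k x == u) F x.
  rewrite mem_sph => /eqP uk.
  rewrite -[LHS]big_filter -[RHS]big_filter -(big_map (fun x => (u * x)%g) xpredT).
  apply: perm_big; apply: uniq_perm.
  - by rewrite map_inj_uniq ?filter_uniq ?sph_uniq //; exact: mulgI.
  - by rewrite filter_uniq ?sph_uniq.
  - move=> x; rewrite mem_filter mem_sph; apply/mapP/andP.
      move=> [y]; rewrite mem_filter mem_sph => /andP[uy /eqP yl] ->.
      rewrite /len word_mul // size_cat -/(len u) uk -/(len y) yl eqxx; split=> //.
      by apply/eqP/val_inj; rewrite -[LHS]/(take k (word (u * y)%g)) word_mul // -uk take_size_cat.
    move=> [/eqP xu /eqP xkl]; exists (suf k x); last by rewrite -{1}xu pre_suf.
    rewrite mem_filter mem_sph len_suf xkl addKn eqxx andbT -xu /= cat_take_drop.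
    exact: word_reduced.
rewrite [RHS]big_seq; under [RHS]eq_bigr do rewrite E //.
rewrite -big_seq; rewrite (exchange_big_dep xpredT) //=.
rewrite big_seq [RHS]big_seq; apply: eq_bigr => x; rewrite mem_sph => /eqP xkl.
rewrite big_mkcond (bigD1_seq (pre k x)) ?sph_uniq ?mem_sph ?len_pre ?xkl ?leq_addr //=.
by rewrite eqxx big1 ?addr0 // => u ux; rewrite eq_sym (negbTE ux).
Qed.

Lemma len_div_suf k x : len ((suf k x)^-1)%g = (len x - k)%N.
Proof. by rewrite len_finv len_suf. Qed.

Lemma pre_suf_inj k x y : pre k x = pre k y -> ((suf k x)^-1 = (suf k y)^-1)%g -> x = y.
Proof. by move=> pxy /invg_inj sxy; rewrite -(pre_suf k x) -(pre_suf k y) pxy sxy. Qed.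

Lemma sph_inv_perm k : perm_eq [seq (x^-1)%g | x <- sph k] (sph k).
Proof.
apply: uniq_perm; rewrite ?map_inj_uniq ?sph_uniq //; first exact: invg_inj.
move=> x; apply/mapP/idP => [[y + ->]|xk]; first by rewrite !mem_sph len_finv.
by exists (x^-1)%g; rewrite ?invgK // mem_sph len_finv -mem_sph.
Qed.

Definition below u x := prefix u (word x).

Lemma below_divl x y : below (word ((suf (lcp x y) x)^-1)%g) (x^-1 * y)%g.
Proof. by rewrite /below word_divl prefix_prefix. Qed.

End Words.

(** * Flows on the tree and the mass they give to cones *)

Section Flow.
Variables (X : finType) (V : nmodType) (K : nat) (t : freeGroup X -> V).
Local Notation G := (freeGroup X).
Hypothesis tE : forall y : G, (K <= len y)%N ->
  t y = \sum_(z <- sph X 1 | reduced (word y ++ word z)) t (y * z)%g.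

(** The next level replaces each word by its one-letter extensions, and whether [u] is a prefix is
    already decided at level [M]. *)
Lemma flow_sph M u : (K <= M)%N -> (size u <= M)%N ->
  \sum_(z <- sph X M.+1 | below u z) t z = \sum_(z <- sph X M | below u z) t z.
Proof.
move=> KM uM; rewrite big_mkcond -addn1 sph_split [RHS]big_mkcond /=.
rewrite big_seq [RHS]big_seq; apply: eq_bigr => y; rewrite mem_sph => /eqP yM.
rewrite tE ?yM //; case: ifPn => [uy|uy].
  by apply: eq_bigr => z yz; rewrite /below word_mul // (prefix_trans uy) // prefix_prefix.
rewrite big1 // => z yz; rewrite ifF //; apply: contraNF uy.
rewrite /below word_mul // !prefixE take_cat -/(len y) yM.
by move: uM; rewrite leq_eqVlt => /predU1P[->|->//]; rewrite ltnn subnn take0 cats0 -yM take_size.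
Qed.

Lemma flow_level M M' u : (K <= M)%N -> (size u <= M)%N -> (K <= M')%N -> (size u <= M')%N ->
  \sum_(z <- sph X M | below u z) t z = \sum_(z <- sph X M' | below u z) t z.
Proof.
wlog MM' : M M' / (M <= M')%N.
  by move=> H *; case: (leqP M M') => [|/ltnW] /H -> //.
move=> KM uM _ _; rewrite -(subnK MM'); elim: (M' - M)%N => //= k ->.
by rewrite addSn flow_sph // (leq_trans _ (leq_addl _ _)).
Qed.

(** The flow through the cone of [u]; any admissible level gives the same value, by [massE]. *)
Definition mass u := \sum_(z <- sph X (maxn K (size u)) | below u z) t z.

Lemma massE M u : (K <= M)%N -> (size u <= M)%N ->
  \sum_(z <- sph X M | below u z) t z = mass u.
Proof. by move=> KM uM; apply: flow_level; rewrite ?leq_maxl ?leq_maxr. Qed.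

(** The cones of the words of length [k] partition every sphere of radius at least [k]. *)
Lemma sum_mass k : \sum_(u <- sph X k) mass (word u) = mass [::].
Proof.
pose M := maxn K k.
rewrite -(@massE M [::]) ?leq_maxl // big_seq.
under eq_bigr => u uk.
  rewrite -(@massE M) ?leq_maxl //; last first.
    by move: uk; rewrite mem_sph /len => /eqP ->; exact: leq_maxr.
  over.
rewrite -big_seq (exchange_big_dep xpredT) //= [RHS]big_seq_cond.
rewrite [LHS]big_seq; apply: eq_big => [x|x xM]; first by rewrite /below prefix0s andbT.
have kx : (k <= len x)%N by move: xM; rewrite mem_sph => /eqP ->; exact: leq_maxr.
rewrite big_mkcond (bigD1_seq (pre k x)) ?sph_uniq ?mem_sph ?len_pre //=.
rewrite /below prefixE /= size_takel // eqxx big_seq_cond big1 ?addr0 // => u /andP[].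
rewrite mem_sph => /eqP uk /eqP ux; rewrite ifF //; apply/negP; rewrite prefixE => /eqP E.
by apply: ux; apply: val_inj; rewrite /= -E -uk.
Qed.

End Flow.

Lemma mass_ge0 (X : finType) (R : numDomainType) K (t : freeGroup X -> R) u :
  (forall y, 0 <= t y) -> 0 <= mass K t u.
Proof. by move=> t0; exact: sumr_ge0. Qed.


(** * Haagerup's inequality *)

Section Haagerup.
Variables (R : realType) (X : finType).
Local Notation G := (freeGroup X).
Implicit Types (x y : G).

Lemma sum_partition (I J : eqType) (V : nmodType) (s : seq I) (t : seq J)
    (P : pred I) (h : I -> J) (F : I -> V) :
  uniq t -> (forall i, i \in s -> P i -> h i \in t) ->
  \sum_(i <- s | P i) F i = \sum_(j <- t) \sum_(i <- s | P i && (h i == j)) F i.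
Proof.
move=> ut ht; rewrite (exchange_big_dep P) => [|j i _ /andP[]//] /=.
rewrite big_seq_cond [RHS]big_seq_cond; apply: eq_bigr => i /andP[si Pi].
rewrite big_mkcond (bigD1_seq (h i)) ?ht //= Pi eqxx big1 ?addr0 // => j.
by rewrite eq_sym => /negbTE ->.
Qed.

Variables (c phi : G -> R) (n : nat).
Hypotheses (c0 : forall x, 0 <= c x) (phi0 : forall x, 0 <= phi x).

Local Notation T := (\sum_(x <- wball X n) c x ^+ 2).
Let pairs := [seq (x, y) | x <- wball X n, y <- wball X n].
(** The pairs that, after removal of their common prefix, leave tails [q] and [s] of lengths [i] and
    [j]; then [x^-1 y = q^-1 s] has length [i + j]. *)
Let D i j (p : G * G) :=
  (len p.1 == lcp p.1 p.2 + i)%N && (len p.2 == lcp p.1 p.2 + j)%N.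
Let tail i x := suf (len x - i) x.

Let pairs_uniq : uniq pairs.
Proof. by apply: allpairs_uniq; rewrite ?wball_uniq // => -[? ?] [? ?]. Qed.

Let tails_inj i j (p p' : G * G) : D i j p -> D i j p' ->
  p.1 = p'.1 -> tail j p.2 = tail j p'.2 -> p = p'.
Proof.
case: p p' => [x y] [x' y'] /andP[/= /eqP xi /eqP yj] /andP[/= /eqP xi' /eqP yj'] xx.
rewrite /tail yj yj' !addnK => s; subst x'; congr pair.
have ll : lcp x y = lcp x y' by apply/eqP; rewrite -(eqn_add2r i) -xi -xi'.
by rewrite -(pre_suf (lcp x y) y) -(pre_suf (lcp x y') y') s -!lcp_pre ll.
Qed.

Let D_swap i j p : D i j p = D j i (p.2, p.1).
Proof.
have lcpC x y : lcp x y = lcp y x.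
  rewrite /lcp; elim: (word x) (word y) => [|a u IHu] [|b v] //=.
  by rewrite eq_sym IHu; case: eqP.
by rewrite /D /= andbC lcpC.
Qed.

Let mass_tail i q := \sum_(x <- wball X n | tail i x == q) c x ^+ 2.

Let mass_tail_ge0 i q : 0 <= mass_tail i q.
Proof. by apply: sumr_ge0 => x _; exact: sqr_ge0. Qed.

Let sum_mass_tail i (t : seq G) : uniq t -> \sum_(q <- t) mass_tail i q <= T.
Proof.
move=> ut; rewrite (exchange_big_dep xpredT) //=; apply: ler_sum => x _.
rewrite -big_filter; have [xt|xt] := boolP (tail i x \in t).
  rewrite big_filter big_mkcond (bigD1_seq (tail i x)) //= eqxx big1 ?addr0 // => q.
  by rewrite eq_sym => /negbTE ->.
rewrite big_filter big_seq_cond big1 ?sqr_ge0 // => q /andP[qt /eqP qE].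
by rewrite qE qt in xt.
Qed.

(** The factor [phi] depends only on the two tails. Cauchy-Schwarz is applied first among the pairs
    with given tails, then over the pairs of tails. *)
Let haagerup_block i j :
  \sum_(p <- pairs | D i j p) c p.1 * c p.2 * phi (p.1^-1 * p.2)%g <=
  T * Num.sqrt (\sum_(z <- sph X (i + j)) phi z ^+ 2).
Proof.
(* The length condition excludes cancellation in [q^-1 s]. *)
pose Q := [seq qs <- [seq (q, s) | q <- sph X i, s <- sph X j] |
            len (qs.1^-1 * qs.2)%g == (i + j)%N].
pose h (p : G * G) := (tail i p.1, tail j p.2).
have Quniq : uniq Q.
  by rewrite filter_uniq // allpairs_uniq ?sph_uniq // => -[? ?] [? ?].
have hdiv p : D i j p -> ((h p).1^-1 * (h p).2 = p.1^-1 * p.2)%g.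
  move=> /andP[/eqP p1 /eqP p2]; rewrite /h /tail /= p1 p2 !addnK.
  set l := lcp p.1 p.2; rewrite -{2}(pre_suf l p.1) -{2}(pre_suf l p.2) lcp_pre.
  by rewrite invgM -mulgA mulKg.
have hQ p : p \in pairs -> D i j p -> h p \in Q.
  move=> _ Dp; rewrite mem_filter hdiv // len_divl.
  have /andP[/eqP p1 /eqP p2] := Dp; rewrite p1 p2 !addKn eqxx /=.
  by apply/allpairsP; exists (h p); split => //;
    rewrite mem_sph len_suf ?p1 ?p2 subKn ?leq_addl // addnK.
pose I qs := \sum_(p <- pairs | D i j p && (h p == qs)) c p.1 * c p.2.
have I0 qs : 0 <= I qs by apply: sumr_ge0 => p _; rewrite mulr_ge0.
have -> : \sum_(p <- pairs | D i j p) c p.1 * c p.2 * phi (p.1^-1 * p.2)%g =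
    \sum_(qs <- Q) I qs * phi (qs.1^-1 * qs.2)%g.
  rewrite (sum_partition _ Quniq hQ); apply: eq_bigr => qs _.
  rewrite mulr_suml; apply: eq_bigr => p /andP[Dp /eqP <-].
  by rewrite hdiv.
(* With both tails fixed, either entry determines the pair, so each of the two sums of squares is a
   sum over distinct words. *)
have Ile qs : I qs ^+ 2 <= mass_tail i qs.1 * mass_tail j qs.2.
  apply: (@le_trans _ _ ((\sum_(p <- pairs | D i j p && (h p == qs)) c p.1 ^+ 2) *
      (\sum_(p <- pairs | D i j p && (h p == qs)) c p.2 ^+ 2))).
    apply: sum_sqr_le => p _; split; rewrite ?sqr_ge0 ?mulr_ge0 //.
    by rewrite exprMn lexx.
  have tl : {in [pred p in pairs | D i j p && (h p == qs)] &, injective (fun p => p.1)}.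
    move=> p p'; rewrite !inE => /andP[_ /andP[Dp /eqP hp]] /andP[_ /andP[Dp' /eqP hp']].
    move=> pp; apply: (tails_inj Dp Dp' pp).
    by apply: val_inj; have := etrans hp (esym hp'); rewrite /h => -[_ E]; exact: E.
  have tr : {in [pred p in pairs | D i j p && (h p == qs)] &, injective (fun p => p.2)}.
    move=> p p'; rewrite !inE => /andP[_ /andP[Dp /eqP hp]] /andP[_ /andP[Dp' /eqP hp']].
    move=> pp; have E : (p.2, p.1) = (p'.2, p'.1).
      rewrite D_swap in Dp; rewrite D_swap in Dp'; apply: (tails_inj Dp Dp') => //=.
      by apply: val_inj; have := etrans hp (esym hp'); rewrite /h => -[E _]; exact: E.
    by case: p p' E {Dp Dp' hp hp' pp} => [? ?] [? ?] [-> ->].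
  apply: ler_pM; [by apply: sumr_ge0 => p _; exact: sqr_ge0|
    by apply: sumr_ge0 => p _; exact: sqr_ge0| |].
    rewrite /mass_tail -[leRHS]big_filter.
    have := @sum_inj_le R _ _ pairs [seq x <- wball X n | tail i x == qs.1]
      (fun p => D i j p && (h p == qs)) (fun p => p.1) (fun x => c x ^+ 2) pairs_uniq tl.
    apply => [p /allpairsP[xy [x1 y1 pE]] /andP[_ /eqP hE]|x].
      by rewrite mem_filter -hE eqxx /= pE.
    exact: sqr_ge0.
  rewrite /mass_tail -[leRHS]big_filter.
  have := @sum_inj_le R _ _ pairs [seq x <- wball X n | tail j x == qs.2]
      (fun p => D i j p && (h p == qs)) (fun p => p.2) (fun x => c x ^+ 2) pairs_uniq tr.
  apply => [p /allpairsP[xy [x1 y1 pE]] /andP[_ /eqP hE]|x]; last exact: sqr_ge0.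
  by rewrite mem_filter -hE eqxx /= pE.
set s := \sum_(z <- sph X (i + j)) _; have s0 : 0 <= s by apply: sumr_ge0 => z _; exact: sqr_ge0.
have T0 : 0 <= T by apply: sumr_ge0 => z _; exact: sqr_ge0.
have TS0 : 0 <= T * Num.sqrt s by rewrite mulr_ge0 ?sqrtr_ge0.
rewrite -ler_sqr ?nnegrE //; last by apply: sumr_ge0 => qs _; rewrite mulr_ge0.
rewrite exprMn sqr_sqrtr //.
apply: (@le_trans _ _ ((\sum_(qs <- Q) mass_tail i qs.1 * mass_tail j qs.2) *
    (\sum_(qs <- Q) phi (qs.1^-1 * qs.2)%g ^+ 2))).
  apply: sum_sqr_le => qs _; split; rewrite ?sqr_ge0 ?mulr_ge0 //.
  by rewrite exprMn ler_wpM2r ?sqr_ge0.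
apply: ler_pM; [by apply: sumr_ge0 => qs _; rewrite mulr_ge0|
  by apply: sumr_ge0 => qs _; exact: sqr_ge0| |].
  apply: (@le_trans _ _ (\sum_(qs <- [seq (q, s) | q <- sph X i, s <- sph X j])
      mass_tail i qs.1 * mass_tail j qs.2)).
    by rewrite big_filter [leRHS](bigID (fun qs : G * G => len (qs.1^-1 * qs.2)%g == (i + j)%N)) /=
       lerDl sumr_ge0 // => qs _; rewrite mulr_ge0.
  rewrite big_allpairs /=; under eq_bigr do rewrite -mulr_sumr.
  rewrite -mulr_suml expr2 ler_pM ?sumr_ge0 ?sum_mass_tail ?sph_uniq //.
(* Without cancellation [q] and [s] are recovered from [q^-1 s] by cutting its word at position
   [i]. *)
apply: sum_inj_le => // [[q s'] [q' s'']||z].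
- rewrite !inE => /andP[+ _] /andP[+ _].
  rewrite !mem_filter /= => /andP[/eqP qs /allpairsP[[q1 s1] /= [+ + [qE sE]]]].
  rewrite -qE -sE !mem_sph => /eqP qi /eqP sj.
  move=> /andP[/eqP qs' /allpairsP[[q2 s2] /= [+ + [qE' sE']]]].
  rewrite -qE' -sE' !mem_sph => /eqP qi' /eqP sj' E.
  have l0 x y k l : len x = k -> len y = l -> len (x^-1 * y)%g = (k + l)%N ->
      word (x^-1 * y)%g = winv (word x) ++ word y.
    move=> xk yl; rewrite len_divl word_divl.
    have [lx ly] := (lcp_lel x y, lcp_ler x y); rewrite xk yl in lx ly *.
    move=> El; have -> : lcp x y = 0%N by lia.
    by rewrite /= !drop0.
  have := congr1 (@word X) E; rewrite (l0 _ _ i j) // (l0 _ _ i j) //.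
  move=> /eqP; rewrite eqseq_cat ?size_rev ?size_map; last by rewrite -/(len q) qi -qi'.
  by move=> /andP[/eqP /(can_inj (@winvK X)) /val_inj -> /eqP /val_inj ->].
- by move=> [q s'] + _; rewrite mem_filter mem_sph => /andP[].
- exact: sqr_ge0.
Qed.

(* Haagerup's inequality: convolution by a function supported on the sphere of
   radius [m] has norm at most [m + 1] times its [l^2] norm. *)
Lemma haagerup :
  \sum_(x <- wball X n) \sum_(y <- wball X n) c x * c y * phi (x^-1 * y)%g <=
  T * \sum_(i < n) \sum_(j < n) Num.sqrt (\sum_(z <- sph X (i + j)) phi z ^+ 2).
Proof.
rewrite -(@big_allpairs _ _ _ _ _ _ _ (fun p => c p.1 * c p.2 * phi (p.1^-1 * p.2)%g)) /=.
(* The pairs are sorted by the lengths of their tails, which are below [n] inside the ball. *)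
pose h (p : G * G) := ((len p.1 - lcp p.1 p.2)%N, (len p.2 - lcp p.1 p.2)%N).
pose t := [seq (i, j) | i <- iota 0 n, j <- iota 0 n].
rewrite (@sum_partition _ _ _ _ t xpredT h) /=; first last.
- move=> p /allpairsP[xy [+ + ->]] _ /=; rewrite !mem_wball => x1 y1.
  by apply/allpairsP; exists (h xy); rewrite !mem_iota /= !add0n !(leq_ltn_trans (leq_subr _ _)).
- by rewrite allpairs_uniq ?iota_uniq // => -[? ?] [? ?].
rewrite mulr_sumr -(big_mkord xpredT (fun i => T * \sum_(j < n) Num.sqrt (\sum_(z <- sph X (i + j)) phi z ^+ 2))).
rewrite big_allpairs /index_iota subn0; apply: ler_sum => i _.
rewrite mulr_sumr -(big_mkord xpredT (fun j => T * Num.sqrt (\sum_(z <- sph X (i + j)) phi z ^+ 2))).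
rewrite /index_iota subn0; apply: ler_sum => j _.
apply: le_trans (haagerup_block i j); rewrite le_eqVlt; apply/orP; left; apply/eqP.
apply: eq_bigl => p; rewrite /h xpair_eqE /D.
have [lx ly] := (lcp_lel p.1 p.2, lcp_ler p.1 p.2).
by congr andb; apply/eqP/eqP; lia.
Qed.

End Haagerup.

(** * Coefficients of multiplicative functions *)

Section Forms.
Variables (R : realType) (n : nat) (S : normalizedSystem R n).
Local Notation V := (sysV S).
Local Notation H := (sysH S).
Local Notation B := (sysB S).
Local Notation G := (Gamma n).
Local Notation ell := (last_letter (ord0, true) : G -> alphabet n).
Local Notation cl f := (\pi_(smooth S)%qT f).
Local Notation sqn z := (Normc.normc z ^+ 2).
Implicit Types (f g h : multfun S) (x y z : G) (a b c : alphabet n) (u v : smooth S).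

Lemma sqnE (z : R[i]) : (sqn z)%:C%C = `|z| ^+ 2.
Proof. by rewrite rmorphXn. Qed.

Lemma normc_ge0 (z : R[i]) : 0 <= Normc.normc z.
Proof. by case: z => a b; exact: sqrtr_ge0. Qed.

Lemma normc_conj (z : R[i]) : Normc.normc (Num.conj z) = Normc.normc z.
Proof. by apply: complexI; rewrite -[LHS]/(`|Num.conj z|) norm_conjC. Qed.

Lemma normc_sum (I : Type) (s : seq I) (P : pred I) (F : I -> R[i]) :
  Normc.normc (\sum_(i <- s | P i) F i) <= \sum_(i <- s | P i) Normc.normc (F i).
Proof.
elim/big_rec2: _ => [|i y z _ le]; first by rewrite ComplexField.Normc.normc0.
by apply: le_trans (le_normcD _ _) _; rewrite lerD2l.
Qed.

Lemma Re_sum (I : Type) (s : seq I) (P : pred I) (F : I -> R[i]) :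
  complex.Re (\sum_(i <- s | P i) F i) = \sum_(i <- s | P i) complex.Re (F i).
Proof. by elim/big_rec2: _ => // i y z _ <-; rewrite raddfD. Qed.

Lemma form_ge0 a (v : V a) : 0 <= complex.Re (B a v v).
Proof. by have := dnorm_ge0 (B a) v; rewrite lecE => /andP[]. Qed.

Lemma formRe a (v : V a) : (complex.Re (B a v v))%:C%C = B a v v.
Proof. by apply: RRe_real; apply: ger0_real; exact: dnorm_ge0. Qed.

Lemma form_CS a (v w : V a) :
  sqn (B a v w) <= complex.Re (B a v v) * complex.Re (B a w w).
Proof.
rewrite -lecR sqnE rmorphM /= !formRe.
by have [] := CauchySchwarz (B a) v w.
Qed.

Lemma sum_sph1 (W : nmodType) (P : pred G) (F : G -> W) :
  \sum_(z <- sph 'I_n.+2 1 | P z) F z = \sum_(b | P (gen b)) F (gen b).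
Proof.
rewrite -big_filter -[RHS]big_filter -(big_map (@gen _) xpredT).
apply: perm_big; apply: uniq_perm; rewrite ?filter_uniq ?sph_uniq //.
  by rewrite map_inj_uniq ?filter_uniq ?index_enum_uniq // => a b [].
move=> z; rewrite mem_filter mem_sph; apply/andP/mapP.
  case=> Pz z1; have [a zE] : exists a, z = gen a.
    case: z z1 {Pz} => -[|a [|b w]] rw //= _; exists a; exact: val_inj.
  by exists a => //; rewrite mem_filter mem_index_enum andbT -zE.
by move=> [b]; rewrite mem_filter => /andP[Pb _] ->.
Qed.

Lemma len_mul_gen_reduced y b : (len (y * gen b)%g == (len y).+1) = reduced (word y ++ [:: b]).
Proof.
rewrite (len_mul_gen (ord0, true)) reduced_cat_head ?word_reduced //.
by rewrite /len /last_letter; case: (word y).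
Qed.

Lemma multiplicative_fromW N M f : (N <= M)%N ->
  multiplicative_from N f -> multiplicative_from M f.
Proof. by move=> NM fN x Mx; apply: fN; exact: leq_trans Mx. Qed.

(** The polarized normalization of the forms is exactly conservation of flow; the backward letter
    contributes nothing, because its map [H] vanishes. *)
Lemma last_form_flow f g N y : multiplicative_from N f -> multiplicative_from N g ->
  (N < len y)%N -> last_form f g y =
  \sum_(z <- sph 'I_n.+2 1 | reduced (word y ++ word z)) last_form f g (y * z)%g.
Proof.
move=> fN gN Ny; rewrite sum_sph1 /=.
have [x xy /(_ (ord0, true))[yE ry]] := split_last (leq_ltn_trans (leq0n N) Ny).
set a := ell y in yE ry; have Nx : (N <= len x)%N by rewrite -ltnS xy.
rewrite (last_form_eq f g (erefl a)) form_polar.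
rewrite (bigID (fun b => reduced (word y ++ [:: b]))) /= addrC big1 ?add0r => [|b].
  apply: eq_bigr => b yb; have yb' : len (y * gen b)%g = (len y).+1.
    by apply/eqP; rewrite len_mul_gen_reduced.
  rewrite (last_form_eq f g (last_letter_mul_gen _ yb')).
  have xab : len (x * gen a * gen b)%g = (len x).+2 by rewrite -yE yb' xy.
  by rewrite yE (fN x Nx).2 // (gN x Nx).2 // !componentT.
rewrite -len_mul_gen_reduced (len_mul_gen (ord0, true)) => /norP[_].
rewrite negbK => /eqP ->; rewrite -/a sysH_eq0 ?lfunE /= ?linear0r //.
by have := gen_linv (linv a); rewrite linvK.
Qed.

Definition lev f : nat := projT1 (cid (multfunP f)).
Lemma levP f : multiplicative_from (lev f) f.
Proof. exact: projT2 (cid (multfunP f)). Qed.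
Arguments levP : clear implicits.

Lemma smooth_form_sph f g : exists M0, forall M, (M0 <= M)%N ->
  smooth_form (cl f) (cl g) = \sum_(y <- sph 'I_n.+2 M) last_form f g y.
Proof.
have [N0 fgN0] := smooth_formE f g; exists N0.+1 => -[//|M] NM.
by rewrite (fgN0 M) // sphere_formE fsbig_finite //; exact: sphere_fin.
Qed.

(** The form is an eventual value by definition; conservation of flow shows that every level beyond
    [N] already attains it. *)
Lemma smooth_form_level N f g M : multiplicative_from N f -> multiplicative_from N g ->
  (N < M)%N -> smooth_form (cl f) (cl g) = \sum_(y <- sph 'I_n.+2 M) last_form f g y.
Proof.
move=> fN gN NM; have [M0 fgM0] := smooth_form_sph f g.
rewrite (fgM0 (maxn M0 M)) ?leq_maxl //.
have tE y : (N.+1 <= len y)%N -> last_form f g y =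
    \sum_(z <- sph 'I_n.+2 1 | reduced (word y ++ word z)) last_form f g (y * z)%g.
  by move=> Ny; exact: (@last_form_flow _ _ N).
have := flow_level tE (u := [::]) (M := maxn M0 M) (M' := M).
rewrite leq_max NM orbT /= => /(_ isT isT isT isT).
by under eq_bigl do rewrite /below prefix0s; under [RHS]eq_bigl do rewrite /below prefix0s.
Qed.

Definition weight f y : R := complex.Re (last_form f f y).

Lemma weight_ge0 f y : 0 <= weight f y. Proof. exact: form_ge0. Qed.

(** The share of the squared norm of [f] carried by the cone of [w], a finitely additive measure on
    the boundary of the tree; [mu f [::]] is the whole squared norm. *)
Definition mu f (w : seq (alphabet n)) : R := mass (lev f).+1 (weight f) w.

Lemma mu_ge0 f w : 0 <= mu f w.
Proof. by apply: mass_ge0 => y; exact: weight_ge0. Qed.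

Lemma weight_flow f y : ((lev f).+1 <= len y)%N -> weight f y =
  \sum_(z <- sph 'I_n.+2 1 | reduced (word y ++ word z)) weight f (y * z)%g.
Proof.
by move=> fy; rewrite /weight (last_form_flow (levP f) (levP f) fy) Re_sum.
Qed.

Lemma muE f M w : (lev f < M)%N -> (size w <= M)%N ->
  \sum_(z <- sph 'I_n.+2 M | below w z) weight f z = mu f w.
Proof. exact: (massE (@weight_flow f)). Qed.

Lemma sum_mu f k : \sum_(x <- sph 'I_n.+2 k) mu f (word x) = mu f [::].
Proof. exact: (sum_mass (@weight_flow f)). Qed.

Lemma sum_mu_inv f k : \sum_(x <- sph 'I_n.+2 k) mu f (word (x^-1)%g) = mu f [::].
Proof.
rewrite -(sum_mu f k) -(big_map (fun x => x^-1)%g xpredT (fun x => mu f (word x))).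
exact/perm_big/sph_inv_perm.
Qed.

Lemma last_form_translate_CS f g x y : (len x < len y)%N ->
  sqn (last_form f (translate x g) y) <= weight f y * weight g (x^-1 * y)%g.
Proof.
move=> xy; apply: le_trans (form_CS _ _) _; rewrite ler_wpM2l ?form_ge0 //.
by rewrite /weight (last_form_eq g g (last_letter_mul _ _)) // len_finv.
Qed.

(* The translate by [x^-1] maps the words of the block injectively into one sphere,
   inside the cone of [(suf j x)^-1]. *)
Lemma coef_block f g x j : (j <= len x)%N -> exists M0, forall M, (M0 <= M)%N ->
  sqn (\sum_(y <- sph 'I_n.+2 M | lcp x y == j) last_form f (translate x g) y) <=
  mu f (word (pre j x)) * mu g (word ((suf j x)^-1)%g).
Proof.
move=> jx; exists (lev f + lev g + len x + len x).+1 => M MM.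
apply: (@le_trans _ _ ((\sum_(y <- sph 'I_n.+2 M | lcp x y == j)
   Normc.normc (last_form f (translate x g) y)) ^+ 2)).
  by rewrite lerXn2r ?nnegrE ?normc_ge0 ?normc_sum ?sumr_ge0 // => y _; exact: normc_ge0.
apply: (@le_trans _ _ ((\sum_(y <- sph 'I_n.+2 M | lcp x y == j) weight f y) *
   (\sum_(y <- sph 'I_n.+2 M | lcp x y == j) weight g (x^-1 * y)%g))).
  rewrite !(big_seq_cond (fun y => lcp x y == j)).
  apply: sum_sqr_le => y /andP[]; rewrite mem_sph => /eqP yM _.
  split; rewrite ?normc_ge0 ?weight_ge0 //; apply: last_form_translate_CS.
  by rewrite yM; lia.
apply: ler_pM; [by apply: sumr_ge0 => y _; exact: weight_ge0|
  by apply: sumr_ge0 => y _; exact: weight_ge0| |].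
  rewrite -(@muE _ M); [|lia|rewrite -/(len (pre j x)) len_pre //; lia].
  rewrite [leRHS](bigID (fun y => lcp x y == j)) /= -[leLHS]addr0 lerD ?sumr_ge0 //; last first.
    by move=> y _; exact: weight_ge0.
  rewrite le_eqVlt; apply/orP; left; apply/eqP; apply: eq_bigl => y.
  case: eqP => [<-|]; rewrite ?andbF // andbT /below.
  have := congr1 (@word _) (lcp_pre x y); rewrite /= => ->.
  by rewrite -{2}(cat_take_drop (lcp x y) (word y)) prefix_prefix.
(* This is the length of [x^-1 y] when [|y| = M] and the common prefix has length [j]. *)
rewrite -(@muE _ (len x - j + (M - j))); [|lia|].
  rewrite -[leRHS]big_filter; apply: sum_inj_le; first exact: sph_uniq.
  - by move=> y y' _ _ /mulgI.
  - move=> y; rewrite mem_sph => /eqP yM /eqP xyj; rewrite mem_filter mem_sph.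
    by rewrite len_divl yM xyj eqxx -xyj below_divl.
  - by move=> y; exact: weight_ge0.
by rewrite -/(len ((suf j x)^-1)%g) len_div_suf leq_addr.
Qed.

Definition coef u v x : R[i] := smooth_form u (smooth_rep x v).

(** The level sum is cut according to the point where [y] leaves the geodesic to [x]; Cauchy-Schwarz
    over its [|x| + 1] vertices costs the factor in front. *)
Lemma coef_le f g x : sqn (coef (cl f) (cl g) x) <=
  (len x).+1%:R * \sum_(j < (len x).+1) mu f (word (pre j x)) * mu g (word ((suf j x)^-1)%g).
Proof.
have [M0 fgM0] := smooth_form_sph f (translate x g).
have /boolp.choice[m Hm] (j : 'I_(len x).+1) : exists m, forall M, (m <= M)%N ->
  sqn (\sum_(y <- sph 'I_n.+2 M | lcp x y == j) last_form f (translate x g) y) <=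
  mu f (word (pre j x)) * mu g (word ((suf j x)^-1)%g).
  by apply: coef_block; rewrite -ltnS.
pose M := (M0 + \sum_j m j)%N; have mM j : (m j <= M)%N.
  by rewrite /M (bigD1 j) //= addnCA leq_addr.
rewrite /coef smooth_repE (fgM0 M) ?leq_addr //.
rewrite (@sum_partition _ _ _ _ (index_enum 'I_(len x).+1) xpredT (fun y => inord (lcp x y))) /=;
  first last.
- by move=> y _ _; exact: mem_index_enum.
- exact: index_enum_uniq.
set z := BIG_F; apply: (@le_trans _ _ ((\sum_j Normc.normc (z j)) ^+ 2)).
  by rewrite lerXn2r ?nnegrE ?normc_ge0 ?normc_sum ?sumr_ge0 // => y _; exact: normc_ge0.
have -> : (len x).+1%:R = \sum_(j < (len x).+1) 1 :> R by rewrite sumr_const card_ord.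
apply: sum_sqr_le => j _; rewrite ?normc_ge0 ler01 mulr_ge0 ?mu_ge0 // mul1r; split=> //.
have -> : z j = \sum_(y <- sph 'I_n.+2 M | lcp x y == j) last_form f (translate x g) y.
  apply: eq_bigl => y; rewrite -val_eqE /= inordK // ltnS; exact: lcp_lel.
exact: Hm.
Qed.

(** For fixed [j], sending [x] to its prefix and its inverted suffix is injective into a product of
    two spheres, where the sum factors into total masses. One factor [k + 1] comes from [coef_le],
    the other from the number of values of [j]. *)
Lemma sphere_coef_le f g k : \sum_(x <- sph 'I_n.+2 k) sqn (coef (cl f) (cl g) x) <=
  k.+1%:R ^+ 2 * (mu f [::] * mu g [::]).
Proof.
apply: (@le_trans _ _ (\sum_(x <- sph 'I_n.+2 k) k.+1%:R * \sum_(j < k.+1)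
   mu f (word (pre j x)) * mu g (word ((suf j x)^-1)%g))).
  rewrite big_seq [leRHS]big_seq; apply: ler_sum => x; rewrite mem_sph => /eqP <-.
  exact: coef_le.
rewrite -mulr_sumr expr2 -mulrA ler_wpM2l // exchange_big /=.
rewrite -[X in X%:R](card_ord k.+1) mulr_natl -sumr_const; apply: ler_sum => j _.
have jk : (j <= k)%N by rewrite -ltnS.
pose h x := (pre j x, (suf j x)^-1)%g.
apply: (@le_trans _ _ (\sum_(p <- [seq (q, s) | q <- sph 'I_n.+2 j, s <- sph 'I_n.+2 (k - j)])
   mu f (word p.1) * mu g (word p.2))).
  apply: (@sum_inj_le _ _ _ _ _ xpredT h (fun p => mu f (word p.1) * mu g (word p.2))).
  - exact: sph_uniq.
  - by move=> x y _ _; rewrite /h => -[px sx]; apply: (@pre_suf_inj _ j); apply: val_inj.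
  - move=> x; rewrite mem_sph => /eqP xk _; apply/allpairsP; exists (h x).
    by rewrite !mem_sph len_div_suf len_pre ?xk.
  - by move=> p; rewrite mulr_ge0 ?mu_ge0.
rewrite big_allpairs /=; under eq_bigr do rewrite -mulr_sumr sum_mu.
by rewrite -mulr_suml sum_mu.
Qed.

(** The coproduct has one zero for each summand, so the restriction vanishes through [mzero_fun],
    which picks the summand of the last letter. *)
Definition mcut_fun (p : pred (alphabet n)) (f : G -> coprod S) x : coprod S :=
  if word x is a :: _ then if p a then f x else mzero_fun S x else mzero_fun S x.

Lemma mcut_subproof p f : exists N, multiplicative_from N (mcut_fun p f).
Proof.
exists (lev f).+1 => x fx.
have [a [w xE]] : exists a w, word x = a :: w.
  by move: fx; rewrite /len; case: (word x) => // a w; exists a, w.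
have mcut_ext y w' : word y = word x ++ w' ->
    mcut_fun p f y = if p a then f y else mzero_fun S y.
  by rewrite /mcut_fun xE => ->.
have /(_ x (ltnW fx))[fx1 fx2] := levP f.
split=> [b xb|b c xbc].
  rewrite (@mcut_ext _ [:: b]); last by rewrite word_mul // -len_mul_gen_reduced xb.
  by case: ifP => _; [exact: fx1 | exact: last_letter_mul_gen].
have [xb xbc'] := len_mul_gen2 xbc.
have xbw : word (x * gen b)%g = word x ++ [:: b].
  by rewrite word_mul // -len_mul_gen_reduced xb.
have xbcw : word (x * gen b * gen c)%g = word x ++ [:: b; c].
  by rewrite word_mul ?xbw -?catA // catA -xbw -len_mul_gen_reduced xbc'.
rewrite (mcut_ext _ _ xbw) (mcut_ext _ _ xbcw); case: ifP => _; first exact: fx2.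
rewrite /mzero_fun (ell_eq (fun=> 0) (last_letter_mul_gen _ xbc')).
rewrite (ell_eq (fun=> 0) (last_letter_mul_gen _ xb)).
by rewrite componentT linear0.
Qed.

Definition mcut p f : multfun S := MultFun (mcut_subproof p f).

Lemma last_form_mzero f g y : (f y = mzero_fun S y) -> last_form f g y = 0.
Proof. by rewrite /last_form => ->; rewrite componentT linear0l. Qed.

(** The support of the restricted function shares no first letter with [x], so only the block of
    empty common prefix survives. The bound has a sum over each sphere that does not depend on the
    radius. *)
Lemma coef_cut_le p f g x : ~~ (if word x is a :: _ then p a else false) ->
  sqn (coef (cl (mcut p f)) (cl g) x) <= mu (mcut p f) [::] * mu g (word (x^-1)%g).
Proof.
move=> px; have [M0 fgM0] := smooth_form_sph (mcut p f) (translate x g).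
have [M1 blk] := coef_block (mcut p f) g (leq0n (len x)).
rewrite /coef smooth_repE (fgM0 (maxn M0 M1)) ?leq_maxl //.
have -> : \sum_(y <- sph 'I_n.+2 (maxn M0 M1)) last_form (mcut p f) (translate x g) y =
   \sum_(y <- sph 'I_n.+2 (maxn M0 M1) | lcp x y == 0%N) last_form (mcut p f) (translate x g) y.
  rewrite [LHS](bigID (fun y => lcp x y == 0%N)) /= [X in _ + X]big1 ?addr0 // => y.
  move: px; rewrite /lcp; case: x {M0 fgM0 M1 blk} => -[|a w] rx //=.
  case E: (word y) => [|b w'] //=; case: (eqVneq a b) => [ab|_] pa //= _.
  by apply: last_form_mzero; rewrite /= /mcut_fun E -ab (negbTE pa).
apply: le_trans (blk _ (leq_maxr _ _)) _.
have -> : pre 0 x = 1%g by apply: val_inj; rewrite /= take0.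
by have -> : suf 0 x = x by apply: val_inj; rewrite /= drop0.
Qed.

Lemma smooth_form_eq0 u : smooth_form u u = 0 -> u = 0.
Proof.
elim/smoothW: u => f f0; have [M0 ffM0] := smooth_form_sph f f.
have [M1 fM1] := multfun_large f.
apply/smooth_eqP; exists (maxn M0 M1) => x; rewrite geq_max => /andP[M0x M1x].
have := ffM0 _ M0x; rewrite f0 => /esym/eqP.
rewrite psumr_eq0 => [/allP /(_ x)|y _]; last exact: dnorm_ge0.
rewrite mem_sph eqxx => /(_ isT) /=; rewrite /last_form dnorm_eq0 => /eqP E.
by rewrite fM1 //= E.
Qed.

End Forms.
Arguments levP {R n S} f.

(** * Algebra of smooth vectors, restriction to first letters, and Abel bounds *)

Section SmoothAlgebra.
Variables (R : realType) (n : nat) (S : normalizedSystem R n).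
Variable pi : multiplicativeRep S.
Local Notation V := (sysV S).
Local Notation H := (sysH S).
Local Notation B := (sysB S).
Local Notation G := (Gamma n).
Local Notation ell := (last_letter (ord0, true) : G -> alphabet n).
Local Notation cl f := (\pi_(smooth S)%qT f).
Local Notation sqn z := (Normc.normc z ^+ 2).
Implicit Types (f g h : multfun S) (x y z : G) (a b c : alphabet n) (u v w : smooth S).

Lemma smooth_linearE (k : R[i]) f g : k *: cl f + cl g = cl (mlin k f g).
Proof.
change (smooth_add (smooth_scale k (cl f)) (cl g) = cl (mlin k f g)).
rewrite smooth_scaleE smooth_addE; apply/smooth_eqP; exists 0%N => x _.
by rewrite /= /mlin_fun !componentT addr0 scale1r.
Qed.

(** The embedding into the Hilbert space is linear and isometric, so the rules for the form come
    from the inner product, with no computation on representatives. *)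
Lemma sformPl (k : R[i]) u v w :
  smooth_form (k *: u + v) w = k * smooth_form u w + smooth_form v w.
Proof. by rewrite -!(embed_isometry pi) linearP linearPl. Qed.

Lemma sformPr (k : R[i]) u v w :
  smooth_form w (k *: u + v) = Num.conj k * smooth_form w u + smooth_form w v.
Proof. by rewrite -!(embed_isometry pi) linearP linearP. Qed.

Lemma sformC u v : smooth_form u v = Num.conj (smooth_form v u).
Proof. by rewrite -!(embed_isometry pi) hermC expr0 mul1r. Qed.

Lemma sform_rep x u v : smooth_form (smooth_rep x u) (smooth_rep x v) = smooth_form u v.
Proof. by rewrite -!(embed_isometry pi) -!rep_smooth rep_unitary. Qed.

Lemma sform0l u : smooth_form 0 u = 0.
Proof. by rewrite -(embed_isometry pi) linear0 linear0l. Qed.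

Lemma embed_inj u v : embed pi u = embed pi v -> u = v.
Proof.
move=> uv; apply/eqP; rewrite -subr_eq0; apply/eqP/smooth_form_eq0.
by rewrite -(embed_isometry pi) linearB uv subrr linear0l.
Qed.

Lemma smooth_repP (k : R[i]) x u v :
  smooth_rep x (k *: u + v) = k *: smooth_rep x u + smooth_rep x v.
Proof. by apply: embed_inj; rewrite -rep_smooth !linearP /= !rep_smooth. Qed.

Lemma smooth_repM x y u : smooth_rep (x * y)%g u = smooth_rep x (smooth_rep y u).
Proof. by apply: embed_inj; rewrite -!rep_smooth repM. Qed.

Lemma smooth_rep1 u : smooth_rep 1%g u = u.
Proof. by apply: embed_inj; rewrite -!rep_smooth rep1. Qed.

Lemma smooth_repK x u : smooth_rep (x^-1)%g (smooth_rep x u) = u.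
Proof. by rewrite -smooth_repM mulVg smooth_rep1. Qed.

Lemma smooth_repVK x u : smooth_rep x (smooth_rep (x^-1)%g u) = u.
Proof. by rewrite -smooth_repM mulgV smooth_rep1. Qed.

Lemma coef_rep y u v x : coef (smooth_rep y u) v x = coef u v (y^-1 * x)%g.
Proof. by rewrite /coef -[RHS](sform_rep y) -smooth_repM mulVKg. Qed.

Lemma coefP (k : R[i]) u v w x : coef (k *: u + v) w x = k * coef u w x + coef v w x.
Proof. exact: sformPl. Qed.

Lemma coef_inv u v x : Normc.normc (coef v u x) = Normc.normc (coef u v (x^-1)%g).
Proof. by rewrite /coef sformC normc_conj -(sform_rep (x^-1)%g) smooth_repK. Qed.

Definition hcut (p : pred (alphabet n)) u : smooth S := cl (mcut p (repr u)).

Lemma hcutE p f : hcut p (cl f) = cl (mcut p f).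
Proof.
have /smooth_eqP[N fN] : cl (repr (cl f)) = cl f by rewrite reprK.
by apply/smooth_eqP; exists N => x /fN /= fx; rewrite /mcut_fun fx.
Qed.

Lemma eq_hcut p q u : p =1 q -> hcut p u = hcut q u.
Proof. by move=> pq; apply/smooth_eqP; exists 0%N => x _ /=; rewrite /mcut_fun; case: (word x) => // a w'; rewrite pq. Qed.

Lemma hcut_predT u : hcut predT u = u.
Proof.
elim/smoothW: u => f; rewrite hcutE; apply/smooth_eqP; exists 1%N => x /=.
by rewrite /mcut_fun /len; case: (word x).
Qed.

Lemma hcut_pred0 u : hcut pred0 u = 0.
Proof.
apply/smooth_eqP; exists 0%N => x _ /=.
by rewrite /mcut_fun; case: (word x).
Qed.

Lemma hcutU p q u : (forall a, ~~ (p a && q a)) ->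
  hcut (predU p q) u = hcut p u + hcut q u.
Proof.
move=> pq; elim/smoothW: u => f; rewrite !hcutE -[cl (mcut p f)]scale1r smooth_linearE.
have [N fN] := multfun_large f; apply/smooth_eqP; exists N.+1 => x Nx /=.
have {}fN := fN x (ltnW Nx); rewrite /mlin_fun /= /mcut_fun.
move: Nx fN; rewrite {1}/len; case: (word x) => // a w _ fx /=.
by have := pq a; case: (p a); case: (q a) => // _; rewrite /= ?componentT scale1r
  /mzero_fun ?componentT ?addr0 ?add0r.
Qed.

Lemma hcutC p u : u = hcut p u + hcut (predC p) u.
Proof.
rewrite -hcutU => [|a]; last by rewrite /= andbN.
by rewrite -{1}[u]hcut_predT; apply: eq_hcut => a; rewrite /= orbN.
Qed.

(** Restriction to a set of first letters acts as an orthogonal projection. *)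
Lemma sform_hcut p u v : smooth_form (hcut p u) v = smooth_form (hcut p u) (hcut p v).
Proof.
elim/smoothW: u => f; elim/smoothW: v => g; rewrite !hcutE.
have [M0 fgM0] := smooth_form_sph (mcut p f) g.
have [M1 fgM1] := smooth_form_sph (mcut p f) (mcut p g).
rewrite (fgM0 (maxn M0 M1)) ?leq_maxl // (fgM1 (maxn M0 M1)) ?leq_maxr //.
apply: eq_bigr => y _; rewrite /last_form /= /mcut_fun.
case: (word y) => [|a w]; first by rewrite componentT !linear0l.
by case: (p a) => //; rewrite componentT !linear0l.
Qed.

(** Partial sums over balls stand for the series. The lower limit 1/2 keeps negative powers of [r]
    bounded, as [abel_bound_rep] requires. *)
Definition abel_bound m u v := exists C : R, forall r k, 2^-1 <= r -> r < 1 ->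
  \sum_(x <- wball 'I_n.+2 k) sqn (coef u v x) * r ^+ len x <= C / (1 - r) ^+ m.

Lemma abel_bound_sym m u v : abel_bound m u v -> abel_bound m v u.
Proof.
move=> [C uvC]; exists C => r k r2 r1; apply: le_trans (uvC r k r2 r1).
have r0 : 0 <= r by apply: le_trans r2; rewrite invr_ge0.
rewrite [leLHS](eq_bigr (fun x => sqn (coef u v (x^-1)%g) * r ^+ len (x^-1)%g)) => [|x _].
  apply: (@sum_inj_le _ _ _ _ _ xpredT (fun x => x^-1)%g (fun x => sqn (coef u v x) * r ^+ len x)).
  - exact: wball_uniq.
  - by move=> x y _ _ /invg_inj.
  - by move=> x; rewrite !mem_wball len_finv.
  - by move=> x; rewrite mulr_ge0 ?exprn_ge0 ?normc_ge0.
by rewrite coef_inv len_finv.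
Qed.

Lemma abel_bound_lin m (k : R[i]) u v w : abel_bound m u w -> abel_bound m v w -> abel_bound m (k *: u + v) w.
Proof.
move=> [C uC] [D vD]; exists (2 * sqn k * C + 2 * D) => r j r2 r1.
have r0 : 0 <= r by apply: le_trans r2; rewrite invr_ge0.
have -> : (2 * sqn k * C + 2 * D) / (1 - r) ^+ m =
    2 * (sqn k * (C / (1 - r) ^+ m)) + 2 * (D / (1 - r) ^+ m) by rewrite mulrDl !mulrA.
apply: le_trans (lerD (ler_wpM2l _ (ler_wpM2l _ (uC r j r2 r1))) (ler_wpM2l _ (vD r j r2 r1)));
  rewrite ?sqr_ge0 //.
rewrite !mulr_sumr -big_split /=; apply: ler_sum => x _.
rewrite !mulrA -mulrDl ler_wpM2r ?exprn_ge0 // coefP.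
apply: (@le_trans _ _ ((Normc.normc k * Normc.normc (coef u w x) + Normc.normc (coef v w x)) ^+ 2)).
  rewrite lerXn2r ?nnegrE ?addr_ge0 ?mulr_ge0 ?normc_ge0 // -ComplexField.Normc.normcM.
  exact: le_normcD.
move: (Normc.normc k) (Normc.normc (coef u w x)) (Normc.normc (coef v w x)) => s t t'.
by have := sqr_ge0 (s * t - t'); nra.
Qed.

(** Translation changes lengths by at most [|y|], which costs a factor [2 ^+ len y] because [r] is
    at least 1/2. *)
Lemma abel_bound_rep m y u v : abel_bound m u v -> abel_bound m (smooth_rep y u) v.
Proof.
move=> [C uvC]; exists (2 ^+ len y * C) => r k r2 r1.
have r0 : 0 < r by apply: lt_le_trans r2; rewrite invr_gt0.
rewrite -mulrA; apply: le_trans (ler_wpM2l _ (uvC r (len y + k)%N r2 r1)); last exact: exprn_ge0.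
rewrite mulr_sumr.
apply: (@le_trans _ _ (\sum_(x <- wball 'I_n.+2 k)
    2 ^+ len y * (sqn (coef u v (y^-1 * x)%g) * r ^+ len (y^-1 * x)%g))).
  apply: ler_sum => x _; rewrite coef_rep mulrCA ler_wpM2l ?sqr_ge0 //.
  have : r ^+ (len y + len x) <= r ^+ len (y^-1 * x)%g.
    by rewrite ler_wiXn2l ?ltW // -(len_finv y) leq_len_mul.
  rewrite exprD => h; have h2 : 1 <= 2 ^+ len y * r ^+ len y.
    by rewrite -exprMn exprn_ege1 //; lra.
  apply: (@le_trans _ _ (2 ^+ len y * r ^+ len y * r ^+ len x)).
    by apply: ler_peMl => //; exact/exprn_ge0/ltW.
  by rewrite -mulrA ler_wpM2l ?exprn_ge0.
apply: (@sum_inj_le _ _ _ _ _ xpredT (fun x => y^-1 * x)%g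
   (fun x => 2 ^+ len y * (sqn (coef u v x) * r ^+ len x))).
- exact: wball_uniq.
- by move=> x z _ _ /mulgI.
- move=> x; rewrite !mem_wball => xk _; apply: leq_ltn_trans (leq_len_mul _ _) _.
  by rewrite len_finv ltn_add2l.
- move=> x; apply: mulr_ge0; first exact: exprn_ge0.
  by apply: mulr_ge0; [exact: sqr_ge0 | exact/exprn_ge0/ltW].
Qed.

(** Where the first letter of [x] fails [p], [coef_cut_le] applies directly; elsewhere it applies to
    the complementary restriction, which is subtracted from [u]. The error has bounded sphere sums,
    so its Abel sum is of order [(1 - r)^-1], which [0 < m] absorbs. *)
Lemma abel_bound_cut m p u v : (0 < m)%N -> abel_bound m u v -> abel_bound m (hcut p u) v.
Proof.
move=> m0 [C uvC]; elim/smoothW: u uvC => f; elim/smoothW: v => g uvC.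
pose q := predC p; pose K := mu (mcut p f) [::] + 2 * mu (mcut q f) [::].
have K0 : 0 <= K by rewrite addr_ge0 ?mulr_ge0 ?mu_ge0.
have key x : sqn (coef (hcut p (cl f)) (cl g) x) <=
    2 * sqn (coef (cl f) (cl g) x) + K * mu g (word (x^-1)%g).
  rewrite hcutE; have [px|px] := boolP (if word x is a :: _ then p a else false); last first.
    apply: le_trans (coef_cut_le _ _ px) _.
    apply: (@le_trans _ _ (K * mu g (word (x^-1)%g))).
      by apply: ler_wpM2r; [exact: mu_ge0 | rewrite lerDl mulr_ge0 ?mu_ge0].
    by rewrite lerDr mulr_ge0 ?sqr_ge0.
  have qx : ~~ (if word x is a :: _ then q a else false).
    by move: px; case: (word x) => //= a _; rewrite negbK.
  have := coef_cut_le f g qx; rewrite -!hcutE => le.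
  have E : coef (hcut p (cl f)) (cl g) x = - coef (hcut q (cl f)) (cl g) x + coef (cl f) (cl g) x.
    rewrite [in X in _ = _ + X](hcutC p (cl f)) -{2}[hcut p _]scale1r coefP mul1r.
    by rewrite addrC addrK.
  rewrite E; apply: (@le_trans _ _ ((Normc.normc (coef (hcut q (cl f)) (cl g) x) +
     Normc.normc (coef (cl f) (cl g) x)) ^+ 2)).
    rewrite lerXn2r ?nnegrE ?addr_ge0 ?normc_ge0 //.
    by rewrite -[X in _ <= X + _]normcN le_normcD.
  have := mulr_ge0 (mu_ge0 (mcut p f) [::]) (mu_ge0 g (word (x^-1)%g)).
  have := sqr_ge0 (Normc.normc (coef (hcut q (cl f)) (cl g) x) - Normc.normc (coef (cl f) (cl g) x)).
  move: le; rewrite /K hcutE; move: (Normc.normc _) (Normc.normc _) (mu _ _) (mu _ _) (mu _ _).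
  by move=> s t m1 m2 m3; nra.
exists (2 * C + K * mu g [::]) => r k r2 r1.
have r0 : 0 <= r by apply: le_trans r2; rewrite invr_ge0.
have r1' : 0 < 1 - r by rewrite subr_gt0.
rewrite mulrDl -mulrA.
apply: (@le_trans _ _ (2 * (\sum_(x <- wball 'I_n.+2 k) sqn (coef (cl f) (cl g) x) * r ^+ len x) +
   K * \sum_(x <- wball 'I_n.+2 k) mu g (word (x^-1)%g) * r ^+ len x)).
  rewrite !mulr_sumr -big_split /=; apply: ler_sum => x _.
  rewrite (mulrA 2) (mulrA K) -mulrDl; apply: ler_wpM2r; first exact: exprn_ge0.
  exact: key.
rewrite lerD // ?ler_wpM2l ?uvC // -mulrA ler_wpM2l //.
rewrite sum_wball (eq_bigr (fun i : 'I_k => mu g [::] * r ^+ i)) => [|i _]; last first.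
  rewrite -(sum_mu_inv g i) mulr_suml big_seq [RHS]big_seq; apply: eq_bigr => x.
  by rewrite mem_sph => /eqP ->.
rewrite -mulr_sumr ler_wpM2l ?mu_ge0 //; apply: le_trans (sum_geo_le _ r0 r1) _.
rewrite lef_pV2 ?posrE ?exprn_gt0 //.
by rewrite -[leRHS]expr1; apply: ler_wiXn2l => //; lra.
Qed.

Lemma abel_bound3 u v : abel_bound 3 u v.
Proof.
elim/smoothW: u => f; elim/smoothW: v => g.
pose K := mu f [::] * mu g [::]; have K0 : 0 <= K by rewrite mulr_ge0 ?mu_ge0.
exists (K * 2) => r k r2 r1.
have r0 : 0 <= r by apply: le_trans r2; rewrite invr_ge0.
rewrite -mulrA; apply: le_trans (ler_wpM2l K0 (sum_sqr_geo_le k r0 r1)).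
rewrite sum_wball mulr_sumr; apply: ler_sum => i _.
rewrite mulrA [K * _]mulrC; apply: le_trans (ler_wpM2r _ (sphere_coef_le f g i)); last exact: exprn_ge0.
rewrite le_eqVlt mulr_suml; apply/orP; left; apply/eqP.
rewrite big_seq [RHS]big_seq; apply: eq_bigr => x; by rewrite mem_sph => /eqP ->.
Qed.

End SmoothAlgebra.

(** * Cone vectors and irreducibility *)

Section ConeVectors.
Variables (R : realType) (n : nat) (S : normalizedSystem R n).
Variable pi : multiplicativeRep S.
Local Notation V := (sysV S).
Local Notation H := (sysH S).
Local Notation B := (sysB S).
Local Notation G := (Gamma n).
Local Notation ell := (last_letter (ord0, true) : G -> alphabet n).
Local Notation cl f := (\pi_(smooth S)%qT f).
Implicit Types (f g h : multfun S) (x y z : G) (a b c : alphabet n) (u v w : smooth S).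

Definition cstep (t : coprod S) b : coprod S := Tagged V (H b (tag t) (tagged t)).

Lemma cstepE a t b : tag t = a -> cstep t b = Tagged V (H b a (component a t)).
Proof. by case: t => c P /= <-; rewrite -[existT _ c P]/(Tagged V P) componentT. Qed.

Lemma mult_step N f y c : multiplicative_from N f -> (N < len y)%N ->
  len (y * gen c)%g = (len y).+1 -> f (y * gen c)%g = cstep (f y) c.
Proof.
move=> fN Ny yc; have [z zy /(_ (ord0, true))[yE _]] := split_last (leq_ltn_trans (leq0n N) Ny).
have Nz : (N <= len z)%N by rewrite -ltnS zy.
have : tag (f y) = ell y by exact: multfun_tag fN Ny.
move: yE; move: (ell y) => a yE ta; rewrite (cstepE _ ta) {1 2}yE.
by apply: (fN z Nz).2; rewrite -yE yc -zy.
Qed.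

(** The elementary multiplicative functions: beyond its level, any multiplicative function
    restricted to a cone is a translate of one of these ([hcut_rep_cone]). *)
Definition mcone_fun a (P : V a) x : coprod S :=
  if word x is c :: w then if c == a then foldl cstep (Tagged V P) w else mzero_fun S x
  else mzero_fun S x.

Lemma mcone_step a (P : V a) x c : (0 < len x)%N -> reduced (rcons (word x) c) ->
  mcone_fun P (x * gen c)%g = cstep (mcone_fun P x) c.
Proof.
move=> x0 xc; have E := word_mul_gen xc.
have ellE : ell (x * gen c)%g = c by rewrite /last_letter E last_rcons.
rewrite /mcone_fun E; move: x0; rewrite /len; case: (word x) => // d w _ /=.
case: eqP => _; first by rewrite -cats1 foldl_cat.
by rewrite /mzero_fun (ell_eq (fun=> 0) ellE) /cstep /= linear0.
Qed.

Lemma mcone_tag a (P : V a) x : (0 < len x)%N -> tag (mcone_fun P x) = ell x.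
Proof.
rewrite /mcone_fun /len /last_letter; case E: (word x) => [|c w] //= _.
case: eqP => [->|_]; last by rewrite /= /last_letter E.
by case: (lastP w) => // w' d; rewrite -cats1 foldl_cat last_cat.
Qed.

Lemma mcone_multiplicative a (P : V a) : multiplicative_from 0 (mcone_fun P).
Proof.
move=> x _; split=> [b xb|b c /len_mul_gen2[xb xbc]].
  by rewrite mcone_tag ?xb // last_letter_mul_gen.
rewrite mcone_step ?xb //; last by rewrite -cats1 -len_mul_gen_reduced xbc.
by apply: cstepE; rewrite mcone_tag ?xb // last_letter_mul_gen.
Qed.

Definition mcone a (P : V a) : multfun S :=
  MultFun (ex_intro _ 0%N (mcone_multiplicative P)).

Lemma mcone_level a (P : V a) : multiplicative_from 0 (mcone P).
Proof. exact: mcone_multiplicative. Qed.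

Definition cone a (P : V a) : smooth S := cl (mcone P).

(** Beyond level [N] the values of [f] on the cone of [y b] are forced by its value at [y b]. *)
Lemma hcut_rep_cone N f y b : multiplicative_from N f -> (N <= len y)%N ->
  len (y * gen b)%g = (len y).+1 ->
  hcut (pred1 b) (smooth_rep (y^-1)%g (cl f)) = cone (component b (f (y * gen b)%g)).
Proof.
move=> fN Ny yb; rewrite smooth_repE hcutE; apply/smooth_eqP; exists 0%N => x _ /=.
rewrite /mcut_fun /mcone_fun invgK; case E: (word x) => [|c w] //=.
case: eqP => // cb; subst c.
have tb : tag (f (y * gen b)%g) = b by exact: (fN y Ny).1.
have yb_red : reduced (word y ++ [:: b]) by rewrite -len_mul_gen_reduced yb.
rewrite componentK //; elim/last_ind: w x E => [|w c IHw] x E.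
  by congr (f (y * _)%g); apply: val_inj.
have rx : reduced (b :: w).
  have := word_reduced x; rewrite E -cats1 -cat_cons => rx.
  by have [] := reduced_cat rx.
have xE : x = (FreeGroup rx * gen c)%g.
  by apply: val_inj; rewrite [RHS]word_mul_gen /= ?E //; have := word_reduced x; rewrite E.
have red z (w' : seq (alphabet n)) : word z = b :: w' -> reduced (word y ++ word z).
  move=> zE; rewrite zE reduced_cat_head ?word_reduced //; last by rewrite -zE word_reduced.
  by rewrite reduced_cat_head ?word_reduced // in yb_red.
have yzE z (w' : seq (alphabet n)) : word z = b :: w' -> len (y * z)%g = (len y + len z)%N.
  by move=> zE; rewrite /len word_mul ?(red _ _ zE) // size_cat.
rewrite -cats1 foldl_cat /= -(IHw (FreeGroup rx)) // xE mulgA; apply: (mult_step fN).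
  by rewrite (@yzE _ w) // /len /= addnS ltnS (leq_trans Ny) // leq_addr.
rewrite -mulgA -xE (yzE _ _ E) (@yzE _ w) // /len E /= size_rcons; lia.
Qed.

Lemma cone_linear a (k : R[i]) (P Q : V a) : cone (k *: P + Q) = k *: cone P + cone Q.
Proof.
rewrite /cone smooth_linearE; apply/smooth_eqP; exists 1%N => x /=.
rewrite /mlin_fun /= /mcone_fun /len; case E: (word x) => [|c w] // _.
case: eqP => [ca|_]; last by rewrite /mzero_fun componentT scaler0 addr0.
subst c; have -> : Tagged V (k *: component (ell x) (foldl cstep (Tagged V P) w) +
    component (ell x) (foldl cstep (Tagged V Q) w)) =
  Tagged V (k *: component (last a w) (foldl cstep (Tagged V P) w) +
    component (last a w) (foldl cstep (Tagged V Q) w)).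
  apply: (ell_eq (fun d => k *: component d _ + component d _)).
  by rewrite /last_letter E.
elim/last_ind: w {E} => [|w c IHw]; first by rewrite /= !componentT.
have tg (P' : V a) : tag (foldl cstep (Tagged V P') w) = last a w.
  by case: (lastP w) => // w' d; rewrite -cats1 foldl_cat last_cat.
rewrite last_rcons -!cats1 !foldl_cat /= IHw {1}/cstep /=.
by rewrite (cstepE _ (tg P)) (cstepE _ (tg Q)) !componentT linearP.
Qed.

Lemma cone0 a : cone (0 : V a) = 0.
Proof.
have := cone_linear (-1) (0 : V a) 0.
by rewrite scaler0 addr0 scaleN1r addNr.
Qed.

Lemma hcut_cone p a (P : V a) : hcut p (cone P) = if p a then cone P else 0.
Proof.
rewrite /cone hcutE; case: ifP => pa; apply/smooth_eqP; exists 0%N => x _ /=;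
  rewrite /mcut_fun /mcone_fun; case: (word x) => [|c w] //=.
  by case: eqP => [->|_]; rewrite ?pa //; case: ifP.
by case: eqP => [->|_]; rewrite ?pa //; case: ifP.
Qed.

(** Translation followed by restriction realizes the maps of the matrix system; stability under both
    operations thus becomes invariance of a subsystem. *)
Lemma hcut_rep_gen_cone a b (P : V a) : b != linv a ->
  hcut (pred1 b) (smooth_rep ((gen a)^-1)%g (cone P)) = cone (H b a P).
Proof.
move=> ba; have ab : len (gen a * gen b)%g = (len (gen a)).+1.
  by apply/eqP; rewrite (len_mul_gen (ord0, true)) /last_letter /= ba.
rewrite (hcut_rep_cone (mcone_level P)) //=.
have -> : mcone_fun P (gen a * gen b)%g = Tagged V (H b a P).
  rewrite mcone_step //; first by rewrite /mcone_fun /= eqxx.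
  by rewrite -cats1 -len_mul_gen_reduced ab.
by rewrite componentT.
Qed.

(* Translation by a letter maps the words beginning with [a] onto those not beginning with its inverse. *)
Lemma rep_gen_cut a u : smooth_rep ((gen a)^-1)%g (hcut (pred1 a) u) =
  hcut (predC1 (linv a)) (smooth_rep ((gen a)^-1)%g u).
Proof.
elim/smoothW: u => f; rewrite hcutE !smooth_repE hcutE; apply/smooth_eqP.
exists 2%N => x x2 /=; rewrite invgK.
have ellE : ell (gen a * x)%g = ell x by exact: last_letter_mul.
have zE : mzero_fun S (gen a * x)%g = mzero_fun S x.
  exact: (ell_eq (fun=> 0) ellE).
rewrite /mcut_fun zE /=.
move: x2; rewrite /len; have := word_reduced x; case E: (word x) => [|b [|c w]] //= rx _.
case: eqP => [bE|bE] /=; last by rewrite eqxx.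
by move: rx; rewrite /reduced /= bE linvK => /andP[/negbTE ->].
Qed.

End ConeVectors.

(** Among the subspaces contained in [Q], one of maximal dimension contains every vector of [Q],
    since adjoining a missing one would enlarge it. *)
Lemma vspace_of_linear (F : fieldType) (U : vectType F) (Q : U -> Prop) :
  Q 0 -> (forall k u v, Q u -> Q v -> Q (k *: u + v)) ->
  exists W : {vspace U}, forall v, v \in W <-> Q v.
Proof.
move=> Q0 QP; pose P d := `[< exists W : {vspace U}, \dim W = d /\ forall v, v \in W -> Q v >].
have P0 : exists d, P d.
  by exists 0%N; apply/asboolP; exists 0%VS; rewrite dimv0; split=> // v; rewrite memv0 => /eqP ->.
have Pub d : P d -> (d <= \dim {:U})%N.
  by move=> /asboolP[W [<- _]]; exact/dimvS/subvf.
case: (ex_maxnP P0 Pub) => d /asboolP[W [Wd WQ]] dmax; exists W => v; split; first exact: WQ.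
move=> Qv; apply: contrapT => vW.
have : P (\dim (W + <[v]>)%VS).
  apply/asboolP; exists (W + <[v]>)%VS; split=> // _ /memv_addP[w wW [_ /vlineP[k ->] ->]].
  by rewrite addrC; apply: QP => //; exact: WQ.
move=> /dmax; rewrite -Wd => le; apply: vW.
have : (W <= W + <[v]>)%VS by exact: addvSl.
move=> /dimv_leqif_eq /leqifP; case: eqP => [-> _|_ lt]; last by move: le; rewrite leqNgt lt.
exact: subvP (addvSr _ _) _ (memv_line v).
Qed.

Section Irreducible.
Variables (R : realType) (n : nat) (S : normalizedSystem R n).
Variable pi : multiplicativeRep S.
Local Notation V := (sysV S).
Local Notation G := (Gamma n).
Local Notation cl f := (\pi_(smooth S)%qT f).
Implicit Types (f g h : multfun S) (x y z : G) (a b c : alphabet n) (u v w : smooth S).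

Variable Q : smooth S -> Prop.
Hypotheses (QP : forall k u v, Q u -> Q v -> Q (k *: u + v))
  (Qrep : forall y u, Q u -> Q (smooth_rep y u))
  (Qcut : forall p u, Q u -> Q (hcut p u)).

Let hcut_sum (p : pred (alphabet n)) u : Q 0 -> (forall a, p a -> Q (hcut (pred1 a) u)) -> Q (hcut p u).
Proof.
move=> Q0 Qp; pose s := [seq a <- enum {: alphabet n} | p a].
rewrite (@eq_hcut _ _ _ p (mem s)) => [|a]; last by rewrite /= mem_filter mem_enum andbT.
have : uniq s by rewrite filter_uniq ?enum_uniq.
have : all p s by exact: filter_all.
elim: s => [_ _|a s IHs /= /andP[pa ps] /andP[as_ us]].
  by rewrite (@eq_hcut _ _ _ _ pred0) ?hcut_pred0.
rewrite (@eq_hcut _ _ _ _ (predU (pred1 a) (mem s))) => [|b]; last by rewrite /= inE.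
rewrite hcutU => [|b]; last by rewrite /=; case: eqP => // ->; rewrite as_.
by rewrite -[hcut (pred1 a) u]scale1r; apply: QP; [exact: Qp | exact: IHs].
Qed.

(* The subspaces of the vectors [P] with [Q (cone P)] form an invariant subsystem. *)
Lemma irreducible_smooth_ind u0 : irreducible_system S -> Q u0 -> u0 != 0 -> forall u, Q u.
Proof.
move=> irrS Qu0 u0_neq0.
have Q0 : Q 0 by have := QP (-1) Qu0 Qu0; rewrite scaleN1r addNr.
have exW a : exists W : {vspace V a}, forall P, P \in W <-> Q (cone P).
  apply: vspace_of_linear => [|k P P' QcP QcP']; first by rewrite cone0.
  by rewrite cone_linear; exact: QP.
pose W a := sval (cid (exW a)).
have WQ a (P : V a) : P \in W a <-> Q (cone P) by exact: svalP (cid (exW a)) P.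
have [] := irrS.2 W.
- move=> b a; apply/subvP => _ /memv_imgP[P PW ->]; apply/WQ.
  have [->|ba] := eqVneq b (linv a).
    rewrite (_ : sysH S _ _ P = 0) ?cone0 // sysH_eq0 ?lfunE //.
    by have := gen_linv (linv a); rewrite linvK.
  by rewrite -(hcut_rep_gen_cone _ ba); apply/Qcut/Qrep/WQ.
(* If all the subspaces vanish, so do the far values of [u0], because each is the parameter of a
   cone vector in [Q]. *)
- move=> W0; case/eqP: u0_neq0; move: Qu0; elim/smoothW: u0 => f Qf.
  have fN := levP f; have [M fM] := multfun_large f.
  apply/smooth_eqP; exists (maxn (lev f).+1 M) => x; rewrite geq_max => /andP[fx /fM xE].
  have [y yx /(_ (ord0, true))] := split_last (leq_ltn_trans (leq0n _) fx).
  move: xE; rewrite /= /mzero_fun; move: (last_letter _ x) => b xE [xyb _].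
  have fy : (lev f <= len y)%N by rewrite -ltnS yx.
  have yb : len (y * gen b)%g = (len y).+1 by rewrite -xyb yx.
  have : Q (cone (component b (f x))).
    by rewrite xyb -(hcut_rep_cone fN fy yb); exact/Qcut/Qrep.
  by move=> /WQ; rewrite W0 memv0 xE componentT => /eqP ->.
- move=> WT; elim/smoothW => f; have fN := levP f.
  (* Induction from far out back to [1]: [k] bounds how many letters [y] lacks to reach the level at
     which the pieces of [f] are cone vectors. *)
  suff key k y : (lev f <= k + len y)%N -> forall b, len (y * gen b)%g = (len y).+1 ->
      Q (hcut (pred1 b) (smooth_rep (y^-1)%g (cl f))).
    rewrite -[cl f]hcut_predT; apply: hcut_sum => // b _.
    have := key (lev f) 1%g; rewrite invg1 (smooth_rep1 pi); by apply => //; exact: leq_addr.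
  elim: k y => [|k IHk] y fy b yb.
    by rewrite (hcut_rep_cone fN fy yb); apply/WQ; rewrite WT memvf.
  (* Seen from [y b], the piece splits into the pieces along the next letters [c], one step further
     out. *)
  rewrite -[hcut _ _](smooth_repVK pi (gen b)) rep_gen_cut; apply: Qrep.
  apply: hcut_sum => // c cb; rewrite -(smooth_repM pi) -invgM; apply: IHk.
    by rewrite yb addnS -addSn.
  apply/eqP; rewrite (len_mul_gen (ord0, true)) last_letter_mul_gen //.
  by rewrite (cb : c != linv b) orbT.
Qed.

End Irreducible.

(** The irreducibility argument is run once in each entry of the coefficient, with [abel_bound_sym]
    exchanging them. *)
Lemma abel_bound_irreducible (R : realType) (n : nat) (S : normalizedSystem R n)
    (pi : multiplicativeRep S) m (u0 v0 : smooth S) : irreducible_system S -> (0 < m)%N ->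
  u0 != 0 -> v0 != 0 -> abel_bound m u0 v0 ->
  forall u v : smooth S, abel_bound m u v.
Proof.
move=> irrS m0 u00 v00 uv0.
have ind (w w0 : smooth S) : w0 != 0 -> abel_bound m w0 w -> forall u : smooth S, abel_bound m u w.
  move=> w00 w0w; pose Q (u : smooth S) := abel_bound m u w.
  have QP (k : R[i]) u v : Q u -> Q v -> Q (k *: u + v).
    exact: (@abel_bound_lin _ _ _ pi m k u v w).
  have Qrep y u : Q u -> Q (smooth_rep y u) by exact: (@abel_bound_rep _ _ _ pi m y u w).
  have Qcut p u : Q u -> Q (hcut p u) by exact: (@abel_bound_cut _ _ _ pi m p u w m0).
  exact: (irreducible_smooth_ind pi QP Qrep Qcut irrS w0w w00).
move=> u v; apply: (ind v u0) => //; apply: (abel_bound_sym pi); apply: (ind _ v0) => //.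
exact: (abel_bound_sym pi).
Qed.

(** * The linear recurrence for the sums over spheres *)

(** Cayley-Hamilton for the evolution matrix; the recurrence is common to all coordinates. *)
Lemma linear_orbit_linrec (F : fieldType) (J : finType) (K : nat) (Y : nat -> J -> F)
    (M : J -> J -> F) :
  (forall k j, (K <= k)%N -> Y k.+1 j = \sum_i M j i * Y k i) ->
  exists d (c : nat -> F), forall k j, (K <= k)%N ->
    Y (k + d)%N j = \sum_(i < d) c i * Y (k + i)%N j.
Proof.
move=> YM; have [m mE] : exists m, #|J| = m by exists #|J|.
case: m mE => [J0|m mE].
  exists 0%N, (fun=> 0) => k j; suff : (0 < #|J|)%N by rewrite J0.
  by apply/card_gt0P; exists j.
pose e (i : 'I_m.+1) : J := enum_val (cast_ord (esym mE) i).
pose r j : 'I_m.+1 := cast_ord mE (enum_rank j).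
have rK : cancel r e by move=> j; rewrite /e /r cast_ordK enum_rankK.
have eK : cancel e r by move=> i; rewrite /e /r enum_valK cast_ordKV.
pose A : 'M[F]_m.+1 := \matrix_(i, j) M (e i) (e j).
pose y k : 'cV[F]_m.+1 := \col_i Y k (e i).
have yA k : (K <= k)%N -> y k.+1 = A *m y k.
  move=> Kk; apply/colP => i; rewrite !mxE YM //.
  rewrite (reindex e) /=; first by apply: eq_bigr => j _; rewrite !mxE.
  by exists r => j _; [exact: eK | exact: rK].
have yAn k i : (K <= k)%N -> y (k + i)%N = A ^+ i *m y k.
  move=> Kk; elim: i => [|i IHi]; first by rewrite addn0 expr0 mul1mx.
  by rewrite addnS yA ?(leq_trans Kk) ?leq_addr // IHi mulmxA exprS.
pose p := char_poly A; have psz : size p = m.+2 by exact: size_char_poly.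
have plead : p`_m.+1 = 1.
  by have := char_poly_monic A => /monicP; rewrite lead_coefE psz.
have CH : \sum_(i < m.+2) p`_i *: A ^+ i = 0.
  have := Cayley_Hamilton A; rewrite -/p -{1}[p]coefK psz poly_def linear_sum => H.
  rewrite -[RHS]H; apply: eq_bigr => i _.
  by rewrite linearZ /= rmorphXn /= horner_mx_X.
exists m.+1, (fun i => - p`_i) => k j Kk.
have : \sum_(i < m.+2) p`_i *: y (k + i)%N = 0.
  transitivity ((\sum_(i < m.+2) p`_i *: A ^+ i) *m y k); last by rewrite CH mul0mx.
  by rewrite mulmx_suml; apply: eq_bigr => i _; rewrite -scalemxAl yAn.
rewrite big_ord_recr /= plead scale1r => /(congr1 (fun C : 'cV_m.+1 => C (r j) 0)).
rewrite !mxE rK summxE => /eqP; rewrite addrC addr_eq0 => /eqP ->.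
rewrite -sumrN; apply: eq_bigr => i _.
by rewrite !mxE rK mulNr.
Qed.

Section DotBasis.
Variables (C : numClosedFieldType) (U : vectType C) (form : {dot U for (@Num.conj C)}).
Local Notation d := (\dim {:U}).
Local Notation e := (vbasis {:U}).

(** The Gram matrix of the basis is invertible because the form is definite. *)
Lemma dot_vbasis_solve (t : 'I_d -> C) : exists w, forall i : 'I_d, form w e`_i = t i.
Proof.
pose M : 'M[C]_d := \matrix_(i, j) form e`_i e`_j.
pose comb (x : 'rV[C]_d) := \sum_(i < d) x 0 i *: e`_i.
have combE x (j : 'I_d) : form (comb x) e`_j = (x *m M) 0 j.
  rewrite /comb linear_sumlz mxE; apply: eq_bigr => i _.
  by rewrite linearZl_LR !mxE.
have Mu : M \in unitmx.
  rewrite -row_free_unit -kermx_eq0; apply/rowV0P => x /sub_kermxP xM.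
  have : form (comb x) (comb x) = 0.
    rewrite {2}/comb linear_sumr big1 // => j _.
    by rewrite linearZr_LR /= combE xM mxE mulr0.
  move=> /eqP; rewrite dnorm_eq0 => /eqP x0.
  have /freeP/(_ (fun i => x 0 i) x0) xi0 := basis_free (vbasisP {:U}).
  by apply/rowP => i; rewrite xi0 mxE.
exists (comb ((\row_i t i) *m invmx M)) => i.
by rewrite combE mulmxKV // mxE.
Qed.

Lemma dot_riesz (l : U -> C) : (forall k u v, l (k *: u + v) = Num.conj k * l u + l v) ->
  exists w, forall v, form w v = l v.
Proof.
move=> lP; have [w we] := dot_vbasis_solve (fun i => l e`_i).
have l0 : l 0 = 0.
  by have := lP (-1) 0 0; rewrite scaler0 addr0 rmorphN rmorph1 mulN1r addNr.
exists w => v; rewrite (coord_vbasis (memvf v)).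
elim: (index_enum 'I_d) => [|i s IHs]; first by rewrite big_nil linear0r l0.
by rewrite big_cons linearPr lP /= IHs we.
Qed.

End DotBasis.

Section Recurrence.
Variables (R : realType) (n : nat) (S : normalizedSystem R n).
Variable pi : multiplicativeRep S.
Local Notation V := (sysV S).
Local Notation H := (sysH S).
Local Notation B := (sysB S).
Local Notation G := (Gamma n).
Local Notation cl f := (\pi_(smooth S)%qT f).
Local Notation sqn z := (Normc.normc z ^+ 2).
Implicit Types (f g h : multfun S) (x y z : G) (a b c : alphabet n) (u v w : smooth S).

Lemma hcut_linear p (k : R[i]) u v : hcut p (k *: u + v) = k *: hcut p u + hcut p v.
Proof.
elim/smoothW: u => f; elim/smoothW: v => g.
rewrite smooth_linearE !hcutE smooth_linearE; apply/smooth_eqP; exists 0%N => x _ /=.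
rewrite /mcut_fun /mlin_fun /= /mcut_fun; case: (word x) => [|a s].
  by rewrite /mzero_fun !componentT scaler0 addr0.
by case: ifP => // _; rewrite /mzero_fun !componentT scaler0 addr0.
Qed.

Lemma push_cons c (s : seq (alphabet n)) : reduced (c :: s) -> push c s = c :: s.
Proof. by case: s => [|d s] //= /andP[/negbTE ->]. Qed.

Lemma coefD u v w x : coef (u + v) w x = coef u w x + coef v w x.
Proof. by rewrite -{1}[u]scale1r (coefP pi) mul1r. Qed.

Lemma sform_cone a (P Q : V a) : smooth_form (cone P) (cone Q) = B a P Q.
Proof.
rewrite (smooth_form_level (mcone_level P) (mcone_level Q) (M := 1)) //.
rewrite (sum_sph1 xpredT) (bigD1 a) //= big1 ?addr0 => [|b ba].
  by rewrite /last_form /last_letter /= /mcone_fun /= eqxx !componentT.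
by rewrite /last_form /= /mcone_fun /= (negbTE ba) /mzero_fun componentT linear0l.
Qed.

(** Coefficients against cone vectors are coordinates of the values of [g]. This serves both the
    recurrence and the failure of square summability. *)
Lemma coef_cone N g b (P : V b) x : multiplicative_from N g -> (N <= len x)%N ->
  reduced (rcons (word (x^-1)%g) b) ->
  coef (cone P) (cl g) x = B b P (component b (g (x^-1 * gen b)%g)).
Proof.
move=> gN Nx xb; have -> : cone P = hcut (pred1 b) (cone P) by rewrite hcut_cone /= eqxx.
rewrite /coef sform_hcut -{1}[x]invgK (hcut_rep_cone gN) ?len_finv //.
  by rewrite hcut_cone /= eqxx sform_cone.
by apply/eqP; rewrite -(len_finv x) len_mul_gen_reduced cats1.
Qed.

Lemma reduced_inv_rcons c x : reduced (c :: word x) -> reduced (rcons (word (x^-1)%g) (linv c)).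
Proof.
by move/winv_reduced; rewrite {1}/winv /= rev_cons.
Qed.

(* Long translates of a fixed multiplicative function see the part of a smooth vector
   carried by the words beginning with [linv c] only through a vector of [V (linv c)]. *)
Lemma coef_hcut_cone g c u : exists P : V (linv c), forall x, (lev g <= len x)%N ->
  reduced (c :: word x) -> coef (hcut (pred1 (linv c)) u) (cl g) x = coef (cone P) (cl g) x.
Proof.
set d := linv c.
have lP (k : R[i]) P Q : smooth_form (hcut (pred1 d) u) (cone (k *: P + Q : V d)) =
    Num.conj k * smooth_form (hcut (pred1 d) u) (cone P) + smooth_form (hcut (pred1 d) u) (cone Q).
  by rewrite cone_linear (sformPr pi).
have [P PE] := dot_riesz (B d) (l := fun P => smooth_form (hcut (pred1 d) u) (cone P)) lP; exists P => x gx cx.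
have xd := reduced_inv_rcons cx.
rewrite (coef_cone _ (levP g) gx xd) PE /coef sform_hcut -{1}[x]invgK.
rewrite (hcut_rep_cone (levP g)) ?len_finv //.
by apply/eqP; rewrite -(len_finv x) len_mul_gen_reduced cats1.
Qed.

(* The states that determine the coefficients far out along a word ending with [b]. *)
Definition state b (P : V b) (Q : V (linv b)) : smooth S :=
  smooth_rep ((gen b)^-1)%g (cone P) + cone Q.

(** By [rep_gen_cut], the words not beginning with [linv c] carry the translated cone vector. The
    rest is seen by long translates of [g] only through one vector [Q], by [coef_hcut_cone]. *)
Lemma coef_state g c (P : V c) u : hcut (pred1 c) u = cone P ->
  exists Q, forall x, (lev g <= len x)%N -> reduced (c :: word x) ->
    coef (smooth_rep ((gen c)^-1)%g u) (cl g) x = coef (state P Q) (cl g) x.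
Proof.
move=> uP; set v := smooth_rep _ u.
have vE : v = smooth_rep ((gen c)^-1)%g (cone P) + hcut (pred1 (linv c)) v.
  rewrite {1}(hcutC (predC1 (linv c)) v) -rep_gen_cut uP; congr (_ + _).
  by apply: eq_hcut => a; rewrite /= negbK.
have [Q QE] := coef_hcut_cone g c v; exists Q => x gx cx.
rewrite {1}vE; apply: etrans (coefD _ _ _ _) _; apply: etrans (esym (coefD _ _ _ _)).
congr (_ + _); exact: QE.
Qed.

Lemma hcut_state c b (P : V b) (Q : V (linv b)) : c != linv b ->
  hcut (pred1 c) (state P Q) = cone (H c b P).
Proof.
move=> cb; rewrite /state -[smooth_rep _ _]scale1r hcut_linear scale1r.
by rewrite hcut_rep_gen_cone // hcut_cone /= eq_sym (negbTE cb) addr0.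
Qed.

Definition in_span (s : seq (smooth S)) u :=
  exists k : nat -> R[i], u = \sum_(i < size s) k i *: s`_i.

Lemma in_span_cat s t u v : in_span s u -> in_span t v -> in_span (s ++ t) (u + v).
Proof.
move=> [k ->] [l ->]; exists (fun i => if (i < size s)%N then k i else l (i - size s)%N).
rewrite size_cat big_split_ord /=; congr (_ + _); apply: eq_bigr => i _.
  by rewrite nth_cat ltn_ord.
by rewrite nth_cat ltnNge leq_addr /= addKn.
Qed.

Lemma in_span_linear b (L : V b -> smooth S) P :
  (forall (k : R[i]) P Q, L (k *: P + Q) = k *: L P + L Q) -> in_span [seq L Q | Q <- vbasis {:V b}] (L P).
Proof.
move=> LP; have L0 : L 0 = 0.
  by have := LP (-1) 0 0; rewrite scaler0 addr0 scaleN1r addNr.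
exists (fun i => if insub i is Some j then coord (vbasis {:V b}) j P else 0).
rewrite size_map size_tuple {1}(coord_vbasis (memvf P)).
transitivity (\sum_(i < \dim {:V b}) coord (vbasis {:V b}) i P *: L (vbasis {:V b})`_i).
  elim: (index_enum _) => [|i s IHs]; first by rewrite !big_nil.
  by rewrite !big_cons LP IHs.
apply: eq_bigr => i _; rewrite (nth_map 0) ?size_tuple //.
by rewrite valK.
Qed.

(** A single [D] serves all letters: the generating lists are padded with zero, which is itself a
    state. *)
Lemma state_span : exists D (e : alphabet n -> nat -> smooth S),
  (forall b i, exists (P : V b) (Q : V (linv b)), e b i = state P Q) /\
  (forall b (P : V b) (Q : V (linv b)), exists k : nat -> R[i], state P Q = \sum_(i < D) k i *: e b i).
Proof.
pose s b := [seq smooth_rep ((gen b)^-1)%g (cone P) | P <- vbasis {:V b}] ++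
  [seq cone P | P <- vbasis {:V (linv b)}].
exists (\sum_b size (s b))%N, (fun b i => (s b)`_i); split=> [b i|b P Q].
  have [si|si] := ltnP i (size (s b)); last first.
    exists 0, 0; rewrite nth_default // /state !cone0 addr0.
    by have := smooth_repP pi (-1) ((gen b)^-1)%g 0 0; rewrite scaler0 addr0 scaleN1r addNr.
  have := mem_nth 0 si; rewrite mem_cat => /orP[]/mapP[P _ ->].
    by exists P, 0; rewrite /state cone0 addr0.
  exists 0, P; rewrite /state cone0 -[LHS]add0r; congr (_ + _).
  by have := smooth_repP pi (-1) ((gen b)^-1)%g 0 0; rewrite scaler0 addr0 scaleN1r addNr.
have [k kE] : in_span (s b) (state P Q).
  apply: in_span_cat; apply: in_span_linear => k P1 P2; rewrite cone_linear //.
  exact: smooth_repP.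
have sD : (size (s b) <= \sum_b size (s b))%N by rewrite (bigD1 b) //= leq_addr.
exists k; rewrite kE -(subnKC sD) big_split_ord /= [X in _ = _ + X]big1 ?addr0 // => i _.
by rewrite nth_default ?scaler0 // leq_addr.
Qed.

Lemma coef_sum D (k : nat -> R[i]) (e : nat -> smooth S) v x :
  coef (\sum_(i < D) k i *: e i) v x = \sum_(i < D) k i * coef (e i) v x.
Proof.
elim: D => [|D IHD]; first by rewrite !big_ord0 /coef (sform0l pi).
by rewrite !big_ord_recr /= addrC (coefP pi) IHD addrC.
Qed.

(** Coefficients of states evolve linearly along a word, hence so do the products of two of them,
    and squared moduli are combinations of such products. Finitely many sums of products over
    spheres therefore form a linear system. *)
Lemma coef_linrec u g : linrec (fun k => \sum_(x <- sph 'I_n.+2 k) sqn (coef u (cl g) x)).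
Proof.
elim/smoothW: u => f.
have [D [e [e_state state_e]]] := state_span.
pose K := lev g.
have step c v (P : V c) : hcut (pred1 c) v = cone P -> exists k : nat -> R[i],
    forall x, (K <= len x)%N -> reduced (c :: word x) ->
    coef (smooth_rep ((gen c)^-1)%g v) (cl g) x = \sum_(i < D) k i * coef (e c i) (cl g) x.
  move=> vP; have [Q QE] := coef_state g vP; have [k kE] := state_e c P Q.
  by exists k => x Kx cx; rewrite QE // kE coef_sum.
(* [th (c, b, i)] expresses the [i]-th generating state at [b], advanced by the letter [c], in the
   generating states at [c]. *)
have /boolp.choice[th thE] (p : alphabet n * alphabet n * 'I_D) : exists k : nat -> R[i],
    p.1.1 != linv p.1.2 -> forall x, (K <= len x)%N -> reduced (p.1.1 :: word x) ->
    coef (e p.1.2 p.2) (cl g) (gen p.1.1 * x)%g = \sum_(i < D) k i * coef (e p.1.1 i) (cl g) x.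
  case: p => -[c b] i /=; have [->|cb] := eqVneq c (linv b); first by exists (fun=> 0).
  have [P [Q eE]] := e_state b i.
  have [|k kE] := @step c (e b i) (H c b P); first by rewrite eE hcut_state.
  by exists k => _ x Kx cx; rewrite -kE // (coef_rep pi) invgK.
(* The letter in the index restricts the sum to the words that may follow it. *)
pose Y k (j : alphabet n * ('I_D * 'I_D)) : R[i] :=
  \sum_(x <- sph 'I_n.+2 k | reduced (j.1 :: word x))
     coef (e j.1 j.2.1) (cl g) x * Num.conj (coef (e j.1 j.2.2) (cl g) x).
pose M (j i : alphabet n * ('I_D * 'I_D)) : R[i] := if i.1 != linv j.1 then
  th (i.1, j.1, j.2.1) i.2.1 * Num.conj (th (i.1, j.1, j.2.2) i.2.2) else 0.
have YM k j : (K <= k)%N -> Y k.+1 j = \sum_i M j i * Y k i.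
  case: j => b [i j] Kk; rewrite /Y big_mkcond /= -(add1n k) sph_split (sum_sph1 xpredT).
  rewrite -(pair_bigA _ (fun c p => M (b, (i, j)) (c, p) * Y k (c, p))) /=.
  apply: eq_bigr => c _; rewrite /M /Y /=; case: (boolP (c != linv b)) => [cb|]; last first.
    rewrite negbK => /eqP cb; rewrite [RHS]big1 => [|p _]; last by rewrite mul0r.
    rewrite big1 // => x cx; rewrite ifF //; apply/negbTE.
    by rewrite push_cons //= cb eqxx.
  under [RHS]eq_bigr do rewrite mulr_sumr.
  rewrite exchange_big /= big_seq_cond [RHS]big_seq_cond; apply: eq_bigr => x /andP[].
  rewrite mem_sph => /eqP xk cx; rewrite push_cons //= cb cx /=.
  have Kx : (K <= len x)%N by rewrite xk.
  rewrite (thE (c, b, i) cb x Kx cx) (thE (c, b, j) cb x Kx cx) /= rmorph_sum mulr_suml.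
  rewrite -(pair_bigA _ (fun i' j' : 'I_D => th (c, b, i) i' * Num.conj (th (c, b, j) j') *
      (coef (e c i') (cl g) x * Num.conj (coef (e c j') (cl g) x)))) /=.
  apply: eq_bigr => i' _; rewrite mulr_sumr; apply: eq_bigr => j' _.
  by rewrite rmorphM; ring.
have [d [r rE]] := linear_orbit_linrec YM.
(* After a prefix of this length, the vector restricted to the last letter is a cone vector, so the
   linear evolution of states can start. *)
pose L := (lev f).+1.
have start (y : G) : exists p : alphabet n * (nat -> R[i]), len y = L ->
    forall x, (reduced (word y ++ word x) = reduced (p.1 :: word x)) /\
    ((K <= len x)%N -> reduced (p.1 :: word x) ->
    coef (cl f) (cl g) (y * x)%g = \sum_(i < D) p.2 i * coef (e p.1 i) (cl g) x).
  have [yL|yL] := eqVneq (len y) L; last first.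
    by exists ((ord0, true), fun=> 0) => /eqP; rewrite (negbTE yL).
  have y0 : (0 < len y)%N by rewrite yL.
  have [z zy /(_ (ord0, true))] := split_last y0; move: (last_letter _ y) => b [yE zb].
  have fz : (lev f <= len z)%N by rewrite -ltnS zy yL.
  have := hcut_rep_cone (levP f) fz; move=> /(_ b).
  rewrite -yE zy yL => /(_ erefl)/step [k kE]; exists (b, k) => _ x /=; split.
    rewrite yE word_mul_gen // cat_rcons; case E: (word x) => [|c s].
      rewrite cats1 zb //.
    have rx : reduced (c :: s) by rewrite -E word_reduced.
    rewrite -cat_rcons reduced_cat_head ?last_rcons //.
    by rewrite -size_eq0 size_rcons /= /reduced /= andbC; move: rx; rewrite /reduced /= => ->.
  move=> Kx bx; rewrite -kE // -(smooth_repM pi) (coef_rep pi); congr (coef _ _ _).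
  by rewrite invgM !invgK yE.
have {start}/boolp.choice[p pE] := start.
(* The recurrence has complex coefficients; since the sphere sums are real, its real part is again a
   recurrence. *)
apply: (@eventually_linrec _ _ (L + K) d (fun i => complex.Re (r i))) => k LKk.
have NE k' : (L + K <= k')%N -> (\sum_(x <- sph 'I_n.+2 k') sqn (coef (cl f) (cl g) x))%:C%C =
   \sum_(y <- sph 'I_n.+2 L) \sum_(i < D) \sum_(j < D)
     (p y).2 i * Num.conj ((p y).2 j) * Y (k' - L)%N ((p y).1, (i, j)).
  move=> Lk; have Lk' : (L <= k')%N by apply: leq_trans Lk; exact: leq_addr.
  rewrite -{1}(subnKC Lk') sph_split rmorph_sum big_seq [RHS]big_seq.
  apply: eq_bigr => y; rewrite mem_sph => /eqP yL; have {}pE := pE y yL.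
  rewrite rmorph_sum.
  under [RHS]eq_bigr do under eq_bigr do rewrite /Y /= mulr_sumr.
  under [RHS]eq_bigr do rewrite exchange_big /=.
  rewrite [RHS]exchange_big /= big_seq_cond [RHS]big_seq_cond.
  apply: eq_big => [x|x /andP[]]; first by rewrite (pE x).1.
  rewrite mem_sph (pE x).1 => /eqP xk px; rewrite sqnE normCK (pE x).2 //; last first.
    by rewrite xk leq_subRL.
  rewrite rmorph_sum mulr_suml; apply: eq_bigr => i _; rewrite mulr_sumr; apply: eq_bigr => j _.
  by rewrite rmorphM; ring.
have : (\sum_(x <- sph 'I_n.+2 (k + d)) sqn (coef (cl f) (cl g) x))%:C%C =
    \sum_(t < d) r t * (\sum_(x <- sph 'I_n.+2 (k + t)) sqn (coef (cl f) (cl g) x))%:C%C.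
  rewrite NE ?(leq_trans LKk) ?leq_addr //.
  under [RHS]eq_bigr => t _ do rewrite NE ?(leq_trans LKk) ?leq_addr // mulr_sumr.
  rewrite [RHS]exchange_big /=; apply: eq_bigr => y _.
  under [RHS]eq_bigr => t _ do rewrite mulr_sumr.
  rewrite [RHS]exchange_big /=; apply: eq_bigr => i _.
  under [RHS]eq_bigr => t _ do rewrite mulr_sumr.
  rewrite [RHS]exchange_big /=; apply: eq_bigr => j _.
  have Lk : (L <= k)%N by apply: leq_trans LKk; exact: leq_addr.
  rewrite -addnBAC // rE ?leq_subRL // mulr_sumr; apply: eq_bigr => t _.
  by rewrite -addnBAC // mulrCA.
move/(congr1 (@complex.Re R)); rewrite Re_sum /= => ->; apply: eq_bigr => t _.
by case: (r t) => a b /=; rewrite mulr0 subr0.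
Qed.

End Recurrence.

(** * Coefficients are not square summable *)

(** The dual basis [w] bounds the coordinates of [v] by its norm; Cauchy-Schwarz on the expansion of
    [v] gives [N^2 <= K N T], and one factor [N] cancels. *)
Lemma dot_le_vbasis (R : realType) (U : vectType R[i]) (form : {dot U for (@Num.conj R[i])}) :
  exists2 K : R, 0 <= K & forall v, complex.Re (form v v) <=
    K * \sum_(i < \dim {:U}) Normc.normc (form (vbasis {:U})`_i v) ^+ 2.
Proof.
have fge0 v : 0 <= complex.Re (form v v) by have := dnorm_ge0 form v; rewrite lecE => /andP[].
have fRe v : (complex.Re (form v v))%:C%C = form v v.
  by apply: RRe_real; apply: ger0_real; exact: dnorm_ge0.
have CS v w : Normc.normc (form v w) ^+ 2 <= complex.Re (form v v) * complex.Re (form w w).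
  rewrite -lecR sqnE rmorphM /= !fRe.
  by have [] := CauchySchwarz form v w.
have /boolp.choice[w we] (j : 'I_(\dim {:U})) : exists w,
    forall i : 'I_(\dim {:U}), form w (vbasis {:U})`_i = (i == j)%:R.
  exact: (dot_vbasis_solve form (fun i => (i == j)%:R)).
pose K := \sum_j complex.Re (form (w j) (w j)).
have K0 : 0 <= K by exact: sumr_ge0.
exists K => // v; set N := complex.Re _; set T := \sum_(i < _) _.
have T0 : 0 <= T by apply: sumr_ge0 => i _; exact: sqr_ge0.
pose x i := coord (vbasis {:U}) i v.
have wv j : form (w j) v = Num.conj (x j).
  rewrite {1}(coord_vbasis (memvf v)) linear_sumr (bigD1 j) //= linearZr_LR /= we eqxx mulr1.
  by rewrite big1 ?addr0 // => i ij; rewrite linearZr_LR /= we (negbTE ij) mulr0.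
have xle j : Normc.normc (x j) ^+ 2 <= complex.Re (form (w j) (w j)) * N.
  by rewrite -normc_conj -wv.
have NE : N%:C%C = \sum_(i < \dim {:U}) x i * form (vbasis {:U})`_i v.
  rewrite fRe {1}(coord_vbasis (memvf v)) linear_sumlz /=.
  by apply: eq_bigr => i _; rewrite linearZl_LR.
have NT : N ^+ 2 <= (K * N) * T.
  have -> : N = Normc.normc N%:C%C.
    by rewrite /= expr0n addr0 sqrtr_sqr ger0_norm // fge0.
  rewrite {1}NE; apply: (@le_trans _ _ ((\sum_(i < \dim {:U}) Normc.normc (x i) *
      Normc.normc (form (vbasis {:U})`_i v)) ^+ 2)).
    rewrite lerXn2r ?nnegrE ?normc_ge0 ?sumr_ge0 // => [i _|]; first by rewrite mulr_ge0 ?normc_ge0.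
    apply: le_trans (normc_sum _ _ _) _; apply: ler_sum => i _.
    by rewrite ComplexField.Normc.normcM.
  apply: (@le_trans _ _ ((\sum_(i < \dim {:U}) Normc.normc (x i) ^+ 2) * T)).
    apply: sum_sqr_le => i _; rewrite ?mulr_ge0 ?normc_ge0 ?sqr_ge0 ?exprMn //.
  apply: ler_wpM2r => //.
  have -> : Normc.normc N%:C%C = N by rewrite /= expr0n addr0 sqrtr_sqr ger0_norm // fge0.
  by rewrite mulr_suml; apply: ler_sum.
have [N0|N0] := leP N 0; first by apply: le_trans N0 _; rewrite mulr_ge0.
by rewrite -(ler_pM2r N0) -expr2; apply: le_trans NT _; rewrite mulrAC.
Qed.

Section NotSquareSummable.
Variables (R : realType) (n : nat) (S : normalizedSystem R n).
Variable pi : multiplicativeRep S.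
Local Notation V := (sysV S).
Local Notation B := (sysB S).
Local Notation G := (Gamma n).
Local Notation cl f := (\pi_(smooth S)%qT f).
Local Notation sqn z := (Normc.normc z ^+ 2).
Implicit Types (f g h : multfun S) (x y z : G) (a b c : alphabet n) (u v w : smooth S).

Lemma sform_ge0 u : 0 <= complex.Re (smooth_form u u).
Proof.
elim/smoothW: u => f; rewrite (smooth_form_level (levP f) (levP f) (ltnSn _)) Re_sum.
by apply: sumr_ge0 => y _; exact: form_ge0.
Qed.

Lemma sform_Re u : (complex.Re (smooth_form u u))%:C%C = smooth_form u u.
Proof.
apply: RRe_real; apply: ger0_real.
elim/smoothW: u => f; rewrite (smooth_form_level (levP f) (levP f) (ltnSn _)).
by apply: sumr_ge0 => y _; exact: dnorm_ge0.
Qed.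

Lemma sform_CS u v : sqn (smooth_form u v) <=
  complex.Re (smooth_form u u) * complex.Re (smooth_form v v).
Proof.
elim/smoothW: u => f; elim/smoothW: v => g; pose N := (lev f + lev g)%N.
have fN : multiplicative_from N f by apply: multiplicative_fromW (levP f); exact: leq_addr.
have gN : multiplicative_from N g by apply: multiplicative_fromW (levP g); exact: leq_addl.
rewrite (smooth_form_level fN gN (ltnSn _)) (smooth_form_level fN fN (ltnSn _)).
rewrite (smooth_form_level gN gN (ltnSn _)) !Re_sum.
apply: (@le_trans _ _ ((\sum_(y <- sph 'I_n.+2 N.+1) Normc.normc (last_form f g y)) ^+ 2)).
  by rewrite lerXn2r ?nnegrE ?normc_ge0 ?normc_sum ?sumr_ge0 // => y _; exact: normc_ge0.
by apply: sum_sqr_le => y _; split; rewrite ?normc_ge0 ?form_ge0 ?form_CS.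
Qed.

Definition sphere_norm u k := \sum_(x <- sph 'I_n.+2 k) sqn (coef u u x).

Lemma sform_suml (s : seq G) (k : G -> R[i]) (F : G -> smooth S) v :
  smooth_form (\sum_(x <- s) k x *: F x) v = \sum_(x <- s) k x * smooth_form (F x) v.
Proof.
elim: s => [|x s IHs]; first by rewrite !big_nil (sform0l pi).
by rewrite !big_cons (sformPl pi) IHs.
Qed.

Lemma sform_sumr (s : seq G) (k : G -> R[i]) (F : G -> smooth S) v :
  smooth_form v (\sum_(x <- s) k x *: F x) = \sum_(x <- s) Num.conj (k x) * smooth_form v (F x).
Proof.
rewrite (sformC pi) sform_suml rmorph_sum; apply: eq_bigr => x _.
by rewrite rmorphM; congr (_ * _); rewrite [RHS](sformC pi).
Qed.

Lemma Re_le_normc (z : R[i]) : complex.Re z <= Normc.normc z.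
Proof. by rewrite -lecR; apply: le_trans (normc_ge_Re z); rewrite lecR ler_norm. Qed.

(* If the convolution by the coefficient of [u] is bounded, then so is the map
   from [l^2] that sends a finitely supported [k] to [sum_x k(x) pi(x) u]; apply its adjoint to [v]. *)
Lemma coef_bessel u v (K : R) : (forall k, \sum_(i < k) \sum_(j < k) Num.sqrt (sphere_norm u (i + j)) <= K) ->
  forall k, \sum_(x <- wball 'I_n.+2 k) sqn (coef v u x) <= complex.Re (smooth_form v v) * K.
Proof.
move=> uK k; set T := \sum_(x <- _) _.
have T0 : 0 <= T by apply: sumr_ge0 => x _; exact: sqr_ge0.
have K0 : 0 <= K by apply: le_trans (uK 0%N); rewrite big_ord0.
(* With the coefficients of [v] themselves as weights, the pairing of [v] with [w] is [T], while the
   squared norm of [w] is at most [T * K]. *)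
pose w := \sum_(x <- wball 'I_n.+2 k) coef v u x *: smooth_rep x u.
have vw : smooth_form v w = T%:C%C.
  rewrite sform_sumr [RHS]rmorph_sum; apply: eq_bigr => x _.
  by rewrite -[RHS]/((sqn (coef v u x))%:C%C) sqnE normCK mulrC.
have ww : complex.Re (smooth_form w w) <= T * K.
  apply: le_trans (Re_le_normc _) _.
  apply: (@le_trans _ _ (\sum_(x <- wball 'I_n.+2 k) \sum_(y <- wball 'I_n.+2 k)
      Normc.normc (coef v u x) * Normc.normc (coef v u y) * Normc.normc (coef u u (x^-1 * y)%g))).
    rewrite sform_suml; apply: le_trans (normc_sum _ _ _) _; apply: ler_sum => x _.
    rewrite sform_sumr mulr_sumr; apply: le_trans (normc_sum _ _ _) _; apply: ler_sum => y _.
    rewrite !ComplexField.Normc.normcM normc_conj mulrA.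
    by rewrite -(coef_rep pi) -/(coef (smooth_rep x u) u y).
  apply: le_trans (haagerup k (fun x => normc_ge0 _) (fun x => normc_ge0 _)) _.
  by apply: ler_wpM2l => //; exact: uK.
have TT : T ^+ 2 <= complex.Re (smooth_form v v) * (T * K).
  have -> : T ^+ 2 = sqn (smooth_form v w).
    by rewrite vw /= expr0n addr0 sqr_sqrtr ?sqr_ge0.
  by apply: le_trans (sform_CS v w) _; apply: ler_wpM2l => //; exact: sform_ge0.
have [T0'|T0'] := leP T 0; first by apply: le_trans T0' _; rewrite mulr_ge0 ?sform_ge0.
by rewrite -(ler_pM2r T0') -expr2; apply: le_trans TT _; rewrite mulrAC mulrA.
Qed.

(** The squared norm is read on the sphere of radius [k + 1], where each value of [f] is controlled
    by its pairings with a basis, that is, by coefficients of finitely many cone vectors. The list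
    is the same for all [k]. *)
Lemma sphere_norm_cones f : exists (L : seq (R * smooth S)),
  (forall p, p \in L -> 0 <= p.1) /\
  forall k, (lev f <= k)%N -> complex.Re (smooth_form (cl f) (cl f)) <=
    \sum_(p <- L) p.1 * \sum_(x <- sph 'I_n.+2 k) sqn (coef p.2 (cl f) x).
Proof.
have exK a : exists K : R, 0 <= K /\ forall v : V a, complex.Re (B a v v) <=
    K * \sum_(i < \dim {:V a}) Normc.normc (B a (vbasis {:V a})`_i v) ^+ 2.
  by have [K K0 KP] := dot_le_vbasis (B a); exists K.
have /boolp.choice[K KP] := exK.
pose I := [seq (a, i) | a <- enum {: alphabet n}, i <- iota 0 (\dim {:V a})].
pose h (p : alphabet n * nat) := (K p.1, cone (vbasis {:V p.1})`_p.2).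
exists (map h I); split=> [_ /mapP[p _ ->]|k fk]; first exact: (KP p.1).1.
rewrite (smooth_form_level (levP f) (levP f) (fk : (_ < k.+1)%N)) Re_sum -[X in sph _ X]addn1.
rewrite sph_split big_map big_allpairs_dep /=.
under eq_bigr do rewrite (sum_sph1 (fun z => reduced (word _ ++ word z))).
pose E b i x := sqn (coef (cone (vbasis {:V b})`_i) (cl f) x).
apply: (@le_trans _ _ (\sum_(y <- sph 'I_n.+2 k) \sum_b
    K b * \sum_(i < \dim {:V b}) E b i (y^-1)%g)).
  rewrite big_seq [leRHS]big_seq; apply: ler_sum => y; rewrite mem_sph => /eqP yk.
  rewrite [leRHS](bigID (fun b => reduced (word y ++ word (gen b)))) /= -[leLHS]addr0.
  apply: lerD; last by apply: sumr_ge0 => b _; rewrite mulr_ge0 ?(KP b).1 ?sumr_ge0 // => i _;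
    exact: sqr_ge0.
  apply: ler_sum => b yb; have yb' : len (y * gen b)%g = (len y).+1.
    by apply/eqP; rewrite len_mul_gen_reduced.
  rewrite (last_form_eq f f (last_letter_mul_gen _ yb')).
  apply: le_trans ((KP b).2 _) _; apply: ler_wpM2l; first exact: (KP b).1.
  rewrite le_eqVlt; apply/orP; left; apply/eqP; apply: eq_bigr => i _.
  by rewrite /E (coef_cone _ (levP f)) ?invgK ?len_finv ?yk // -cats1.
rewrite exchange_big /= [leRHS]big_enum /=; apply: ler_sum => b _.
have -> : iota 0 (\dim {:V b}) = index_iota 0 (\dim {:V b}) by rewrite /index_iota subn0.
rewrite -mulr_sumr exchange_big /= big_mkord.
rewrite mulr_sumr; apply: ler_sum => i _; apply: ler_wpM2l; first exact: (KP b).1.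
rewrite le_eqVlt; apply/orP; left; apply/eqP.
rewrite -(big_map (fun x => x^-1)%g xpredT (fun x => sqn (coef (cone (vbasis {:V b})`_i) (cl f) x))).
exact/perm_big/sph_inv_perm.
Qed.

Lemma abel_bound0_sphere_norm u : abel_bound 0 u u ->
  exists C : R, forall k, \sum_(i < k) sphere_norm u i <= C.
Proof.
move=> [C uC]; exists (2 * C) => k.
(* By Bernoulli's inequality [r ^+ k.+1] is at least 1/2, so the weighted sum is at least half of
   the plain one. *)
pose d : R := (2 * (k.+1)%:R)^-1; pose r := 1 - d.
have k0 : 0 < (k.+1)%:R :> R by rewrite ltr0n.
have d0 : 0 < d by rewrite invr_gt0 mulr_gt0.
have dE : (k.+1)%:R * d = 2^-1 by rewrite /d invfM mulrCA divff ?mulr1 ?lt0r_neq0.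
have d1 : d <= (k.+1)%:R * d by apply: ler_peMl; [exact: ltW | rewrite ler1n].
have r2 : 2^-1 <= r by rewrite /r; lra.
have r1 : r < 1 by rewrite /r; lra.
have := uC r k r2 r1; rewrite expr0 divr1 => h.
rewrite mulrC -ler_pdivrMr //; apply: le_trans h; rewrite sum_wball mulr_suml.
apply: ler_sum => i _; rewrite /sphere_norm mulr_suml big_seq [leRHS]big_seq.
apply: ler_sum => x; rewrite mem_sph => /eqP ->; apply: ler_wpM2l; first exact: sqr_ge0.
apply: (@le_trans _ _ (r ^+ k.+1)); last first.
  by apply: ler_wiXn2l; [lra | exact: ltW | exact: leq_trans (ltnW (ltn_ord i)) (leqnSn k)].
apply: le_trans (bernoulli_le _ (ltW d0) _); last lra.
by rewrite dE; lra.
Qed.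

Lemma summable_to0 (s : nat -> R) C : (forall k, 0 <= s k) ->
  (forall k, \sum_(i < k) s i <= C) ->
  forall e, 0 < e -> exists K, forall k, (K <= k)%N -> `|s k| <= e.
Proof.
move=> s0 sC e e0.
have /cvg_series_cvg_0 : cvgn (series s).
  apply: nondecreasing_is_cvgn; first exact: nondecreasing_series.
  by exists C => _ [k _ <-]; rewrite /series /= big_mkord.
move=> /cvgr0Pnorm_le /(_ e e0) [K _ sK]; exists K => k Kk; exact: sK.
Qed.

Lemma not_abel_bound0 u : u != 0 -> ~ abel_bound 0 u u.
Proof.
move=> u0 uO; have [C sC] := abel_bound0_sphere_norm uO.
have s0 k : 0 <= sphere_norm u k by apply: sumr_ge0 => x _; exact: sqr_ge0.
have sL : linrec (sphere_norm u).
  have := coef_linrec pi u (repr u); rewrite reprK.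
  by rewrite /sphere_norm.
have [D [t [D0 t0 t1 sD]]] := linrec_decay sL (summable_to0 s0 sC).
(* Haagerup's inequality involves square roots of the sphere sums, which decay like powers of
   [q]. *)
pose q := Num.sqrt t; have q0 : 0 <= q by exact: sqrtr_ge0.
have q1 : q < 1 by rewrite -sqrtr1 ltr_sqrt.
pose K := Num.sqrt D * (1 - q)^-1 * (1 - q)^-1.
have q1' : 0 <= (1 - q)^-1 by rewrite invr_ge0 subr_ge0 ltW.
have sK k : \sum_(i < k) \sum_(j < k) Num.sqrt (sphere_norm u (i + j)) <= K.
  apply: (@le_trans _ _ (\sum_(i < k) \sum_(j < k) Num.sqrt D * q ^+ i * q ^+ j)).
    apply: ler_sum => i _; apply: ler_sum => j _.
    rewrite -mulrA -exprD.
    have -> : Num.sqrt D * q ^+ (i + j) = Num.sqrt (D * t ^+ (i + j)).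
      by rewrite sqrtrM // -(sqr_sqrtr (ltW t0)) -exprM mulnC exprM sqrtr_sqr ger0_norm ?exprn_ge0.
    by apply: ler_wsqrtr; apply: le_trans (ler_norm _) (sD _).
  under eq_bigr do rewrite -mulr_sumr.
  rewrite -mulr_suml -mulr_sumr.
  by rewrite ler_pM ?mulr_ge0 ?sqrtr_ge0 ?ler_wpM2l ?sum_geo_le ?sumr_ge0 // => i _; exact: exprn_ge0.
move: u0 {uO sC s0 sL D0 t0 t1 sD} sK; elim/smoothW: u => f f0 sK.
have [L [L0 Lf]] := sphere_norm_cones f.
set N := complex.Re _ in Lf.
have N0 : 0 < N.
  rewrite lt_neqAle sform_ge0 andbT; apply/eqP => N0; case/eqP: f0; apply: smooth_form_eq0.
  by rewrite -sform_Re -/N -N0.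
pose A := \sum_(p <- L) p.1 * (complex.Re (smooth_form p.2 p.2) * K).
(* Each of [m] consecutive spheres contributes at least [N], while the Bessel bound keeps the total
   below [A]. *)
have bound m : m%:R * N <= A.
  apply: (@le_trans _ _ (\sum_(p <- L) p.1 *
      \sum_(x <- wball 'I_n.+2 (lev f + m)) sqn (coef p.2 (cl f) x))); last first.
    rewrite big_seq [leRHS]big_seq; apply: ler_sum => p pL.
    by apply: ler_wpM2l; [exact: L0 | exact: (coef_bessel p.2 sK)].
  apply: (@le_trans _ _ (\sum_(i < m) \sum_(p <- L) p.1 *
     \sum_(x <- sph 'I_n.+2 (lev f + i)) sqn (coef p.2 (cl f) x))).
    rewrite -[X in X%:R](card_ord m) mulr_natl -sumr_const; apply: ler_sum => i _.
    by apply: Lf; exact: leq_addr.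
  rewrite exchange_big /= big_seq [leRHS]big_seq; apply: ler_sum => p pL.
  rewrite -mulr_sumr; apply: ler_wpM2l; first exact: L0.
  rewrite sum_wball big_split_ord /= lerDr sumr_ge0 // => i _.
  by rewrite sumr_ge0 // => x _; exact: sqr_ge0.
have [m Am] : exists m : nat, A / N < m%:R.
  by exists (Num.truncn (A / N)).+1; exact: truncnS_gt.
by move: Am; rewrite ltr_pdivrMr // ltNge bound.
Qed.

End NotSquareSummable.

(** * From Abel sums to the damped coefficients *)

Section Asymptotics.
Variables (R : realType) (n : nat) (S : normalizedSystem R n).
Variable pi : multiplicativeRep S.
Local Notation sqn z := (Normc.normc z ^+ 2).
Implicit Types (v : smooth S).

Definition abel_lower m v := exists c d : R, [/\ 0 < c, 0 < d &
  forall r, 1 - d < r -> r < 1 -> exists k,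
    c / (1 - r) ^+ m <= \sum_(x <- wball 'I_n.+2 k) sqn (coef v v x) * r ^+ len x].

Lemma abel_dichotomy m v : abel_bound m v v \/ abel_lower m.+1 v.
Proof.
have E r k : \sum_(x <- wball 'I_n.+2 k) sqn (coef v v x) * r ^+ len x =
    \sum_(i < k) sphere_norm v i * r ^+ i.
  rewrite sum_wball; apply: eq_bigr => i _; rewrite /sphere_norm mulr_suml.
  rewrite big_seq [RHS]big_seq; apply: eq_bigr => x; by rewrite mem_sph => /eqP ->.
have s0 k : 0 <= sphere_norm v k by apply: sumr_ge0 => x _; exact: sqr_ge0.
have sL : linrec (sphere_norm v).
  by have := coef_linrec pi v (repr v); rewrite reprK.
have [C vC] := abel_bound3 v v.
have sB r : 0 < r -> r < 1 -> exists D : R, forall k, \sum_(i < k) sphere_norm v i * r ^+ i <= D.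
  (* [abel_bound3] speaks only of radii at least 1/2; smaller ones follow by monotonicity. *)
  move=> r0 r1; pose r' := Num.max r 2^-1.
  exists (C / (1 - r') ^+ 3) => k.
  have r'1 : r' < 1 by rewrite gt_max r1 invf_lt1 // ltr1n.
  have r'2 : 2^-1 <= r' by rewrite le_max lexx orbT.
  apply: le_trans (vC r' k r'2 r'1); rewrite E.
  by apply: psum_le_r => //; [exact: ltW | rewrite le_max lexx].
have [[D sD]|[c [d [c0 d0 sc]]]] := linrec_dichotomy m s0 sL sB.
  by left; exists D => r k r2 r1; rewrite E; exact: sD.
right; exists c, d; split=> // r rd r1.
by have [k kc] := sc r rd r1; exists k; rewrite E.
Qed.

Lemma damped_coefE eps v x : Normc.normc (damped_coef pi eps v x) ^+ 2 =
  sqn (coef v v x) * expR (- (2 * eps)) ^+ len x.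
Proof.
rewrite /damped_coef rep_smooth embed_isometry ComplexField.Normc.normcM exprMn.
congr (_ * _); rewrite /= expr0n addr0 sqrtr_sqr ger0_norm ?expR_ge0 //.
rewrite -!expRM_natl; congr expR; ring.
Qed.

(** With [r = exp(-2 eps)] and [eps < 1/4] one has [eps <= 1 - r <= 2 eps], so powers of [1 - r] and
    of [eps] are interchangeable. *)
Lemma l2norm_sq_bounds alpha v : abel_bound alpha v v -> abel_lower alpha v ->
  exists c1 c2 : R, [/\ 0 < c1, 0 < c2 & \forall eps \near 0^'+,
    ((c1 * (1 / eps) ^+ alpha)%:E <= l2norm_sq (damped_coef pi eps v)
      <= (c2 * (1 / eps) ^+ alpha)%:E)%E].
Proof.
move=> [C vC] [c [d [c0 d0 vc]]].
(* The power of 2 comes from [1 - r <= 2 eps]; [C] may be nonpositive, hence the positive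
   majorant. *)
exists (c / 2 ^+ alpha), (`|C| + 1); split; first by rewrite divr_gt0 ?exprn_gt0.
  by rewrite ltr_wpDl.
have d4 : 0 < Num.min (4^-1) (d / 2) by rewrite lt_min invr_gt0 ltr0n divr_gt0.
near=> eps.
have eps0 : 0 < eps by near: eps; exact: nbhs_right_gt.
have /andP[eps4 epsd] : (eps < 4^-1) && (eps < d / 2).
  by rewrite -lt_min; near: eps; exact: nbhs_right_lt.
pose r := expR (- (2 * eps)).
have rub : r <= 1 - eps.
  have : r * expR (2 * eps) = 1 by rewrite -expRD addNr expR0.
  have := expR_ge1Dx (2 * eps); have := expR_ge0 (- (2 * eps)); rewrite -/r.
  move: (expR (2 * eps)) => e r0 e1 re.
  have : r * (1 + 2 * eps) <= 1 by apply: le_trans (ler_wpM2l r0 e1) _; rewrite re.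
  nra.
have rlb : 1 - 2 * eps <= r by have := expR_ge1Dx (- (2 * eps)).
have r1 : r < 1 by lra.
have r1' : 0 < 1 - r by lra.
have r2 : 2^-1 <= r by lra.
have rd : 1 - d < r by lra.
apply/andP; split.
  have [k vck] := vc r rd r1; apply: esum_ge.
  have kfin : finite_set [set x : Gamma n | (len x < k)%N].
    by apply: (sub_finite_set _ (@finite_ball _ k)) => x /= xk; exact: ltnW.
  exists [set x | (len x < k)%N]; first by split.
  rewrite fsumEFin // fsbig_finite //.
  rewrite lee_fin -[X in _ <= \sum_(x <- X) _]/(wball 'I_n.+2 k).
  under eq_bigr do rewrite damped_coefE -/r.
  apply: le_trans vck; rewrite -mulrA; apply: ler_wpM2l; first exact: ltW.
  have -> : (2 ^+ alpha)^-1 * (1 / eps) ^+ alpha = (2 * eps)^-1 ^+ alpha.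
    by rewrite div1r invfM exprMn !exprVn.
  rewrite -exprVn; have e0 : 0 < 2 * eps by rewrite mulr_gt0.
  apply: lerXn2r; rewrite ?nnegrE ?invr_ge0; [exact: ltW | exact: ltW |].
  by rewrite lef_pV2 ?posrE //; lra.
apply: ub_ereal_sup => _ [A [Afin _] <-].
rewrite fsumEFin // fsbig_finite // lee_fin.
under eq_bigr do rewrite damped_coefE -/r.
pose k := (\max_(x <- enum_fset (fset_set A)) len x).+1.
apply: (@le_trans _ _ (\sum_(x <- wball 'I_n.+2 k) sqn (coef v v x) * r ^+ len x)).
  apply: (@sum_sub_le R _ (enum_fset (fset_set A))); first exact: fset_uniq.
    move=> x xA; rewrite mem_wball ltnS.
    by rewrite leq_bigmax_seq.
  by move=> x; rewrite mulr_ge0 ?sqr_ge0 ?exprn_ge0 ?expR_ge0.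
apply: le_trans (vC r k r2 r1) _.
apply: (@le_trans _ _ ((`|C| + 1) / (1 - r) ^+ alpha)).
  apply: ler_wpM2r; first by rewrite invr_ge0 exprn_ge0 // ltW.
  by apply: le_trans (ler_norm C) _; rewrite lerDl.
apply: ler_wpM2l; first by rewrite addr_ge0.
rewrite div1r -!exprVn; apply: lerXn2r; rewrite ?nnegrE ?invr_ge0; [exact: ltW | exact: ltW |].
by rewrite lef_pV2 ?posrE //; lra.
Unshelve. all: by end_near.
Qed.

End Asymptotics.

Theorem theorem1 (R : realType) (n : nat) (S : normalizedSystem R n)
    (irrS : irreducible_system S) (pi : multiplicativeRep S) :
  exists alpha : nat, [/\ (0 < alpha)%N, (alpha <= 3)%N &
    forall v : smooth S, v != 0 ->
      exists c1 c2 : R, [/\ 0 < c1, 0 < c2 &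
        \forall eps \near 0^'+,
          ((c1 * (1 / eps) ^+ alpha)%:E <= l2norm_sq (damped_coef pi eps v)
            <= (c2 * (1 / eps) ^+ alpha)%:E)%E]].
Proof.
(* By the dichotomy, failure of the upper bound of order [m] is the lower bound of order [m + 1]. *)
have concl m : (forall v : smooth S, v != 0 -> ~ abel_bound m v v) ->
    (forall v : smooth S, v != 0 -> abel_bound m.+1 v v) ->
    forall v : smooth S, v != 0 -> exists c1 c2 : R, [/\ 0 < c1, 0 < c2 &
        \forall eps \near 0^'+,
          ((c1 * (1 / eps) ^+ m.+1)%:E <= l2norm_sq (damped_coef pi eps v)
            <= (c2 * (1 / eps) ^+ m.+1)%:E)%E].
  move=> lo up v v0; apply: l2norm_sq_bounds; first exact: up.
  by have [/(lo v v0)|] := abel_dichotomy pi m v.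
have all_of_one m (v : smooth S) : (0 < m)%N -> v != 0 -> abel_bound m v v ->
    forall w : smooth S, w != 0 -> abel_bound m w w.
  by move=> m0 v0 vO w _; exact: (abel_bound_irreducible pi irrS m0 v0 v0 vO).
(* [alpha] is the least positive order whose upper bound holds for some nonzero vector, and hence
   for all; order 0 is excluded by [not_abel_bound0]. *)
have [[v [v0 vO]]|no1] := pselect (exists v : smooth S, v != 0 /\ abel_bound 1 v v).
  exists 1%N; split=> //; apply: concl; last exact: all_of_one vO.
  by move=> w; exact: not_abel_bound0.
have [[v [v0 vO]]|no2] := pselect (exists v : smooth S, v != 0 /\ abel_bound 2 v v).
  exists 2%N; split=> //; apply: concl; last exact: all_of_one vO.
  by move=> w w0 wO; apply: no1; exists w.
exists 3%N; split=> //; apply: concl; last by move=> w _; exact: abel_bound3.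
by move=> w w0 wO; apply: no2; exists w.
Qed.
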